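(* Let $\pi$ be a permutation of $[n]$ and let $\bm{y}$ be an almost optimal displacement vector of $\pi$. After constructing the root of $\mathcal{L}^1(\pi,\bm{y})$ (the unique $L\in\mathcal{L}^1(\pi,\bm{y})$ with no left tangled triple) in $O(n+(\operatorname{inv}(\bm{y}))^3)$ time, one can enumerate all the cyclic ladder lotteries in $\mathcal{L}^1(\pi,\bm{y})$, without duplication, with $O((\operatorname{inv}(\bm{y}))^2)$ delay.
   Context: Let $[n]=\{1,\dots,n\}$ and $\pi$ a permutation of $[n]$. A cyclic ladder lottery $L$ of $\pi$ consists of $n$ vertical lines $1,\dots,n$ and finitely many horizontal bars at distinct heights. Each bar connects lines $k,k+1$ ($1\le k\le n-1$) or lines $n,1$. Start with element $i$ on top of line $i$ and sweep downward; each bar swaps the elements on its two lines. At the bottom, line $j$ must carry $\pi_j$. The route of $i$ is the pseudoline $\mathrm{pl}(L,i)$. On a cylinder, $L$ is an arrangement of $n$ $y$-monotone pseudolines whose intersections are the bars. Lotteries are identified as pseudoline arrangements, i.e. when every pseudoline crosses the same pseudolines in the same order. $\mathcal{L}^1(\pi)$ is the set of those lotteries in which any two pseudolines cross at most once. $\mathit{DV}(L)=(x_1,\dots,x_n)$, where $x_i$ is the number of bars at which $i$ moves one line right (line $k\to k+1$ or $n\to1$) minus the number at which it moves left. $\bm{y}$ is almost optimal if $\bm{y}=\mathit{DV}(L)$ for some $L\in\mathcal{L}^1(\pi)$, and $\mathcal{L}^1(\pi,\bm{y})=\{L\in\mathcal{L}^1(\pi):\mathit{DV}(L)=\bm{y}\}$.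 A triple $\{i,j,k\}$ of distinct elements is tangled if its three pseudolines pairwise cross. Restricting to them, let $p$ be the intersection adjacent to two top endpoints, $q$ the one adjacent to one top and one bottom endpoint, and $r$ the one adjacent to two bottom endpoints. The triple is left tangled if $p,q,r$ appear counterclockwise on the boundary of the enclosed region, and right tangled otherwise. For a displacement vector $\bm{x}$ and $i,j\in[n]$, let $r=i-j$ and $s=(i+x_i)-(j+x_j)$. Define $c_{ij}(\bm{x})=|\{k\in[r,s]:k\equiv 0 \bmod n\}|$ if $r\le s$, and $c_{ij}(\bm{x})=-|\{k\in[s,r]:k\equiv 0\bmod n\}|$ if $s<r$. Set $\operatorname{inv}(\bm{x})=\frac12\sum_{i,j\in[n]}|c_{ij}(\bm{x})|$; this equals the number of intersections of any $L\in\mathcal{L}^1(\pi)$ with $\mathit{DV}(L)=\bm{x}$. An enumeration algorithm has delay $D$ if the time before the first output, between consecutive outputs, and after the last output is each $O(D)$. *)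

(* Defs.v *)
From HB Require Import structures.
From mathcomp Require Import all_boot all_order all_fingroup all_algebra.

Set Implicit Arguments.
Unset Strict Implicit.
Unset Printing Implicit Defensive.

Import Order.TTheory GRing.Theory Num.Theory.

(** * Cyclic ladder lotteries

    Lines and elements are numbered 0, ..., n-1 from left to right.  A bar is
    named after the line at its left end: bar [b] joins line [b] to line
    [ordS b] = b+1 mod n, so bar n-1 joins the last line to the first one.  A
    sequence of bars lists the bars from top to bottom. *)

Section Lotteries.
Variable n : nat.
Implicit Types (L : seq 'I_n) (s : 'S_n) (i j k u v w : 'I_n) (c : 'I_n * 'I_n).

(* [s l] is the element on line [l]; the bar [b] exchanges the elements of its
   two lines. *)
Definition cross_bar s (b : 'I_n) : 'S_n := (tperm b (ordS b) * s)%g.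

Definition bottom L : 'S_n := foldl cross_bar 1%g L.

(* The crossings from top to bottom, each as the pair (element moving right,
   element moving left). *)
Fixpoint crossings_from s L : seq ('I_n * 'I_n) :=
  if L is b :: L' then
    (s b, s (ordS b)) :: crossings_from (cross_bar s b) L'
  else [::].

Definition crossings L := crossings_from 1%g L.

Definition meet i j c := (c == (i, j)) || (c == (j, i)).

Definition crosses L i j := has (meet i j) (crossings L).

Definition route L i : seq 'I_n :=
  pmap (fun c => if c.1 == i then Some c.2
                 else if c.2 == i then Some c.1 else None) (crossings L).

Definition same_arrangement L1 L2 : bool :=
  [forall i, route L1 i == route L2 i].

Definition DV L : {ffun 'I_n -> int} :=
  [ffun i => ((count (fun c => c.1 == i) (crossings L))%:Z
              - (count (fun c => c.2 == i) (crossings L))%:Z)%R].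

(* The first condition only matters for n = 1, where line n and line 1
   coincide and there is no pair of lines to join. *)
Definition lottery1 (pi : 'S_n) L : bool :=
  [&& all (fun b => b != ordS b) L, bottom L == pi
    & [forall i, forall j, (i != j) ==>
        (count (meet i j) (crossings L) <= 1)]].

Definition lottery1_dv (pi : 'S_n) (y : {ffun 'I_n -> int}) L : bool :=
  lottery1 pi L && (DV L == y).

Definition almost_optimal (pi : 'S_n) (y : {ffun 'I_n -> int}) : Prop :=
  exists L, lottery1_dv pi y L.

Definition tangled L i j k : bool :=
  [&& uniq [:: i; j; k], crosses L i j, crosses L i k & crosses L j k].

(* Position, counted from the top, of the (first) bar where i and j cross. *)
Definition depth L i j : nat := find (meet i j) (crossings L).

(* Name the triple so that p = uv, q = uw and r = vw.  The crossing p is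
   adjacent to the top endpoints of u and v, the crossing q to the top endpoint
   of w and the bottom endpoint of u, and the crossing r to the bottom endpoints
   of v and w: this says exactly that p, q, r occur in this order from top to
   bottom.  The region is bounded by the piece of v from p to r on one side, and
   by the piece of u from p to q followed by the piece of w from q to r on the
   other.  So p, q, r are counterclockwise on the boundary iff q is on the left
   side, i.e. iff u leaves p as the left one of the two pseudolines. *)
Definition left_tangled L i j k : bool :=
  tangled L i j k &&
  [exists u, exists v, exists w,
    [&& perm_eq [:: u; v; w] [:: i; j; k],
        depth L u v < depth L u w, depth L u w < depth L v w
      & (v, u) \in crossings L]].

Definition is_root (pi : 'S_n) (y : {ffun 'I_n -> int}) L : bool :=
  lottery1_dv pi y L && [forall i, forall j, forall k, ~~ left_tangled L i j k].

Definition int_range (r s : int) : seq int :=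
  [seq (r + m%:Z)%R | m <- iota 0 `|s - r|%N.+1].

Definition mult_count (r s : int) : nat :=
  count (fun m => (Posz n %| m)%Z) (int_range r s).

Definition c_coef (x : {ffun 'I_n -> int}) i j : int :=
  let r : int := (i%:Z - j%:Z)%R in
  let s : int := ((i%:Z + x i) - (j%:Z + x j))%R in
  if (r <= s)%R then (mult_count r s)%:Z%R else (- (mult_count s r)%:Z)%R.

(* A pseudoline does not cross itself, whereas the formula gives
   c_coef x i i = 1; hence the sum ranges over distinct i and j.  It is even,
   because c_coef x j i = - c_coef x i j for those. *)
Definition inv_dv (x : {ffun 'I_n -> int}) : nat :=
  (\sum_i \sum_(j | j != i) `|c_coef x i j|%N)./2.

End Lotteries.

(** * Model of computation

    A word RAM with a structured control flow: finitely many named registers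
    and a memory, both holding integers, all of whose computed values must be
    bounded by [W] in absolute value (the word size is thus O(log W) bits).
    Every elementary instruction and every test takes one unit of time.  A
    record (here: a ladder lottery) is output one word at a time by [Emit], and
    completed by [EndRecord]. *)

Inductive binop := Add | Sub | Mul | Div.

Definition eval_binop (o : binop) (a b : int) : int :=
  match o with
  | Add => (a + b)%R
  | Sub => (a - b)%R
  | Mul => (a * b)%R
  | Div => (a %/ b)%Z
  end.

Definition register := nat.

Inductive cmd :=
  | Skip
  | Const of register & int               (* x := a *)
  | Op of binop & register & register & register   (* x := y o z *)
  | Read of register & register           (* x := mem[y] *)
  | Write of register & register          (* mem[x] := y *)
  | Emit of register
  | EndRecord
  | Seq of cmd & cmd
  | If of register & cmd & cmd            (* if 0 < x *)
  | While of register & cmd.              (* while 0 < x *)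

Record state := State { regs : register -> int; memory : nat -> int }.

Definition update (T : eqType) (f : T -> int) (a : T) (v : int) : T -> int :=
  fun b => if b == a then v else f b.

Definition set_reg (s : state) x v := State (update (regs s) x v) (memory s).
Definition set_mem (s : state) a v := State (regs s) (update (memory s) a v).

(* The time steps of an execution, in order; each takes one unit of time. *)
Inductive step := Tick | Out of int | Eor.

(* [exec W c s tr s']: started in state s, the command c halts in state s'
   after the time steps tr.  There is no rule for a computed value exceeding
   W, nor for an access to a negative address. *)
Inductive exec (W : nat) : cmd -> state -> seq step -> state -> Prop :=
  | ExecSkip s : exec W Skip s [:: Tick] s
  | ExecConst s x (a : int) :
      `|a|%N <= W -> exec W (Const x a) s [:: Tick] (set_reg s x a)
  | ExecOp s o x y z :
      let v := eval_binop o (regs s y) (regs s z) in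
      `|v|%N <= W -> exec W (Op o x y z) s [:: Tick] (set_reg s x v)
  | ExecRead s x y (a : nat) :
      regs s y = Posz a ->
      exec W (Read x y) s [:: Tick] (set_reg s x (memory s a))
  | ExecWrite s x y (a : nat) :
      regs s x = Posz a ->
      exec W (Write x y) s [:: Tick] (set_mem s a (regs s y))
  | ExecEmit s x : exec W (Emit x) s [:: Out (regs s x)] s
  | ExecEndRecord s : exec W EndRecord s [:: Eor] s
  | ExecSeq s1 s2 s3 c1 c2 tr1 tr2 :
      exec W c1 s1 tr1 s2 -> exec W c2 s2 tr2 s3 ->
      exec W (Seq c1 c2) s1 (tr1 ++ tr2) s3
  | ExecIfPos s s' x c1 c2 tr :
      (0 < regs s x)%R -> exec W c1 s tr s' ->
      exec W (If x c1 c2) s (Tick :: tr) s'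
  | ExecIfNpos s s' x c1 c2 tr :
      (regs s x <= 0)%R -> exec W c2 s tr s' ->
      exec W (If x c1 c2) s (Tick :: tr) s'
  | ExecWhilePos s1 s2 s3 x c tr1 tr2 :
      (0 < regs s1 x)%R -> exec W c s1 tr1 s2 ->
      exec W (While x c) s2 tr2 s3 ->
      exec W (While x c) s1 (Tick :: tr1 ++ tr2) s3
  | ExecWhileNpos s x c :
      (regs s x <= 0)%R -> exec W (While x c) s [:: Tick] s.

(* The trace cut at the ends of records: one segment per record (without its
   final [Eor]), then the segment following the last record. *)
Definition segments (tr : seq step) : seq (seq step) :=
  foldr (fun e gs => if e is Eor then [::] :: gs
                     else (e :: head [::] gs) :: behead gs)
        [:: [::]] tr.

Definition emitted (g : seq step) : seq int :=
  pmap (fun e => if e is Out v then Some v else None) g.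

Definition outputs (tr : seq step) : seq (seq int) :=
  let gs := segments tr in
  [seq emitted g | g <- belast (head [::] gs) (behead gs)].

(* At most D units of time before the completion of the first record, between
   the completions of consecutive records, and after the last one. *)
Definition has_delay (D : nat) (tr : seq step) : bool :=
  all (fun g => (size g).+1 <= D) (segments tr).

(* Register 0 holds n; the memory holds pi_0, ..., pi_(n-1) and then
   y_0, ..., y_(n-1); everything else is 0. *)
Definition input_mem n (pi : 'S_n) (y : {ffun 'I_n -> int}) : seq int :=
  [seq Posz (pi j) | j <- enum 'I_n] ++ [seq y i | i <- enum 'I_n].

Definition initial_state n (pi : 'S_n) (y : {ffun 'I_n -> int}) : state :=
  State (fun x => if x == 0 then Posz n else 0%R)
        (fun a => nth 0%R (input_mem pi y) a).

(* A lottery is output as the list of its bars from top to bottom. *)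
Definition encode n (L : seq 'I_n) : seq int := [seq Posz (val b) | b <- L].

Definition enumerates n (pi : 'S_n) (y : {ffun 'I_n -> int})
    (Ls : seq (seq 'I_n)) : Prop :=
  all (lottery1_dv pi y) Ls /\
  forall L, lottery1_dv pi y L -> count (same_arrangement L) Ls = 1.

(* Main.v *)
(** Lift the lines to the integers.  A lottery with displacement vector y is a
    reduced word of the affine permutation p |-> p + y_p, and because any two
    pseudolines cross at most once, conversely every reduced word of it is such a
    lottery; same arrangement means same commutation class.

    An element a of largest displacement is never passed from the left.  Cutting
    the cylinder along its pseudoline linearly orders the bars available at each
    moment, and every class has a unique normal word, in which each bar is at
    least its predecessor minus one.  These words are generated by depth-first
    search without dead ends: a bar c may follow if each bar d < c - 1 with an
    inverted pair (i, j) is avoidable, i.e. some element right of j must still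
    be passed by j; the leftmost unavoidable bar is then always a possible
    continuation.  Both tests take one scan over the bars in use, so that
    climbing to the next branching and descending to the next word cost inv(y)
    scans each.

    The first word always takes the leftmost bar (i, j), at which no element has
    yet to pass i.  In each tangled triple it thus crosses the middle element
    first with the one moving furthest right, which leaves no left
    tangled triple; conversely, in any such arrangement that bar comes first on
    both of its lines, and uniqueness follows by induction. *)

Require Import Defs.
From HB Require Import structures.
From mathcomp Require Import all_boot all_order all_fingroup all_algebra.
From mathcomp Require Import zify.

Set Implicit Arguments.
Unset Strict Implicit.
Unset Printing Implicit Defensive.

Import Order.TTheory GRing.Theory Num.Theory.

Local Open Scope ring_scope.

(** * Affine permutations and reduced words *)

(** The delay must not depend on n, so no scan may run over all bars. The list [us0], computed once,
    holds only the bars that some element still has to pass from left to right. Each of them occurs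
    in every reduced word, so a scan costs O(inv(y)); and crossing a bar brings no further bar into
    use, so the list stays complete. It covers two periods of lifted bars, because the cut
    pseudoline crosses every other one at most once and hence travels at most N lines.

    Crossing at most once is recast as [narrow], a condition on the displacements alone; this is why
    it passes from one lottery to all reduced words. The search state is the word, the remaining
    displacements and the place of the cut. Crossing a bar is an involution on the displacements, so
    climbing undoes descending in place. *)

Section Affine.
Variable m : nat.
Local Notation N := (m.+1).
Implicit Types (p q : int) (b i j u v w : 'I_N) (D : {ffun 'I_N -> int})
  (L : seq 'I_N) (s : 'S_N).

Lemma mulN_cases (k : int) : [\/ k = 0, N%:Z <= k * N%:Z | k * N%:Z <= - N%:Z].
Proof.
case: (ltrgtP k 0) => [H|H|->]; first by apply: Or33; nia.
  by apply: Or32; nia.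
exact: Or31.
Qed.

(* Lines are lifted to the integers: [lin] is the covering map of the cylinder. *)
Definition lin p : 'I_N := inord `|(p %% N)%Z|.

Lemma lin_val p : Posz (val (lin p)) = (p %% N)%Z.
Proof. rewrite /lin /= inordK; lia. Qed.

Lemma lin_eqP p q : reflect (exists k, p = q + k * N%:Z) (lin p == lin q).
Proof.
apply: (iffP eqP) => [/(congr1 (fun i : 'I_N => Posz i))|[k ->]].
  rewrite !lin_val => e; exists ((p %/ N)%Z - (q %/ N)%Z).
  by have := divz_eq p N; have := divz_eq q N; rewrite e; lia.
by apply/val_inj/eqP; rewrite -eqz_nat !lin_val addrC modzMDl.
Qed.

Lemma lin_ord b : lin (Posz b) = b.
Proof. by apply/val_inj/eqP; rewrite -eqz_nat lin_val modz_small //; have := ltn_ord b; lia. Qed.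

Lemma linD p k : lin (p + k * N%:Z) = lin p.
Proof. by apply/eqP/lin_eqP; exists k. Qed.

Lemma linDN p : lin (p + N%:Z) = lin p.
Proof. by rewrite -[N%:Z]mul1r linD. Qed.

Lemma lin_ordS p : lin (p + 1) = ordS (lin p).
Proof.
have e: Posz (val (ordS (lin p))) = ((Posz (val (lin p)) + 1) %% N)%Z.
  by rewrite /= -addn1 -modz_nat PoszD.
by apply/val_inj/eqP; rewrite -eqz_nat e !lin_val modzDml.
Qed.

Lemma lin_neq p q : p < q -> q < p + N%:Z -> lin p != lin q.
Proof. by move=> lt1 lt2; apply/negP => /lin_eqP [k]; case: (ltrP k 0); nia. Qed.

Lemma lin_neqC p q : p < q -> q < p + N%:Z -> lin q != lin p.
Proof. by rewrite eq_sym; exact: lin_neq. Qed.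

Lemma lin_lift b q : exists2 p, lin p = b & q <= p < q + N%:Z.
Proof.
exists (q + ((Posz b - q) %% N)%Z); last lia.
rewrite -{2}(lin_ord b); apply/eqP/lin_eqP; exists (- ((Posz b - q) %/ N)%Z).
by have := divz_eq (Posz b - q) N; lia.
Qed.

(* Throughout, [D l] is the displacement still to be performed by the element
   that is now on line [l], so that [gp D] maps each lifted line to the lifted
   line on which its element ends. *)
Definition gp D p := p + D (lin p).

Lemma gpDN D p k : gp D (p + k * N%:Z) = gp D p + k * N%:Z.
Proof. by rewrite /gp linD; lia. Qed.

(** The element arriving on line [b] has just moved left, so its remaining displacement grows by
    one. *)
Definition advance D b : {ffun 'I_N -> int} :=
  [ffun l => if l == b then D (ordS b) + 1
             else if l == ordS b then D b - 1 else D l].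

(** The simple reflection of the affine symmetric group: for a bar between two different lines it
    exchanges every lift of [b] with its right neighbour. By [gp_step], crossing the bar is
    composition with it. *)
Definition refl b p := if lin p == b then p + 1
                       else if lin p == ordS b then p - 1 else p.

Lemma linB1 p b : lin p = ordS b -> lin (p - 1) = b.
Proof.
rewrite -{1}(lin_ord b) -lin_ordS => /eqP /lin_eqP [k e].
by rewrite -[RHS]lin_ord; apply/eqP/lin_eqP; exists k; lia.
Qed.

Lemma gp_step D b p : b != ordS b -> gp (advance D b) p = gp D (refl b p).
Proof.
move=> nb; rewrite /gp /refl ffunE.
case: eqP => [e|_]; first by rewrite lin_ordS e; lia.
case: eqP => [e|_] //; by rewrite (linB1 e); lia.
Qed.

Lemma lin_refl b p : b != ordS b -> lin (refl b p) = tperm b (ordS b) (lin p).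
Proof.
move=> nb; rewrite /refl; case: eqP => [e|/eqP ne].
  by rewrite lin_ordS e tpermL.
case: eqP => [e|/eqP ne2]; first by rewrite (linB1 e) e tpermR.
by rewrite tpermD // eq_sym.
Qed.

Lemma reflK b p : b != ordS b -> refl b (refl b p) = p.
Proof.
move=> nb; rewrite {2}/refl; case: eqP => [e|ne].
  by rewrite /refl lin_ordS e eqxx eq_sym (negPf nb); lia.
case: eqP => [e|ne2]; last by rewrite /refl; move/eqP/negPf: ne => ->; move/eqP/negPf: ne2 => ->.
by rewrite /refl (linB1 e) eqxx; lia.
Qed.

Lemma refl_le b p : p - 1 <= refl b p <= p + 1.
Proof. by rewrite /refl; do 2?case: eqP => _; lia. Qed.

(** Up to translation, a simple reflection inverts only the pair that it exchanges. *)
Lemma refl_mono b p q :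
  p < q -> ~~ ((lin p == b) && (q == p + 1)) -> refl b p < refl b q.
Proof.
move=> lt_pq; rewrite /refl negb_and => /orP H.
case: (lin p =P b) H => [e|ne] H.
  have qne: q != p + 1 by case: H => //; rewrite e eqxx.
  case: (lin q =P b) => [e'|ne']; first by lia.
  case: eqP => [e'|_]; last by lia.
  case: (q =P p + 2) => [e2|]; last lia.
  case: ne'; rewrite e' -{1}e -lin_ordS -[RHS](linB1 e'); congr lin; lia.
have := refl_le b q; rewrite /refl.
case: (lin p =P ordS b) => [e1|ne1] Hq; first lia.
case: (lin q =P b) Hq => [e2|ne2] Hq; first lia.
case: (lin q =P ordS b) Hq => [e2|ne3] Hq; last lia.
case: (q =P p + 1) => [e3|]; last lia.
by case: ne; rewrite -(linB1 e2) e3; congr lin; lia.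
Qed.

Lemma refl_id b p : lin p != b -> lin p != ordS b -> refl b p = p.
Proof. by rewrite /refl => /negPf -> /negPf ->. Qed.

Lemma refl_linl p : refl (lin p) p = p + 1.
Proof. by rewrite /refl eqxx. Qed.

Lemma refl_linr p : lin p != lin (p + 1) -> refl (lin p) (p + 1) = p.
Proof.
by rewrite /refl eq_sym => /negPf ->; rewrite lin_ordS eqxx; lia.
Qed.

Definition desc D p := gp D (p + 1) < gp D p.

Lemma descE D b : (D (ordS b) + 1 < D b) = desc D (Posz b).
Proof. by rewrite /desc /gp lin_ordS lin_ord; lia. Qed.

Lemma desc_lin D p : desc D p = (D (ordS (lin p)) + 1 < D (lin p)).
Proof. by rewrite /desc /gp lin_ordS; lia. Qed.

Lemma desc_neq D b : D (ordS b) + 1 < D b -> b != ordS b.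
Proof. by move=> H; apply/negP => /eqP e; move: H; rewrite -e; lia. Qed.

Lemma desc_neql D p : desc D p -> lin p != lin (p + 1).
Proof. by rewrite desc_lin lin_ordS; exact: desc_neq. Qed.

(* Reduced words of the affine permutation [gp D]. *)
Fixpoint red D L : bool :=
  if L is b :: L' then (D (ordS b) + 1 < D b) && red (advance D b) L'
  else D == [ffun=> 0].

Lemma refl_ord b : refl b (Posz b) = Posz b + 1.
Proof. by rewrite -{1}(lin_ord b) refl_linl. Qed.

Lemma refl_ordS b : b != ordS b -> refl b (Posz b + 1) = Posz b.
Proof. by move=> nb; rewrite -{1}(lin_ord b) refl_linr // lin_ordS lin_ord. Qed.

Lemma refl_at b p : lin p = b -> refl b p = p + 1.
Proof. by move=> <-; rewrite refl_linl. Qed.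

Lemma refl_next b p : b != ordS b -> lin p = b -> refl b (p + 1) = p.
Proof. by move=> nb e; rewrite -{1}e refl_linr // lin_ordS e. Qed.

Lemma desc_at D b p : lin p = b -> (D (ordS b) + 1 < D b) = desc D p.
Proof. by move=> <-; rewrite desc_lin. Qed.

Lemma cross_barE s b p :
  b != ordS b -> cross_bar s b (lin p) = s (lin (refl b p)).
Proof. by move=> nb; rewrite /cross_bar permM lin_refl. Qed.

Lemma cross_bar_refl s b p :
  b != ordS b -> cross_bar s b (lin (refl b p)) = s (lin p).
Proof. by move=> nb; rewrite cross_barE // reflK. Qed.

Lemma meetC i j x y : meet i j (x, y) = meet i j (y, x).
Proof. by rewrite /meet !xpair_eqE orbC [(y == _) && _]andbC [(y == _) && _]andbC. Qed.

Lemma meetCl i j c : meet i j c = meet j i c.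
Proof. by rewrite /meet orbC. Qed.

(** * Lotteries as reduced words *)

Definition proper L := all (fun b => b != ordS b) L.

Definition simple s L :=
  forall i j, i != j -> (count (meet i j) (crossings_from s L) <= 1)%N.

Fixpoint fin L p := if L is b :: L' then fin L' (refl b p) else p.

Lemma simple_tail s b L : simple s (b :: L) -> simple (cross_bar s b) L.
Proof. by move=> H i j ne; have := H i j ne; rewrite /=; case: meet => /=; lia. Qed.

Lemma simple_head s b L : b != ordS b -> simple s (b :: L) ->
  ~~ has (meet (s b) (s (ordS b))) (crossings_from (cross_bar s b) L).
Proof.
move=> nb /(_ (s b) (s (ordS b))); rewrite (inj_eq perm_inj) nb => /(_ isT).
by rewrite /= {1}/meet eqxx /= has_count; lia.
Qed.

(** Two lifts change order only where a bar exchanges them, which would be a crossing of their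
    elements. *)
Lemma fin_mono L s p q : proper L -> p < q -> lin p != lin q ->
  ~~ has (meet (s (lin p)) (s (lin q))) (crossings_from s L) ->
  fin L p < fin L q.
Proof.
elim: L s p q => //= b L IH s p q /andP [nb pL] lt ne; rewrite negb_or => /andP [H1 H2].
apply: (IH (cross_bar s b)) => //.
- apply: refl_mono => //; apply/negP => /andP [/eqP e /eqP e2].
  by move: H1; rewrite e2 lin_ordS e /meet eqxx.
- by rewrite !lin_refl // (inj_eq perm_inj).
- by rewrite !cross_bar_refl.
Qed.

Definition disp s L i : int :=
  (count (fun c => c.1 == i) (crossings_from s L))%:Z
  - (count (fun c => c.2 == i) (crossings_from s L))%:Z.

Lemma disp_cons s b L i : disp s (b :: L) i =
  (s b == i)%:Z - (s (ordS b) == i)%:Z + disp (cross_bar s b) L i.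
Proof. by rewrite /disp [crossings_from _ _]/= ![count _ (_ :: _)]/= !PoszD opprD addrACA. Qed.

Lemma fin_disp L s p : proper L -> fin L p = p + disp s L (s (lin p)).
Proof.
elim: L s p => [|b L IH] s p; first by rewrite /disp /=; lia.
case/andP => nb pL; rewrite [LHS](IH (cross_bar s b)) // cross_bar_refl // disp_cons.
rewrite /refl !(inj_eq perm_inj) ![_ == lin p]eq_sym.
case: (lin p =P b) => [->|_]; first by rewrite ?eqxx (negPf nb); lia.
by case: eqP => _; lia.
Qed.

(** Indexed by the current lines rather than by elements, so that it can stand for [D]; at the top
    both indexings agree ([DV_dispf]). *)
Definition dispf s L : {ffun 'I_N -> int} := [ffun l => disp s L (s l)].

Lemma gp_dispf s L p : proper L -> gp (dispf s L) p = fin L p.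
Proof. by move=> pL; rewrite (fin_disp s) // /gp ffunE. Qed.

Lemma step_dispf s b L : b != ordS b ->
  advance (dispf s (b :: L)) b = dispf (cross_bar s b) L.
Proof.
move=> nb; apply/ffunP => l; rewrite !ffunE !disp_cons /cross_bar permM.
rewrite !eqxx !(inj_eq perm_inj) [ordS b == b]eq_sym (negPf nb).
case: eqP => [->|/eqP n1]; first by rewrite tpermL; lia.
case: eqP => [->|/eqP n2]; first by rewrite tpermR; lia.
rewrite tpermD ?[b == l]eq_sym ?[ordS b == l]eq_sym // (negPf n1) (negPf n2).
by lia.
Qed.

(** The two elements of the first bar never meet again, so they end in the order that the bar gives
    them: the bar is a descent. *)
Lemma red_dispf L s : proper L -> simple s L -> red (dispf s L) L.
Proof.
elim: L s => [|b L IH] s; first by move=> _ _; apply/eqP/ffunP => l; rewrite !ffunE.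
move=> pbL sL; have /andP [nb pL] := pbL; rewrite [red _ _]/= step_dispf // IH //; last first.
  exact: simple_tail.
rewrite andbT descE /desc !gp_dispf //= refl_ord refl_ordS //.
apply: (@fin_mono L (cross_bar s b)) => //; first lia.
  by rewrite lin_ordS lin_ord.
have := simple_head nb sL; rewrite lin_ordS lin_ord.
rewrite /cross_bar !permM tpermL tpermR.
by rewrite (eq_has (meetCl _ _)).
Qed.

Lemma red_proper D L : red D L -> proper L.
Proof. by elim: L D => //= b L IH D /andP [/desc_neq -> /IH ->]. Qed.

Lemma red_fin D L p : red D L -> gp D p = fin L p.
Proof.
elim: L D p => [|b L IH] D p /=; first by move/eqP => ->; rewrite /gp ffunE addr0.
case/andP => /desc_neq nb /IH => <-; by rewrite gp_step // reflK.
Qed.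

Lemma red_cross D L s p q : red D L -> p < q -> gp D q < gp D p ->
  has (meet (s (lin p)) (s (lin q))) (crossings_from s L).
Proof.
move=> rL lt lt2; apply: contraLR lt2 => H; rewrite -leNgt.
have [/lin_eqP [k e]|ne] := boolP (lin p == lin q).
  by rewrite e gpDN; move: lt; rewrite e; lia.
by rewrite ltW // !(red_fin _ rL) (fin_mono (red_proper rL) lt ne H).
Qed.

(* Any two pseudolines cross at most once: no two lifts of one element are
   inverted with the same lift of another. *)
Definition narrow D := forall p q, p < q -> gp D q < gp D p ->
  q - p < N%:Z /\ gp D p - gp D q < N%:Z.

Lemma gpDN1 D p : gp D (p + N%:Z) = gp D p + N%:Z.
Proof. by rewrite -[X in p + X]mul1r gpDN mul1r. Qed.

Lemma neq_ordS_gt1 b : b != ordS b -> (1 < N)%N.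
Proof. by rewrite ltnS lt0n; apply: contraNN => /eqP m0; apply/eqP/val_inj; subst m; case: b => [[]]. Qed.

(* Reflecting can widen the interval between the two lines of an inverted pair
   to [N + 1], but then the pair comes from the bar itself, shifted by [N]. *)
Lemma narrow_refl D D' b : b != ordS b ->
  (forall p, gp D p = gp D' (refl b p)) ->
  (forall p, lin p = b -> gp D p - gp D (p + 1) < N%:Z) ->
  narrow D' -> narrow D.
Proof.
move=> nb E Hb nD' p q lt lt2; have N1 := neq_ordS_gt1 nb.
have [/andP [/eqP e /eqP e2]|ne] := boolP ((lin p == b) && (q == p + 1)).
  by have := Hb p e; rewrite e2; split => //; lia.
have lt' := refl_mono lt ne; move: (lt2); rewrite !E => lt3.
have [H1 H2] := nD' _ _ lt' lt3; split=> //.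
have := refl_le b p; have := refl_le b q => Hq Hp.
have Hqp: q - p <= N%:Z + 1 by lia.
have [e|ne1] := eqVneq q (p + N%:Z); first by move: lt2; rewrite e gpDN1; lia.
have [e|ne2] := eqVneq q (p + 1 + N%:Z); last by move=> {Hq Hp H1 H2}; lia.
have lpb: lin p = b.
  apply/eqP/negPn/negP => /negPf nlp.
  have: refl b p <= p by rewrite /refl nlp; case: ifP => _; lia.
  by lia.
by move: lt2; rewrite e gpDN1; have := Hb p lpb; lia.
Qed.

Lemma narrow_step D b : D (ordS b) + 1 < D b -> narrow D -> narrow (advance D b).
Proof.
move=> db; have nb := desc_neq db; apply: (narrow_refl nb) => p; first exact: gp_step.
by move=> e; rewrite !gp_step // refl_at // refl_next //; move: db; rewrite (desc_at _ e) /desc; lia.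
Qed.

Lemma red_narrow s D L : red D L -> simple s L -> narrow D.
Proof.
elim: L D s => [|b L IH] D s.
  by move/eqP => -> _ p q; rewrite /gp !ffunE; lia.
move=> /= /andP [db rL] sL; have nb := desc_neq db.
have N1 := neq_ordS_gt1 nb.
apply: (@narrow_refl _ (advance D b) b nb) => [p|p e|]; first by rewrite gp_step // reflK.
  have E x : gp D x = fin L (refl b x) by rewrite -(red_fin _ rL) gp_step // reflK.
  rewrite !E refl_at // refl_next //.
  (* After the bar, [p + 1] carries the element that moved right and [p + N] the next lift of the
     other one. They meet no more, so the former stays behind. *)
  have: fin L (p + 1) < fin L (p + N%:Z).
    apply: (@fin_mono L (cross_bar s b)) (red_proper rL) _ _ _; first lia.
      by rewrite linDN lin_ordS e eq_sym.
    rewrite linDN lin_ordS e /cross_bar !permM tpermL tpermR.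
    exact: simple_head nb sL.
  by rewrite -!(red_fin _ rL) gpDN1; lia.
by apply: (IH _ (cross_bar s b)) rL _; apply: simple_tail.
Qed.

Definition ordered s D i j := forall p q,
  p < q -> meet i j (s (lin p), s (lin q)) -> gp D p < gp D q.

Lemma ordered_step s D b i j : b != ordS b -> ~~ meet i j (s b, s (ordS b)) ->
  ordered s D i j -> ordered (cross_bar s b) (advance D b) i j.
Proof.
move=> nb nm H p q lt; rewrite !cross_barE // !gp_step //.
have [/andP [/eqP e /eqP e2]|ne] := boolP ((lin p == b) && (q == p + 1)).
  rewrite e2 refl_at // refl_next // lin_ordS e => mt.
  by rewrite meetC mt in nm.
by move=> mt; apply: H => //; apply: refl_mono.
Qed.

Lemma ordered_nocross s D L i j : red D L -> ordered s D i j ->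
  ~~ has (meet i j) (crossings_from s L).
Proof.
elim: L s D => //= b L IH s D /andP [db rL] H; have nb := desc_neq db.
have nm: ~~ meet i j (s b, s (ordS b)).
  apply/negP => mt; move: (db); rewrite descE /desc.
  have := H (Posz b) (Posz b + 1); rewrite lin_ordS lin_ord => /(_ _ mt).
  by lia.
by rewrite negb_or nm (IH _ _ rL) //; apply: ordered_step.
Qed.

(** After a bar at [x], narrowness puts the target of [x + 1] between those of [x] and [x + N]: the
    lifts of the two elements interleave in the right order. *)
Lemma ordered_head s D b : narrow D -> D (ordS b) + 1 < D b ->
  ordered (cross_bar s b) (advance D b) (s b) (s (ordS b)).
Proof.
move=> nD db p q lt; have nb := desc_neq db.
have key x : lin x = b -> gp (advance D b) x < gp (advance D b) (x + 1) < gp (advance D b) x + N%:Z.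
  move=> e; rewrite !gp_step // refl_at // refl_next //.
  have dx: desc D x by rewrite -(desc_at _ e).
  have [] := nD x (x + 1) _ dx; first lia.
  by move: dx; rewrite /desc; lia.
rewrite /meet !xpair_eqE /cross_bar !permM => /orP [] /andP [/eqP e1 /eqP e2].
  move/perm_inj/(canRL (tpermK _ _)): e1; rewrite tpermL => ep.
  move/perm_inj/(canRL (tpermK _ _)): e2; rewrite tpermR => eq.
  have /lin_eqP [k e]: lin p == lin (q + 1) by rewrite lin_ordS eq ep.
  have := key q eq; rewrite e gpDN; move: lt; rewrite e => lt.
  have: k * N%:Z <= - N%:Z by case: (ltrP k 0); nia.
  by lia.
move/perm_inj/(canRL (tpermK _ _)): e1; rewrite tpermR => ep.
move/perm_inj/(canRL (tpermK _ _)): e2; rewrite tpermL => eq.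
have /lin_eqP [k e]: lin q == lin (p + 1) by rewrite lin_ordS eq ep.
have := key p ep; rewrite e gpDN; move: lt; rewrite e => lt.
have: 0 <= k * N%:Z by case: (ltrP k 0); nia.
by lia.
Qed.

Lemma red_simple s D L : red D L -> narrow D -> simple s L.
Proof.
elim: L s D => //= b L IH s D /andP [db rL] nD i j ne /=.
have nD' := narrow_step db nD; have := IH (cross_bar s b) _ rL nD' i j ne.
case mt: (meet i j _) => //= _; rewrite addnC addn1 ltnS leqn0.
rewrite -leqn0 leqNgt -has_count.
have := ordered_nocross rL (@ordered_head s _ _ nD db).
by move: mt; rewrite /meet !xpair_eqE => /orP [] /andP [/eqP -> /eqP ->] //; rewrite (eq_has (meetCl _ _)).
Qed.

Lemma red_inverted s D L i j : red D L -> (i, j) \in crossings_from s L ->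
  exists p q, [/\ p < q, gp D q < gp D p, s (lin p) = i & s (lin q) = j].
Proof.
elim: L s D => //= b L IH s D /andP [db rL]; have nb := desc_neq db.
rewrite inE => /orP [/eqP [-> ->]|].
  exists (Posz b), (Posz b + 1); rewrite lin_ordS lin_ord; split=> //; first lia.
  by move: db; rewrite descE.
case/(IH _ _ rL) => p [q] [lt]; rewrite !gp_step // !cross_barE // => H e1 e2.
exists (refl b p), (refl b q); split=> //; apply: refl_mono => //.
apply/negP => /andP [/eqP e /eqP e3]; move: H; rewrite e3 (refl_at e) (refl_next nb e).
by move: db; rewrite (desc_at _ e) /desc; lia.
Qed.

(** With [p' = p + k N] and [q' = q + l N], the assumption [q' < p'] forces [l < k], and the targets
    are shifted alike. Hence of two crossing elements it is always the same one that moves right. *)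
Lemma inverted_asym D p q p' q' : lin p = lin p' -> lin q = lin q' ->
  p < q -> gp D q < gp D p -> q' < p' -> gp D q' <= gp D p'.
Proof.
move=> /esym/eqP/lin_eqP [k ->] /esym/eqP/lin_eqP [l ->]; rewrite !gpDN.
move=> H1 H2 H3; have: l < k by apply: contraTT H3; rewrite -!leNgt; nia.
by move=> lk; have: l * N%:Z <= k * N%:Z by [nia]; lia.
Qed.

Lemma red_right s D L p q : red D L -> p < q -> gp D q < gp D p ->
  (s (lin p), s (lin q)) \in crossings_from s L.
Proof.
move=> rL lt H; have /hasP [c cL] := red_cross s rL lt H.
rewrite /meet => /orP [/eqP <-|/eqP e] //.
have [q' [p' [lt' H' /perm_inj e1 /perm_inj e2]]] : exists q' p', [/\ q' < p', gp D p' < gp D q',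
    s (lin q') = s (lin q) & s (lin p') = s (lin p)].
  by apply: (red_inverted rL); rewrite -e.
by have := inverted_asym (esym e2) (esym e1) lt H lt'; lia.
Qed.

(** The element on line [lin p] ends on line [lin (gp D p)], whatever the word. *)
Lemma red_bottom s D L1 L2 : red D L1 -> red D L2 ->
  foldl (@cross_bar _) s L1 = foldl (@cross_bar _) s L2.
Proof.
have key L s0 p : proper L -> (foldl (@cross_bar _) s0 L) (lin (fin L p)) = s0 (lin p).
  elim: L s0 p => //= b L IH s0 p /andP [nb pL]; by rewrite IH // cross_bar_refl.
move=> r1 r2; apply/permP => l; pose i := foldl (@cross_bar _) s L1 l.
have [p e] : exists p, s (lin p) = i.
  by exists (Posz ((s^-1)%g i)); rewrite lin_ord permKV.
have H1 := key _ s p (red_proper r1); have H2 := key _ s p (red_proper r2).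
rewrite -(red_fin _ r1) in H1; rewrite -(red_fin _ r2) in H2.
have -> : l = lin (gp D p) by apply: (@perm_inj _ (foldl (@cross_bar _) s L1)); rewrite H1 e.
by rewrite H1 H2.
Qed.

Lemma DV_dispf L : DV L = dispf 1%g L.
Proof. by apply/ffunP => i; rewrite !ffunE perm1. Qed.

Lemma lottery_red pi D L : lottery1_dv pi D L -> red D L /\ narrow D.
Proof.
case/andP => /and3P [pL _ /forallP H] /eqP <-; rewrite DV_dispf.
have sL : simple 1%g L by move=> i j ne; have /forallP/(_ j)/implyP/(_ ne) := H i.
have rL := red_dispf pL sL; split=> //; exact: red_narrow rL sL.
Qed.

Lemma red_disp s D L : red D L -> D = dispf s L.
Proof.
move=> rL; apply/ffunP => l; have := gp_dispf s (Posz l) (red_proper rL).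
by rewrite -(red_fin _ rL) /gp lin_ord => /addrI.
Qed.

(** Bottom and displacements depend on [D] only, and [narrow] gives simplicity; so a single lottery
    turns every reduced word of [D] into one. *)
Lemma red_lottery pi D L L' :
  lottery1_dv pi D L -> red D L' -> lottery1_dv pi D L'.
Proof.
move=> lL rL'; have [rL nD] := lottery_red lL.
rewrite /lottery1_dv DV_dispf -(red_disp _ rL') eqxx andbT.
apply/and3P; split; first exact: red_proper rL'.
  by rewrite /bottom (red_bottom 1%g rL' rL); case/andP: lL => /and3P [].
apply/forallP => i; apply/forallP => j; apply/implyP; exact: red_simple rL' nD i j.
Qed.

(** * Length of a word against [inv_dv] *)

Lemma size_crossings s L : size (crossings_from s L) = size L.
Proof. by elim: L s => //= b L IH s; rewrite IH. Qed.

Lemma crossings_neq s L c : proper L -> c \in crossings_from s L -> c.1 != c.2.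
Proof.
elim: L s => //= b L IH s /andP [nb pL]; rewrite inE => /orP [/eqP -> /=|]; last exact: IH.
by rewrite (inj_eq perm_inj).
Qed.

Lemma mult_count_gt0 (r s k : int) : r <= k * N%:Z <= s -> (0 < mult_count N r s)%N.
Proof.
move=> H; rewrite /mult_count -has_count; apply/hasP; exists (k * N%:Z); last by apply/dvdzP; exists k.
apply/mapP; exists `|(k * N%:Z - r)%R|%N; last by lia.
by rewrite mem_iota; lia.
Qed.

(** For [p = i + k N] and [q = j + l N], being inverted means that [(l - k) N] lies strictly between
    the bounds [r] and [s] of [c_coef D i j]. *)
Lemma c_coef_inverted D p q : p < q -> gp D q < gp D p ->
  (0 < `|c_coef D (lin p) (lin q)|)%N && (0 < `|c_coef D (lin q) (lin p)|)%N.
Proof.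
move=> lt H; have [k ek] : exists k, p = Posz (lin p) + k * N%:Z.
  by apply/lin_eqP; rewrite lin_ord.
have [l el] : exists l, q = Posz (lin q) + l * N%:Z.
  by apply/lin_eqP; rewrite lin_ord.
move: H; rewrite /gp {1}ek {1}el => H; rewrite {1}ek {1}el in lt.
rewrite /c_coef; apply/andP; split.
  rewrite ifT; last lia.
  by have := @mult_count_gt0 (Posz (lin p) - Posz (lin q)) (Posz (lin p) + D (lin p) - (Posz (lin q) + D (lin q))) (l - k); lia.
rewrite ifF; last lia.
by have := @mult_count_gt0 (Posz (lin q) + D (lin q) - (Posz (lin p) + D (lin p))) (Posz (lin q) - Posz (lin p)) (k - l); lia.
Qed.

(** Each crossing accounts for two ordered pairs with nonzero coefficient, and simplicity makes all
    these pairs distinct; the half in [inv_dv] makes up for the doubling. *)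
Lemma size_le_inv pi D L : lottery1_dv pi D L -> (size L <= inv_dv D)%N.
Proof.
move=> lL; have [rL nD] := lottery_red lL.
have sL : simple 1%g L := red_simple 1%g rL nD.
rewrite /inv_dv -[size L]doubleK; apply: half_leq.
rewrite pair_big_dep /= -(size_crossings 1%g L).
set cs := crossings_from _ _; pose sw (c : 'I_N * 'I_N) := (c.2, c.1).
have swK : involutive sw by case.
have count2 i j : i != j ->
    (count_mem (i, j) cs + count_mem (i, j) (map sw cs) <= 1)%N.
  move=> ne; rewrite count_map; apply: leq_trans (sL i j ne).
  rewrite -/cs; elim: (cs) => //= -[x y] cs' IH.
  have : (((x, y) == (i, j)) + (sw (x, y) == (i, j)) <= meet i j (x, y))%N.
    rewrite /meet !xpair_eqE /= [(y == i) && _]andbC.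
    have [->|] := eqVneq x i; last by case: (x == j) => //=; case: (y == i).
    by rewrite (negPf ne) /=; case: (y == j).
  by move=> H; rewrite addnACA; exact: leq_add H IH.
have U : uniq (cs ++ map sw cs).
  apply: count_mem_uniq => -[i j]; rewrite count_cat mem_cat -!has_pred1 !has_count.
  have [<-|/count2] := eqVneq i j; last first.
    by move: (count_mem _ cs) (count_mem _ (map sw cs)) => [|[|x]] [|[|y]].
  have -> : count_mem (i, i) cs = 0%N.
    by apply/count_memPn/negP => /(crossings_neq (red_proper rL)); rewrite eqxx.
  have -> //: count_mem (i, i) (map sw cs) = 0%N.
  apply/count_memPn/negP => /mapP [c /(crossings_neq (red_proper rL)) ne [e1 e2]].
  by rewrite -e1 -e2 eqxx in ne.
have -> : (size cs).*2 = #|mem (cs ++ map sw cs)|.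
  by rewrite (card_uniqP U) size_cat size_map addnn.
rewrite -sum1_card big_mkcond [leqRHS]big_mkcond /=; apply: leq_sum => -[i j] _ /=.
case: ifP => // ; rewrite mem_cat => H.
have [p [q [lt HD E]]] : exists p q, [/\ p < q, gp D q < gp D p & ((i, j) = (lin p, lin q)) \/ ((i, j) = (lin q, lin p))].
  case/orP: H => [H|/mapP [[x y] H [ei ej]]].
    have [p [q [lt HD]]] := red_inverted rL H; rewrite !perm1 => <- <-.
    by exists p, q; split=> //; left.
  have [p [q [lt HD]]] := red_inverted rL H; rewrite !perm1 => ex ey.
  by exists p, q; split=> //; right; rewrite ei ej ex ey.
have ne : lin p != lin q.
  apply/negP => /lin_eqP [k e]; move: HD lt; rewrite e gpDN; lia.
have /andP [c1 c2] := c_coef_inverted lt HD.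
by case: E => -[-> ->]; rewrite 1?eq_sym ?ne // eq_sym ne.
Qed.

(** * Commutation classes and their normal forms *)

Definition partner i (c : 'I_N * 'I_N) : option 'I_N :=
  if c.1 == i then Some c.2 else if c.2 == i then Some c.1 else None.

Definition route_from s L i := pmap (partner i) (crossings_from s L).

Definition eqr s L1 L2 := forall i, route_from s L1 i = route_from s L2 i.

Lemma same_arrangementP L1 L2 : reflect (eqr 1%g L1 L2) (same_arrangement L1 L2).
Proof. by apply: (iffP forallP) => H i; apply/eqP/H. Qed.

Lemma eqr_trans s L1 L2 L3 : eqr s L1 L2 -> eqr s L2 L3 -> eqr s L1 L3.
Proof. by move=> H1 H2 i; rewrite H1. Qed.

Lemma eqr_sym s L1 L2 : eqr s L1 L2 -> eqr s L2 L1.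
Proof. by move=> H i. Qed.

Lemma eqr_cons s b L1 L2 : eqr s (b :: L1) (b :: L2) <-> eqr (cross_bar s b) L1 L2.
Proof.
split=> H i; have := H i; rewrite /route_from /=; last by move=> ->.
by case: partner => [x /= []|].
Qed.

Definition disj b c := [&& b != c, b != ordS c, ordS b != c & ordS b != ordS c].

Lemma disj_neqs b c : disj b c ->
  [/\ (b == c) = false, (b == ordS c) = false, (ordS b == c) = false & (ordS b == ordS c) = false].
Proof. by case/and4P => /negPf -> /negPf -> /negPf -> /negPf ->. Qed.

Lemma disj_neqs' b c : disj b c ->
  [/\ (c == b) = false, (ordS c == b) = false, (c == ordS b) = false & (ordS c == ordS b) = false].
Proof. by case/and4P; rewrite ![_ == c]eq_sym ![_ == ordS c]eq_sym => /negPf -> /negPf -> /negPf -> /negPf ->. Qed.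

Lemma step_disj D b c : disj b c ->
  (advance D b c = D c) * (advance D b (ordS c) = D (ordS c)).
Proof. by move/disj_neqs' => [e1 e2 e3 e4]; rewrite !ffunE e1 e2 e3 e4. Qed.

Lemma step_comm D b c : disj b c -> advance (advance D b) c = advance (advance D c) b.
Proof.
move=> dj; have [e1 e2 e3 e4] := disj_neqs dj; have [f1 f2 f3 f4] := disj_neqs' dj.
apply/ffunP => l; rewrite !ffunE e1 e2 e3 e4 f1 f2 f3 f4.
case: (l =P c) => [->|_]; first by rewrite f1 f3.
case: (l =P ordS c) => [->|_] //; by rewrite f2 f4.
Qed.

Lemma cross_bar_disj s b c : disj b c ->
  (cross_bar s b c = s c) * (cross_bar s b (ordS c) = s (ordS c)).
Proof. by case/and4P => *; rewrite /cross_bar !permM !tpermD. Qed.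

Lemma cross_bar_comm s b c : disj b c ->
  cross_bar (cross_bar s b) c = cross_bar (cross_bar s c) b.
Proof.
move=> dj; have [e1 e2 e3 e4] := disj_neqs dj; have [f1 f2 f3 f4] := disj_neqs' dj.
apply/permP => l; rewrite /cross_bar !permM; congr (s _).
case: (tpermP c (ordS c) l) => [->|->|/eqP n1 /eqP n2].
- by rewrite !(@tpermD _ b (ordS b)) ?e1 ?e2 ?e3 ?e4 // tpermL.
- by rewrite !(@tpermD _ b (ordS b)) ?e1 ?e2 ?e3 ?e4 // tpermR.
case: (tpermP b (ordS b) l) => [_|_|/eqP n3 /eqP n4].
- by rewrite tpermD ?f3 ?f4.
- by rewrite tpermD ?f1 ?f2.
- by rewrite tpermD 1?eq_sym.
Qed.

Lemma eqr_swap s b c L : disj b c -> eqr s (b :: c :: L) (c :: b :: L).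
Proof.
move=> dj i; have dj' : disj c b.
  by case/and4P: dj => *; apply/and4P; split; rewrite eq_sym.
rewrite /route_from /= !(cross_bar_disj _ dj) !(cross_bar_disj _ dj') cross_bar_comm //.
rewrite /partner /= -(permKV s i) !(inj_eq perm_inj).
have [e1 e2 e3 e4] := disj_neqs dj; have [f1 f2 f3 f4] := disj_neqs' dj.
case: (b =P (s^-1)%g i) => [<-|_] /=; first by rewrite f1 f2.
case: (ordS b =P (s^-1)%g i) => [<-|_] //=; by rewrite f3 f4.
Qed.

Lemma far_disj p q : p + 1 < q -> q + 1 < p + N%:Z -> disj (lin p) (lin q).
Proof.
move=> H1 H2; rewrite /disj -!lin_ordS.
by apply/and4P; split; apply: lin_neq; lia.
Qed.

Lemma disjC b c : disj b c = disj c b.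
Proof. by apply/and4P/and4P => -[*]; split; rewrite eq_sym. Qed.

Definition nxt (h p : int) := if p == h then h + 1 else h.

(** Only N - 1 bars are allowed: the remaining one, from [h - 1] to [h], would let an element pass
    the cut from the left. *)
Fixpoint vld D (h : int) (ps : seq int) : bool :=
  if ps is p :: ps' then
    [&& h <= p, p <= h + N%:Z - 2, desc D p & vld (advance D (lin p)) (nxt h p) ps']
  else D == [ffun=> 0].

(* When the element on the lifted line [h] is never passed from the left, its
   pseudoline cuts the cylinder into a strip: every bar ever used has exactly one
   lift in the window [h, h + N - 2], and the window moves with [h] ([nxt]). *)
Definition noPass D h := forall q, q < h -> gp D q < gp D h.

Lemma noPass_step D h p : noPass D h -> h <= p -> p <= h + N%:Z - 2 ->
  desc D p -> noPass (advance D (lin p)) (nxt h p).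
Proof.
move=> nH le1 le2 dp q lt.
have nb : lin p != ordS (lin p) by rewrite -lin_ordS; exact: desc_neql dp.
have lth : q < h -> refl (lin p) q < h.
  move=> qh; have := refl_le (lin p) q; have [e1|ne1] := eqVneq q (h - 1); last lia.
  suff: refl (lin p) q != q + 1 by lia.
  rewrite /refl (negPf (_ : lin q != lin p)); last by apply: lin_neq; lia.
  by case: ifP => _; lia.
rewrite /nxt in lt *; rewrite !gp_step //; case: eqP lt => [e|ne] lt.
  have -> : refl (lin p) (h + 1) = h by rewrite refl_next // e.
  have [->|nq] := eqVneq q h; first by rewrite -{1}e refl_linl; move: dp; rewrite /desc e.
  by apply: nH; apply: lth; lia.
rewrite [refl _ h]refl_id; first by apply: nH; apply: lth.
  by apply: lin_neq; lia.
by rewrite -lin_ordS; apply: lin_neq; lia.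
Qed.

Lemma vld_red D h ps : vld D h ps -> red D (map lin ps).
Proof. by elim: ps D h => //= p ps IH D h /and4P [_ _ dp /IH ->]; rewrite -desc_lin dp. Qed.

Lemma red_vld D h L : red D L -> noPass D h ->
  exists2 ps, vld D h ps & map lin ps = L.
Proof.
elim: L D h => [|b L IH] D h; first by exists [::].
case/andP => db rL nH; have nb := desc_neq db; have N1 := neq_ordS_gt1 nb.
have [p e /andP [le1 lt1]] := lin_lift b h.
have dp : desc D p by rewrite -(desc_at _ e).
have le2 : p <= h + N%:Z - 2.
  (* The only lift outside the window is the bar from [h - 1] to [h], shifted by N; as a descent it
     would contradict [noPass]. *)
  have [ep|] := eqVneq p (h - 1 + N%:Z); last lia.
  have := nH (h - 1); move: dp; rewrite ep /desc gpDN1.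
  have -> : h - 1 + N%:Z + 1 = h + N%:Z by lia.
  by rewrite gpDN1; lia.
have := IH (advance D b) (nxt h p) rL; rewrite -{1}e => /(_ (noPass_step nH le1 le2 dp)) [ps v <-].
by exists (p :: ps); rewrite /= ?e // le1 le2 dp v.
Qed.

(* In the strip, words with no descent of size at least two are the
   lexicographic normal forms of the commutation classes. *)
Definition leR (p q : int) := p <= q + 1.

(** Bars of one window that are at least two apart share no line. The bar [p] is not [h], since
    otherwise the next window would begin to the right of [q]; so the exchange respects the
    windows. *)
Lemma vld_swap D h p q ps : q + 1 < p -> vld D h (p :: q :: ps) ->
  [/\ disj (lin p) (lin q), h <= q, q <= h + N%:Z - 2, desc D q &
      vld (advance D (lin q)) (nxt h q) (p :: ps)].
Proof.
move=> lt /= /and4P [le1 le2 dp /and4P [le3 le4 dq v]].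
have nph : p == h = false by apply/negP => /eqP e; move: le3; rewrite /nxt e eqxx; lia.
have nh : nxt h p = h by rewrite /nxt nph.
rewrite nh in le3 le4.
have dj : disj (lin q) (lin p) by apply: far_disj; lia.
have dj' : disj (lin p) (lin q) by rewrite disjC.
split=> //; first by move: dq; rewrite !desc_lin !(step_disj _ dj').
have e1 : nxt (nxt h q) p = nxt (nxt h p) q by rewrite /nxt nph; do ?case: eqP; lia.
rewrite /= [desc _ p]desc_lin !(step_disj _ dj) -desc_lin dp e1 step_comm // v.
by rewrite /nxt; case: eqP => _; rewrite !andbT; lia.
Qed.

(** One step of insertion sort: [p] sinks past the bars at least two to its left. The last clause
    transports admissible predecessors, so that the result can stand behind a head. *)
Lemma insert_normal s D h p ps : vld D h (p :: ps) -> sorted leR ps ->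
  exists ps', [/\ vld D h ps', eqr s (map lin (p :: ps)) (map lin ps') &
    forall l, leR l p -> path leR l ps -> path leR l ps'].
Proof.
elim: ps p s D h => [|q ps IH] p s D h v so.
  by exists [:: p]; split=> // l H _; rewrite /= H.
have [le|lt] := boolP (leR p q).
  by exists (p :: q :: ps); split=> // l H /= /andP [_ H2]; rewrite H le.
have {}lt : q + 1 < p by move: lt; rewrite /leR; lia.
have [dj le1 le2 dq v2] := vld_swap lt v.
have [ps' [v3 e3 p3]] := IH p (cross_bar s (lin q)) _ _ v2 (path_sorted so).
exists (q :: ps'); split; first by rewrite /= le1 le2 dq v3.
  by apply: eqr_trans (eqr_swap _ _ dj) _; apply/eqr_cons.
move=> l lp /= /andP [-> H]; apply: p3 => //; rewrite /leR; lia.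
Qed.

Lemma normal_exists s D h ps : vld D h ps ->
  exists ps', [/\ vld D h ps', eqr s (map lin ps) (map lin ps') & sorted leR ps'].
Proof.
elim: ps s D h => [|p ps IH] s D h; first by exists [::].
case/and4P => le1 le2 dp /(IH (cross_bar s (lin p))) [ps1 [v1 e1 so1]].
have v2 : vld D h (p :: ps1) by rewrite /= le1 le2 dp v1.
have [ps2 [v e2 H]] := insert_normal s v2 so1; exists ps2; split=> //.
  by apply: eqr_trans e2; apply/eqr_cons.
(* Any common lower bound of [p] and the head of [ps1] is an admissible predecessor of both. *)
apply: (@path_sorted _ leR (Num.min p (head p ps1))); apply: H; first by rewrite /leR; lia.
by case: (ps1) so1 => //= q ps' ->; rewrite andbT /leR; lia.
Qed.

Lemma route_from_cons s b L i :
  route_from s (b :: L) i = if s b == i then s (ordS b) :: route_from (cross_bar s b) L i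
    else if s (ordS b) == i then s b :: route_from (cross_bar s b) L i
    else route_from (cross_bar s b) L i.
Proof. by rewrite /route_from /= /partner /=; do 2?case: ifP. Qed.

(* The right neighbour [p + 1] of a pair that is yet to cross can only be moved
   away by the bar [p + 1], and a normal word that starts to the right of
   [p + 1] uses this bar before any bar further left. *)
Lemma normal_blocked s D h l p ps : vld D h ps -> path leR l ps -> p + 2 <= l ->
  h <= p -> p + 1 < h + N%:Z ->
  ohead (route_from s (map lin ps) (s (lin (p + 1)))) != Some (s (lin p)).
Proof.
elim: ps s D h l => //= q ps IH s D h l /and4P [le1 le2 dq v] /andP [lq pq] lpl hp hN.
rewrite /leR in lq; rewrite route_from_cons !(inj_eq perm_inj) -lin_ordS.
have [->|nq] := eqVneq q (p + 1).
  rewrite eqxx /= /eq_op /= (inj_eq perm_inj) -/(_ == _).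
  by apply: lin_neqC; lia.
rewrite (negPf (_ : lin q != lin (p + 1))); last by apply: lin_neqC; lia.
rewrite (negPf (_ : lin (q + 1) != lin (p + 1))); last by apply: lin_neqC; lia.
have dj : disj (lin q) (lin p) by rewrite disjC; apply: far_disj; lia.
have := IH (cross_bar s (lin q)) _ _ q v pq.
rewrite lin_ordS !(cross_bar_disj _ dj) /nxt ifF; last lia.
by apply; lia.
Qed.

Lemma normal_uniq s D h ps1 ps2 : vld D h ps1 -> vld D h ps2 ->
  sorted leR ps1 -> sorted leR ps2 -> eqr s (map lin ps1) (map lin ps2) ->
  ps1 = ps2.
Proof.
elim: ps1 ps2 s D h => [|p1 ps1 IH] [|p2 ps2] s D h //.
- by move=> _ _ _ _ /(_ (s (lin p2))); rewrite /= route_from_cons eqxx.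
- by move=> _ _ _ _ /(_ (s (lin p1))); rewrite /= route_from_cons eqxx.
move=> v1 v2 so1 so2 E.
have key q qs q' qs' : vld D h (q :: qs) -> vld D h (q' :: qs') -> sorted leR (q' :: qs') ->
    eqr s (map lin (q :: qs)) (map lin (q' :: qs')) -> ~ q < q'.
  move=> v v' so e lt; have /and4P [le1 le2 dq _] := v.
  have /and4P [le1' le2' dq' _] := v'.
  (* As [q < q'], the bar [q + 2] may precede [q']. So in the second word the element on line
     [q + 1] does not meet the one on line [q] first, whereas in the first word it does. *)
  have := @normal_blocked s D h (q + 2) q (q' :: qs') v' _ _ le1.
  rewrite -e /= route_from_cons !(inj_eq perm_inj) -lin_ordS (negPf (desc_neql dq)) eqxx /= eqxx.
  move: so => /= so; rewrite so /leR => H.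
  by suff: ~~ true by []; apply: H; lia.
have e12 : p1 = p2.
  have := key _ _ _ _ v1 v2 so2 E; have := key _ _ _ _ v2 v1 so1 (eqr_sym E); lia.
subst p2; congr (_ :: _); move: v1 v2 => /and4P [_ _ _ v1] /and4P [_ _ _ v2].
apply: (IH ps2 (cross_bar s (lin p1)) _ _ v1 v2 (path_sorted so1) (path_sorted so2)).
by apply/eqr_cons.
Qed.

End Affine.

(** * The arrangement without left tangled triples *)

Section Root.
Variable m : nat.
Local Notation N := (m.+1).
Local Notation lin := (@lin m).
Implicit Types (p q : int) (b i j u v w : 'I_N) (D : {ffun 'I_N -> int})
  (L : seq 'I_N) (s : 'S_N) (cs : seq ('I_N * 'I_N)).

Lemma meet_pairs i j x y : meet i j (x, y) ->
  (x = i /\ y = j) \/ (x = j /\ y = i).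
Proof. by rewrite /meet !xpair_eqE => /orP [] /andP [/eqP -> /eqP ->]; [left|right]. Qed.

Lemma inverted_neq D p q : p < q -> gp D q < gp D p -> lin p != lin q.
Proof.
move=> lt H; apply/negP => /lin_eqP [k e]; move: H lt; rewrite e gpDN; lia.
Qed.

(** [P] and [S] can only meet as neighbours, so [Q] must have left the space between them before, by
    crossing one of the two. *)
Lemma between D L s (P Q S : int) : red D L -> narrow D -> P < Q -> Q < S ->
  gp D S < gp D P -> lin P != lin Q -> lin Q != lin S ->
  let first i j := find (meet (s i) (s j)) (crossings_from s L) in
  (first (lin P) (lin Q) < first (lin P) (lin S))%N
  || (first (lin Q) (lin S) < first (lin P) (lin S))%N.
Proof.
elim: L s D P Q S => [|b L IH] s D P Q S.
  by move=> /eqP -> _; rewrite /gp !ffunE; lia.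
case/andP => db rL nD PQ QS H ne1 ne2; have nb := desc_neq db.
have ne3 : lin P != lin S by apply: (inverted_neq _ H); apply: lt_trans QS.
set x := s (lin P); set y := s (lin Q); set z := s (lin S); rewrite /=.
have nxy : x != y by rewrite (inj_eq perm_inj).
have nyz : y != z by rewrite (inj_eq perm_inj).
have nxz : x != z by rewrite (inj_eq perm_inj).
have [mxz|nm] := boolP (meet x z _).
  have dP : narrow D by [].
  case: (meet_pairs mxz) => -[/perm_inj e1 /perm_inj e2].
    (* If the first bar exchanged them, [S] would be [P + 1] up to a multiple of N, and narrowness
       leaves no room for [Q]. *)
    have dp : desc D P by rewrite -(desc_at _ (esym e1)).
    have /lin_eqP [k ek] : lin S == lin (P + 1) by rewrite lin_ordS -e1 e2.
    exfalso; have [] := nD P S (lt_trans PQ QS) H.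
    by move: ek PQ QS; clear; case: (mulN_cases m k) => [->|?|?]; lia.
  (* Here [S] would be the one moving right, against [inverted_asym]. *)
  have dp : desc D S by rewrite -(desc_at _ (esym e1)).
  have HS : gp D S <= gp D (S + 1).
    apply: (@inverted_asym _ D P S (S + 1) S _ _ _ H) => //; last lia.
      by rewrite lin_ordS -e1 e2.
    exact: lt_trans QS.
  by exfalso; move: dp HS; rewrite /desc; clear; lia.
case: ifP => // nm1; case: ifP => nm2; first by rewrite orbT.
rewrite !ltnS.
have Rm p q : p < q -> meet (s (lin p)) (s (lin q)) (s b, s (ordS b)) = false ->
    refl b p < refl b q.
  move=> lt nmt; apply: refl_mono => //; apply/negP => /andP [/eqP e1 /eqP e2].
  by move: nmt; rewrite e2 lin_ordS e1 /meet eqxx.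
have := IH (cross_bar s b) _ (refl b P) (refl b Q) (refl b S) rL (narrow_step db nD).
rewrite /= !gp_step // !reflK // !cross_bar_refl // !lin_refl // !(inj_eq perm_inj).
by apply => //; apply: Rm.
Qed.

(* [v] passes [u], then [u] and [w] cross, then [v] and [w]: the triple is left
   tangled. *)
Definition LT cs u v w := [&& (find (meet u v) cs < find (meet u w) cs)%N,
  (find (meet u w) cs < find (meet v w) cs)%N,
  (find (meet v w) cs < size cs)%N, uniq [:: u; v; w] & (v, u) \in cs].

Lemma left_tangled_LT L i j k :
  left_tangled L i j k -> exists u v w, LT (crossings L) u v w.
Proof.
case/andP => /and4P [U c1 c2 c3] /existsP [u] /existsP [v] /existsP [w].
case/and4P => pe d1 d2 vu; exists u, v, w; rewrite /LT d1 d2 vu (perm_uniq pe) U !andbT.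
rewrite -has_find; have : uniq [:: u; v; w] by rewrite (perm_uniq pe).
have : v \in [:: i; j; k] by rewrite -(perm_mem pe) !inE eqxx orbT.
have : w \in [:: i; j; k] by rewrite -(perm_mem pe) !inE eqxx !orbT.
rewrite !inE /= !inE => /or3P [] /eqP -> /or3P [] /eqP -> /and3P [] //;
  rewrite ?eqxx // => _ _ _; rewrite // (eq_has (meetCl _ _)) //.
Qed.

Lemma LT_left_tangled L u v w : LT (crossings L) u v w -> left_tangled L u v w.
Proof.
case/and5P => d1 d2 d3 U vu; rewrite /left_tangled /tangled U /crosses !has_find d3.
rewrite (ltn_trans d2 d3) (ltn_trans d1 (ltn_trans d2 d3)) /=.
by apply/existsP; exists u; apply/existsP; exists v; apply/existsP; exists w; rewrite perm_refl d1 d2.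
Qed.

(** The left element of each bar is one that no other has yet to pass; unlike being leftmost, this
    does not refer to a cut. *)
Fixpoint leftmost D L : Prop :=
  if L is b :: L' then noPass D (Posz b) /\ leftmost (advance D b) L' else True.

Lemma noPassD D h k : noPass D h -> noPass D (h + k * N%:Z).
Proof.
move=> H q lt; have := H (q - k * N%:Z); rewrite gpDN.
by have := gpDN D (q - k * N%:Z) k; rewrite subrK => ->; lia.
Qed.

Lemma noPass_lin D b p : lin p = b -> noPass D (Posz b) -> noPass D p.
Proof.
by move=> e H; have /lin_eqP [k ->] : lin p == lin (Posz b); rewrite ?e ?lin_ord //; apply: noPassD.
Qed.

Lemma uniq3P u v w : uniq [:: u; v; w] -> [/\ u != v, u != w & v != w].
Proof. by rewrite /= !inE negb_or andbT => /andP [/andP [-> ->] ->]. Qed.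

Lemma meet_other u v w x y : uniq [:: u; v; w] -> meet u v (x, y) ->
  (meet u w (x, y) = false) * (meet v w (x, y) = false).
Proof.
case/uniq3P => /negPf n1 /negPf n2 /negPf n3.
by case/meet_pairs => -[-> ->]; rewrite /meet !xpair_eqE !eqxx;
  rewrite ?[v == u]eq_sym ?n1 ?n2 ?n3 ?andbF.
Qed.

Lemma shift_pair D p q (x : int) : lin p = lin x ->
  exists q', [/\ lin q' = lin q, q' - x = q - p & gp D q' - gp D x = gp D q - gp D p].
Proof.
move/eqP/lin_eqP => [k ->]; exists (q - k * N%:Z).
rewrite -mulNr linD !gpDN; split=> //; lia.
Qed.

(** Otherwise [w1 = w2 + k N] with [k >= 1], whence [gp D p > gp D w1 >= gp D w2 + N > gp D (p + 1)
    + N]: too wide for the inverted pair [p], [p + 1]. *)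
Lemma narrow_lifts_neq D p (w1 w2 : int) : narrow D -> desc D p ->
  p < w1 -> gp D w1 < gp D p -> w2 < p -> gp D (p + 1) < gp D w2 ->
  lin w1 != lin w2.
Proof.
move=> nD dp lt1 H1 lt2 H2; apply/negP => /lin_eqP [k e].
have [] := nD p (p + 1) ltac:(lia) dp; move: H1 H2 lt1 lt2; rewrite e gpDN; clear.
by case: (mulN_cases m k) => [->|?|?]; lia.
Qed.

Lemma narrow_lifts_eq D p (w1 w2 : int) : narrow D ->
  p < w1 -> gp D w1 < gp D p -> p < w2 -> gp D w2 < gp D p ->
  lin w1 = lin w2 -> w1 = w2.
Proof.
move=> nD lt1 H1 lt2 H2 /eqP/lin_eqP [k e].
have [A B] := nD _ _ lt1 H1; have [A' B'] := nD _ _ lt2 H2.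
move: H1 H2 A A' B B' lt1 lt2; rewrite e gpDN; clear.
by case: (mulN_cases m k) => [->|?|?]; lia.
Qed.

(** Take the bar where [v] passes [u]. Nothing passes [v] from the left, so [w] lies to the right of
    both and is passed by both. Then [v], now between [u] and [w], meets [w] before [u] does. *)
Lemma leftmost_noLT D L s u v w : red D L -> narrow D -> leftmost D L ->
  ~~ LT (crossings_from s L) u v w.
Proof.
elim: L s D => [|b L IH] s D; first by [].
move=> rbL nD [np lmL]; have /andP [db rL] := rbL; have nb := desc_neq db.
apply/negP => /and5P [d1 d2 d3 U vu]; have [nuv nuw nvw] := uniq3P U.
have nD' := narrow_step db nD.
have sh := simple_head nb (red_simple s rbL nD).
move: d1 d2 d3 vu; rewrite /=; set cs := crossings_from _ L; set c0 := (_, _).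
have [muv _|nuvm] := boolP (meet u v c0); last first.
  case: ifP => // muw; case: ifP => // mvw d1 d2 d3; rewrite inE => /orP [/eqP e|vu].
    by move: nuvm; rewrite -e /meet eqxx orbT.
  by have := IH (cross_bar s b) _ rL nD' lmL; rewrite /LT U vu; move: d1 d2 d3; rewrite !ltnS => -> -> ->.
have [-> ->] := meet_other U muv; rewrite !ltnS => d2 d3; rewrite inE => vu.
have nhas : ~~ has (meet u v) cs.
  by case: (meet_pairs muv) => -[<- <-] //; rewrite (eq_has (meetCl _ _)).
have [ev eu] : v = s b /\ u = s (ordS b).
  case/orP: vu => [/eqP [-> ->] //|vu]; case/hasP: nhas; exists (v, u) => //.
  by rewrite /meet eqxx orbT.
have cross_inv x y : has (meet x y) cs ->
    (exists p q, [/\ p < q, gp D q < gp D p, s (lin p) = x & s (lin q) = y]) \/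
    (exists p q, [/\ p < q, gp D q < gp D p, s (lin p) = y & s (lin q) = x]).
  case/hasP => -[x' y'] H /meet_pairs [[e1 e2]|[e1 e2]]; subst x' y'; [left|right];
  by apply: (red_inverted rbL); rewrite /= inE H orbT.
have Hvw : has (meet v w) cs by rewrite has_find.
have Huw : has (meet u w) cs by rewrite has_find (ltn_trans d2 d3).
case: (cross_inv _ _ Hvw) => [|[q [p' [lt H _]]]]; last first.
  rewrite ev => /perm_inj e; have := noPass_lin e np lt.
  by rewrite ltNge (ltW H).
case=> p1 [w1 [lt1 H1]]; rewrite ev => /perm_inj e1 ew1.
have dp1 : desc D p1 by rewrite -(desc_at _ e1).
have e1' : lin (p1 + 1) = ordS b by rewrite lin_ordS e1.
have wb : lin w1 != b by rewrite -(inj_eq (@perm_inj _ s)) ew1 -ev eq_sym.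
have wb' : lin w1 != ordS b by rewrite -(inj_eq (@perm_inj _ s)) ew1 -eu eq_sym.
have elin p : s (lin p) = u -> lin p = lin (p1 + 1).
  by rewrite eu e1' => /perm_inj.
have lw p : s (lin p) = w -> lin w1 = lin p by rewrite -ew1 => /perm_inj.
(* If [w] passed [u] from the left instead, a lift of [w] left of the bar would contradict
   [narrow_lifts_neq]. *)
case: (cross_inv _ _ Huw) => -[p2 [w2 [lt2 H2 e2 ew2]]]; last first.
  have [q' [eq' dq gq]] := shift_pair D p2 (elin _ ew2).
  have /eqP [] : lin w1 != lin q'; last by rewrite eq'; apply: lw.
  have neq' : q' != p1 by apply: contraNneq wb => e; rewrite (lw _ e2) -eq' e e1.
  apply: (narrow_lifts_neq nD dp1 lt1 H1).
    by move: lt2 dq neq'; clear; lia.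
  by move: H2 gq; clear; lia.
have [q' [eq' dq gq]] := shift_pair D w2 (elin _ e2).
have ew : w1 = q'.
  apply: (narrow_lifts_eq nD lt1 H1); last by rewrite eq'; apply: lw.
    by move: lt2 dq; clear; lia.
  by move: H2 gq dp1; rewrite /desc; clear; lia.
have H2' : gp D w1 < gp D (p1 + 1) by move: H2 gq; rewrite ew; clear; lia.
have rw1 : refl b w1 = w1 by apply: refl_id.
have := @between _ _ (cross_bar s b) p1 (p1 + 1) w1 rL nD'.
rewrite !gp_step // (refl_at e1) rw1 e1' e1 nb [_ == lin w1]eq_sym wb'.
have -> : p1 < p1 + 1 by clear; lia.
have -> : p1 + 1 < w1 by move: lt2 dq; rewrite ew; clear; lia.
have ex : cross_bar s b b = u by rewrite /cross_bar permM tpermL.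
have ey : cross_bar s b (ordS b) = v by rewrite /cross_bar permM tpermR.
have ez : cross_bar s b (lin w1) = w.
  by rewrite /cross_bar permM tpermD ?ew1 // eq_sym.
rewrite /= ex ey ez => /(_ isT isT H2' isT isT); rewrite -/cs.
(* [u] and [v] do not meet again, so [find] returns the length and the first alternative of
   [between] fails. *)
rewrite (hasNfind nhas) leq_gtF ?find_size //= => H.
by have := ltn_trans d2 H; rewrite ltnn.
Qed.

Lemma noPass_disj D b c : c != ordS c -> disj c b ->
  noPass D (Posz b) -> noPass (advance D c) (Posz b).
Proof.
move=> nc dj np q lt; have [e1 e2 e3 e4] := disj_neqs' dj.
have rb : refl c (Posz b) = Posz b by apply: refl_id; rewrite lin_ord ?e1 ?e3.
rewrite !gp_step // rb; apply: np; rewrite -[X in _ < X]rb; apply: refl_mono => //.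
apply/negP => /andP [/eqP eq /eqP eb].
by move: e3; rewrite -[b in b == _]lin_ord eb lin_ordS eq eqxx.
Qed.

(** The new bar only shifts positions: its pair meets no more, whereas all pairs of the triple still
    do. *)
Lemma LT_cons D b L s u v w : red D (b :: L) -> narrow D ->
  LT (crossings_from (cross_bar s b) L) u v w ->
  LT (crossings_from s (b :: L)) u v w.
Proof.
move=> rbL nD; have sL := red_simple s rbL nD.
set cs := crossings_from _ L => /and5P [d1 d2 d3 U vu].
have [nuv nuw nvw] := uniq3P U.
have head i j : i != j -> has (meet i j) cs -> meet i j (s b, s (ordS b)) = false.
  move=> ne; have := sL i j ne; rewrite /= -/cs has_count.
  by case: meet => //=; case: (count _ _).
have hvw : has (meet v w) cs by rewrite has_find.
have huw : has (meet u w) cs by rewrite has_find (ltn_trans d2).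
have huv : has (meet u v) cs by rewrite has_find (ltn_trans d1) // (ltn_trans d2).
apply/and5P; split=> //; last by rewrite /= inE vu orbT.
- by rewrite /= -/cs !head.
- by rewrite /= -/cs !head.
- by rewrite /= -/cs !head.
Qed.

Lemma ordS_inj : injective (@ordS N).
Proof.
by move=> b c e; rewrite -(@linB1 m (Posz b + 1) b) ?(@linB1 m _ c) // lin_ordS lin_ord.
Qed.

(** The first bar of [L] is [b] itself or shares no line with it and commutes. A bar from the left
    would pass the element on [b]; one on the right would begin a left tangled triple. *)
Lemma leftmost_source D L s b : red D L -> narrow D -> D (ordS b) + 1 < D b ->
  noPass D (Posz b) -> (forall u v w, ~~ LT (crossings_from s L) u v w) ->
  exists2 L', red D (b :: L') & eqr s L (b :: L').
Proof.
elim: L s D => [|c L IH] s D rL nD db np noLT.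
  by move: db; move/eqP: rL => ->; rewrite !ffunE.
have [ecb|ncb] := eqVneq c b; first by exists L; rewrite -ecb.
have /andP [dc rL'] := rL; have nc := desc_neq dc; have nb := desc_neq db.
have nD' := narrow_step dc nD.
have [ecb'|ncb'] := eqVneq (ordS c) b.
  have := np (Posz b - 1); have lb : lin (Posz b - 1) = c by apply: linB1; rewrite lin_ord.
  move: dc; rewrite (desc_at _ lb) /desc subrK => dc.
  by move=> /(_ ltac:(clear; lia)); rewrite ltNge (ltW dc).
have [ecb2|ncb2] := eqVneq c (ordS b).
  (* The bar [c] exchanges [p + 1] and [p + 2]. The element on [p] still crosses both and, by
     [between], meets the one coming from [p + 2] first: this is left tangled. *)
  exfalso; pose p := Posz b.
  have dp : desc D p by rewrite -(@desc_at _ D b p) // lin_ord.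
  have dp1 : desc D (p + 1) by rewrite -(@desc_at _ D c) // lin_ordS lin_ord.
  have lp : lin p = b by rewrite lin_ord.
  have lp1 : lin (p + 1) = c by rewrite lin_ordS lp.
  have lp2 : lin (p + 2) = ordS c by rewrite -lp1 -lin_ordS; congr lin; clear; lia.
  have Hp : gp D (p + 2) < gp D p.
    move: dp dp1; rewrite /desc; have -> : p + 1 + 1 = p + 2 by clear; lia.
    by clear; lia.
  have np2 := @inverted_neq _ p (p + 2) ltac:(clear; lia) Hp.
  have np1 := desc_neql dp.
  rewrite lp lp2 in np2.
  have rp : refl c p = p by apply: refl_id; rewrite lp ?[b == c]eq_sym.
  have rp1 : refl c (p + 1) = p + 2 by rewrite refl_at // /p; clear; lia.
  have rp2 : refl c (p + 2) = p + 1.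
    by rewrite -(refl_next nc lp1); congr refl; clear; lia.
  have := @between _ _ (cross_bar s c) p (p + 1) (p + 2) rL' nD' ltac:(clear; lia) ltac:(clear; lia).
  rewrite !gp_step // rp rp2 lp lp1 lp2 => /(_ dp _ nc); rewrite eq_sym ncb => /(_ isT).
  have nocross := simple_head nc (red_simple s rL nD).
  have e1 : cross_bar s c c = s (ordS c) by rewrite /cross_bar permM tpermL.
  have e2 : cross_bar s c (ordS c) = s c by rewrite /cross_bar permM tpermR.
  have e3 : cross_bar s c b = s b.
    by rewrite /cross_bar permM tpermD // eq_sym.
  rewrite /= e1 e2 e3; set cs := crossings_from _ L.
  have -> : find (meet (s (ordS c)) (s c)) cs = size cs.
    by rewrite hasNfind // (eq_has (meetCl _ _)).
  rewrite [X in _ || X]leq_gtF ?find_size // orbF => H.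
  have Hh : has (meet (s b) (s c)) cs.
    have := @red_cross _ _ _ (cross_bar s c) p (p + 2) rL'.
    rewrite !gp_step // rp rp2 lp lp2 e2 e3; apply => //; clear; lia.
  have U : uniq [:: s (ordS c); s c; s b].
    by rewrite /= !inE !(inj_eq perm_inj) negb_or ncb [_ == c]eq_sym nc ncb'.
  have hm : meet (s (ordS c)) (s c) (s c, s (ordS c)) by rewrite /meet eqxx orbT.
  have [m1 m2] := meet_other U hm.
  case/negP: (noLT (s (ordS c)) (s c) (s b)); apply/and5P; split=> //.
  - by rewrite /= -/cs hm m1.
  - rewrite /= -/cs m1 m2 ltnS (eq_find (meetCl _ (s b))).
    by rewrite [X in (_ < X)%N](eq_find (meetCl _ (s b))).
  - by rewrite /= -/cs m2 ltnS -has_find (eq_has (meetCl _ _)).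
  - by rewrite /= inE eqxx.
have dj : disj c b.
  by apply/and4P; split=> //; apply: contraNneq ncb => /ordS_inj/eqP.
have dj' : disj b c by rewrite disjC.
have := IH (cross_bar s c) _ rL' nD' _ (noPass_disj nc dj np) _.
rewrite !(step_disj _ dj) => /(_ db) [|L' rL2 e2].
  by move=> u v w; apply: contra (noLT u v w); exact: (LT_cons rL nD).
exists (c :: L').
  move: rL2 => /= /andP [_ rL2]; rewrite db !(step_disj _ dj') dc /=.
  by rewrite step_comm.
by apply: eqr_trans (eqr_swap _ _ dj); apply/eqr_cons.
Qed.

(** The order of two crossings on a common pseudoline can be read off its route, while depths
    themselves change under commutation. *)
Lemma find_index (i j k : 'I_N) cs : (forall c, c \in cs -> c.1 != c.2) ->
  i != j -> i != k -> j != k ->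
  (find (meet i j) cs < find (meet i k) cs)%N =
  (index j (pmap (partner i) cs) < index k (pmap (partner i) cs))%N.
Proof.
move=> + nij nik njk; elim: cs => //= -[x y] cs IH Hcs.
have nxy := Hcs (x, y) (mem_head _ _).
have {}IH := IH (fun c Hc => Hcs c (@mem_behead _ ((x, y) :: cs) c Hc)).
rewrite /partner /= in nxy *.
have mx z : i != z -> meet i z (x, y) = if x == i then y == z else if y == i then x == z else false.
  move=> niz; rewrite /meet !xpair_eqE.
  have [->|nx] := eqVneq x i; first by rewrite (negPf niz) /= orbF.
  by have [->|ny] := eqVneq y i; rewrite ?andbT ?andbF.
rewrite !mx //; case: (x == i).
  rewrite /=; case: (y =P j) => [->|_]; first by rewrite (negPf njk).
  by case: (y == k); rewrite ?ltn0 ?ltnS.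
case: (y == i) => //=; case: (x =P j) => [->|_]; first by rewrite (negPf njk).
by case: (x == k); rewrite ?ltn0 ?ltnS.
Qed.

(** The two comparisons in [LT] concern crossings on [u] and on [w] respectively, and the
    orientation of a crossing depends on [D] only. *)
Lemma LT_eqr D L1 L2 s u v w : red D L1 -> red D L2 -> narrow D ->
  eqr s L1 L2 -> LT (crossings_from s L1) u v w -> LT (crossings_from s L2) u v w.
Proof.
move=> r1 r2 nD E /and5P [d1 d2 d3 U vu]; have [nuv nuw nvw] := uniq3P U.
have n1 := fun c : 'I_N * 'I_N => @crossings_neq m s L1 c (red_proper r1).
have n2 := fun c : 'I_N * 'I_N => @crossings_neq m s L2 c (red_proper r2).
have nwu : w != u by rewrite eq_sym.
have nwv : w != v by rewrite eq_sym.
have mem2 x y : (x, y) \in crossings_from s L1 -> (x, y) \in crossings_from s L2.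
  by case/(red_inverted r1) => p [q [lt H <- <-]]; exact: (red_right s r2 lt H).
apply/and5P; split=> //.
- move: d1; rewrite (find_index n1 nuv nuw nvw) (find_index n2 nuv nuw nvw).
  by have := E u; rewrite /route_from => ->.
- move: d2; rewrite ![find (meet _ w) _](eq_find (meetCl _ w)).
  rewrite (find_index n1 nwu nwv nuv) (find_index n2 nwu nwv nuv).
  by have := E w; rewrite /route_from => ->.
- move: d3; rewrite -!has_find => /hasP [[x y] /mem2 H mt].
  by apply/hasP; exists (x, y).
- exact: mem2.
Qed.

Lemma root_unique D R L s : red D R -> leftmost D R -> narrow D -> red D L ->
  (forall u v w, ~~ LT (crossings_from s L) u v w) -> eqr s R L.
Proof.
elim: R s D L => [|b R IH] s D L.
  by move=> /eqP -> _ _; case: L => //= c L; rewrite !ffunE.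
move=> /= /andP [db rR] [np lR] nD rL noLT.
have [L' rL' eL'] := leftmost_source rL nD db np noLT.
apply: eqr_trans (eqr_sym eL'); apply/eqr_cons.
have rL2 : red (advance D b) L' by case/andP: rL'.
apply: IH rR lR (narrow_step db nD) rL2 _ => u v w.
apply: contra (noLT u v w) => H; apply: (LT_eqr rL' rL nD (eqr_sym eL')).
exact: (LT_cons rL' nD H).
Qed.

End Root.

(** * Descents *)

Section Descents.
Variable m : nat.
Local Notation N := (m.+1).
Local Notation lin := (@lin m).
Implicit Types (p q h : int) (b i j u v w : 'I_N) (D : {ffun 'I_N -> int})
  (L : seq 'I_N) (s : 'S_N) (ps : seq int).

Definition total (F : int -> int) D : int := \sum_l F (D l).

(** Termination measure: crossing a descent changes it by [2 (D (ordS b) + 1 - D b) < 0]. *)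
Definition energy D := total (fun x => x * x) D.

Lemma total_step F D b : b != ordS b -> total F (advance D b) =
  total F D - F (D b) - F (D (ordS b)) + F (D (ordS b) + 1) + F (D b - 1).
Proof.
move=> nb; have nb' : ordS b != b by rewrite eq_sym.
rewrite /total (bigD1 b) // (bigD1 (ordS b)) //= [in RHS](bigD1 b) //=.
rewrite [in RHS](bigD1 (ordS b)) //= !ffunE !eqxx (negPf nb').
rewrite [X in _ + (_ + X)](eq_bigr (fun l => F (D l))) => [|l /andP [n1 n2]].
  by move: (\sum_(i | _) _) => S; lia.
by rewrite ffunE (negPf n1) (negPf n2).
Qed.

Lemma gp_inj_step D b : b != ordS b -> injective (gp D) -> injective (gp (advance D b)).
Proof. by move=> nb inj p q; rewrite !gp_step // => /inj; apply: (can_inj (fun x => reflK x nb)). Qed.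

Lemma red_gp_inj D L : red D L -> injective (gp D).
Proof.
elim: L D => [|b L IH] D; first by move/eqP => -> p q; rewrite /gp !ffunE; lia.
case/andP => /desc_neq nb /IH inj p q H.
have := inj (refl b p) (refl b q); rewrite !gp_step // !reflK // => /(_ H).
by apply: (can_inj (fun x => reflK x nb)).
Qed.

(** Without descents [gp D] increases, so [D] is weakly increasing along the lifted lines; being
    periodic it is constant, and its total is zero. *)
Lemma no_desc_zero D : total id D = 0 -> injective (gp D) ->
  (forall p, ~~ desc D p) -> D = [ffun=> 0].
Proof.
move=> s0 inj nd.
have le1 p : D (lin p) <= D (lin (p + 1)).
  have := nd p; have : gp D p != gp D (p + 1) by rewrite (inj_eq inj); lia.
  by rewrite /desc /gp; lia.
have lek p (k : nat) : D (lin p) <= D (lin (p + k%:Z)).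
  elim: k => [|k IH]; first by rewrite addr0.
  by apply: le_trans IH _; have := le1 (p + k%:Z); rewrite -addrA -PoszD addn1.
have const l : D l = D ord0.
  apply/le_anti/andP; split; last first.
    by have := lek 0 l; rewrite add0r lin_ord (@lin_ord m ord0).
  have := lek (Posz l) (N - l)%N; have -> : Posz l + (N - l)%N%:Z = 0 + N%:Z.
    by have := ltn_ord l; lia.
  by rewrite linDN lin_ord (@lin_ord m ord0).
apply/ffunP => l; rewrite ffunE const; move: s0; rewrite /total.
rewrite (eq_bigr (fun=> D ord0)) => [|i _]; last exact: const.
by rewrite sumr_const card_ord => /eqP; rewrite mulrn_eq0 /= => /eqP.
Qed.

Lemma energy_step D b : D (ordS b) + 1 < D b ->
  energy (advance D b) < energy D.
Proof. by move=> db; rewrite /energy total_step ?(desc_neq db) //; nia. Qed.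

Lemma red_total D L : red D L -> total id D = 0.
Proof.
elim: L D => [|b L IH] D.
  by move/eqP => ->; rewrite /total big1 // => l _; rewrite ffunE.
by case/andP => /desc_neq nb /IH; rewrite total_step //; lia.
Qed.

Lemma energy_ge0 D : 0 <= energy D.
Proof. by apply: sumr_ge0 => l _; rewrite -expr2 sqr_ge0. Qed.

(** The hypotheses say that [gp D] is an affine permutation. They survive the crossing of any
    descent, while the energy drops. *)
Lemma red_exists D : total id D = 0 -> injective (gp D) -> exists L, red D L.
Proof.
have [k] := ubnP `|energy D|%N; elim: k D => // k IH D lek s0 inj.
have [|] := boolP [exists b, D (ordS b) + 1 < D b]; last first.
  move=> H; exists [::]; apply/eqP; apply: no_desc_zero => // p.
  by rewrite desc_lin; apply: contra H => H; apply/existsP; exists (lin p).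
case/existsP => b db; have nb := desc_neq db.
have [|||L rL] := IH (advance D b); last by exists (b :: L); rewrite /= db.
- by have := energy_step db; have := energy_ge0 (advance D b); move: lek; lia.
- by rewrite total_step //; move: s0; lia.
- exact: gp_inj_step.
Qed.

(* Some element still has to pass from the left of bar [p] to its right; these
   are exactly the bars that reduced words use. *)
Definition over D p := exists2 q, q <= p & p < gp D q.

Lemma refl_le_stable b p q : lin p != b -> q <= p -> refl b q <= p.
Proof.
move=> nb; rewrite le_eqVlt => /orP [/eqP ->|lt]; last by have := refl_le b q; lia.
by rewrite /refl (negPf nb); case: ifP => _; lia.
Qed.

Lemma refl_gt_stable b p q : lin p != b -> p < q -> p < refl b q.
Proof.
move=> nb lt; have [e|ne] := eqVneq q (p + 1); last by have := refl_le b q; lia.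
rewrite /refl; case: eqP => [_|ne]; first by lia.
by case: eqP => [e2|_] //; case/eqP: nb; rewrite -(linB1 e2) e; congr lin; lia.
Qed.

(** As many elements go right across a bar as go left; existence is enough here. At the bar [p]
    itself one of its two elements is the witness, unless both end on the same side and the
    induction hypothesis gives a third. *)
Lemma red_over_under D L p : red D L -> over D p <-> exists2 q, p < q & gp D q <= p.
Proof.
elim: L D => [|b L IH] D.
  by move/eqP => ->; split=> -[q]; rewrite /gp ffunE; lia.
case/andP => db rL; have nb := desc_neq db; have := IH _ rL => {IH} [[IH1 IH2]].
have E q : gp D q = gp (advance D b) (refl b q) by rewrite gp_step // reflK.
have [e|ne] := eqVneq (lin p) b; last first.
  split=> -[q le gq].
    case: IH1 => [|q' le' gq']; first by exists (refl b q); [exact: refl_le_stable|rewrite -E].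
    by exists (refl b q'); [exact: refl_gt_stable|rewrite E reflK].
  case: IH2 => [|q' le' gq']; first by exists (refl b q); [exact: refl_gt_stable|rewrite -E].
  by exists (refl b q'); [exact: refl_le_stable|rewrite E reflK].
have dp : desc D p by rewrite -(desc_at _ e).
have E1 : gp (advance D b) p = gp D (p + 1) by rewrite gp_step // refl_at.
have E2 : gp (advance D b) (p + 1) = gp D p by rewrite gp_step // refl_next.
split=> -[q le gq].
  have [le1|gt1] := leP (gp D (p + 1)) p; first by exists (p + 1) => //; lia.
  case: IH1 => [|q1 le1 gq1]; first by exists p; rewrite ?E1.
  have ne : q1 != p + 1.
    by apply/negP => /eqP e1; move: gq1 dp; rewrite e1 E2 /desc; lia.
  exists (refl b q1); last by rewrite E reflK.
  by have := refl_le b q1; move: ne le1; clear; lia.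
have [le1|gt1] := ltP p (gp D p); first by exists p.
case: IH2 => [|q1 le1 gq1]; first by exists (p + 1); rewrite ?E2 //; clear; lia.
have ne : q1 != p.
  by apply/negP => /eqP e1; move: gq1 dp; rewrite e1 E1 /desc; lia.
exists (refl b q1); last by rewrite E reflK.
by have := refl_le b q1; move: ne le1; clear; lia.
Qed.

Lemma desc_over D L p : red D L -> desc D p -> over D p.
Proof.
move=> rL dp; have [lt|le] := ltP p (gp D p); first by exists p.
apply/(red_over_under p rL); exists (p + 1); first by clear; lia.
by apply: ltW; apply: lt_le_trans le.
Qed.

(** No bar comes newly into use, so a list made at the start stays complete. *)
Lemma over_step D L b p : red D L -> D (ordS b) + 1 < D b ->
  over (advance D b) p -> over D p.
Proof.
move=> rL db; have nb := desc_neq db; have [e _|ne] := eqVneq (lin p) b.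
  by apply: (desc_over rL); rewrite -(desc_at _ e).
by case=> q le gq; exists (refl b q); [exact: refl_le_stable|rewrite -gp_step].
Qed.

(** The element that has to pass does so in every word; this bounds the number of bars in use by the
    length. *)
Lemma over_used D L p : red D L -> over D p -> lin p \in L.
Proof.
elim: L D => [|b L IH] D; first by move/eqP => -> [q]; rewrite /gp ffunE; lia.
case/andP => db rL; have nb := desc_neq db; rewrite inE.
have [//|ne [q le gq]] := eqVneq (lin p) b.
apply: (IH _ rL); exists (refl b q); first exact: refl_le_stable.
by rewrite gp_step // reflK.
Qed.

(** The cut only ever moves right, one line at each bar [h]; so [h] never exceeds the target of its
    element. *)
Lemma vld_ge0 D h ps : vld D h ps -> 0 <= D (lin h).
Proof.
elim: ps D h => [|p ps IH] D h; first by move/eqP => ->; rewrite ffunE.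
case/and4P => le1 le2 dp /IH; have nb : lin p != ordS (lin p) by rewrite -lin_ordS (desc_neql dp).
have [e|ne] := eqVneq p h.
  subst h; rewrite /nxt eqxx; have := gp_step D (p + 1) nb.
  by rewrite refl_next // /gp; clear; lia.
rewrite /nxt (negPf ne); have := gp_step D h nb; rewrite refl_id /gp; first by clear; lia.
  by apply: lin_neq; lia.
by rewrite -lin_ordS; apply: lin_neq; lia.
Qed.

Lemma gp_nxt D h p : h <= p -> p <= h + N%:Z - 2 -> desc D p ->
  gp (advance D (lin p)) (nxt h p) = gp D h.
Proof.
move=> le1 le2 dp; have nb : lin p != ordS (lin p) by rewrite -lin_ordS (desc_neql dp).
rewrite gp_step // /nxt; case: eqP => [<-|ne]; first by rewrite refl_next.
by rewrite refl_id //; [|rewrite -lin_ordS]; apply: lin_neq; lia.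
Qed.

(* The descent [d] need not be crossed first: a third element can be brought to
   line [d + 1] before. *)
Definition avoidable D h d :=
  exists q, [/\ d + 1 < q, q <= h + N%:Z - 1 & gp D q < gp D (d + 1)].

(** A bar to the right of [d + 1] permutes the lines [d + 2], ..., [h + N - 1] among themselves. *)
Lemma refl_window h d p q : h <= d -> d + 1 < p -> p <= h + N%:Z - 2 ->
  d + 1 < q -> q <= h + N%:Z - 1 -> d + 1 < refl (lin p) q <= h + N%:Z - 1.
Proof.
move=> h1 h2 h3 h4 h5; have le := refl_le (lin p) q; apply/andP; split.
  have [e|ne] := eqVneq q (d + 2); last by move: ne le h4; clear; lia.
  rewrite /refl; case: ifP => _; first by rewrite e; clear; lia.
  case: eqP => [/linB1 el|_] //.
  have : lin (d + 1) != lin p by apply: lin_neq; lia.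
  by rewrite -el e; have -> : d + 2 - 1 = d + 1; [lia|rewrite eqxx].
have [e|ne] := eqVneq q (h + N%:Z - 1); last by move: ne le h5; clear; lia.
rewrite /refl (negPf (_ : lin q != lin p)); last by apply: lin_neqC; lia.
by case: ifP => _; move: e; clear; lia.
Qed.

Lemma avoidable_step D h d p : h <= d -> d + 1 < p -> p <= h + N%:Z - 2 ->
  lin p != ordS (lin p) -> avoidable (advance D (lin p)) h d <-> avoidable D h d.
Proof.
move=> h1 h2 h3 nb.
have rd : refl (lin p) (d + 1) = d + 1.
  by apply: refl_id; rewrite -?lin_ordS; apply: lin_neq; lia.
split=> -[q [l1 l2 H]]; exists (refl (lin p) q);
  have /andP [? ?] := refl_window h1 h2 h3 l1 l2; split=> //.
  by move: H; rewrite !gp_step // rd.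
by rewrite !gp_step // reflK // rd.
Qed.

(* A normal word starting to the right of [d + 1] can only cross the pair of the
   descent [d] after a third element has come to line [d + 1]. *)
Lemma normal_avoidable D h l ps d : vld D h ps -> path leR l ps -> d + 2 <= l ->
  h <= d -> desc D d -> avoidable D h d.
Proof.
elim: ps D h l => [|p ps IH] D h l.
  by move=> /eqP -> _ _ _; rewrite /desc /gp !ffunE; lia.
case/and4P => le1 le2 dp v /andP [lp pp] ld hd dd; rewrite /leR in lp.
have nb : lin p != ordS (lin p) by rewrite -lin_ordS (desc_neql dp).
have [e|ne] := eqVneq p (d + 1).
  (* Bar [d + 1] is a descent, so the element on line [d + 2] is the third one. *)
  exists (d + 2); move: dp; rewrite e /desc -addrA => dp.
  by split=> //; move: le2; rewrite e; clear; lia.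
have lt : d + 1 < p by move: ne lp ld; clear; lia.
apply/(avoidable_step D hd lt le2 nb).
have eh : nxt h p = h by rewrite /nxt ifF //; move: lt hd; clear; lia.
rewrite eh in v; apply: IH v pp _ (hd) _; first by move: lt; clear; lia.
have dj : disj (lin p) (lin d) by rewrite disjC; apply: far_disj => //; move: le2 hd; clear; lia.
by rewrite desc_lin !(step_disj _ dj) -desc_lin.
Qed.

(** Go left from [q] until the targets are no longer below that of [p]. This turns a witness of
    [avoidable] into a descent with a smaller target, so that comparing descents is enough. *)
Lemma first_desc D p q : p < q -> gp D q < gp D p ->
  exists e, [/\ p <= e, e < q, desc D e & gp D (e + 1) < gp D p].
Proof.
have [k] := ubnP `|q - p|%N; elim: k q => // k IH q lek lt H.
have [H2|H2] := ltP (gp D (q - 1)) (gp D p).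
  have lt2 : p < q - 1 by have [e|] := eqVneq (q - 1) p; [move: H2; rewrite e ltxx|lia].
  have [|e [? ? ? ?]] := IH (q - 1) _ lt2 H2; first by lia.
  by exists e; split=> //; lia.
exists (q - 1); rewrite /desc subrK; split=> //; [lia|lia|exact: lt_le_trans H2].
Qed.

End Descents.

(** * The search tree of normal words *)

Section Search.
Variable m : nat.
Local Notation N := (m.+1).
Local Notation lin := (@lin m).
Implicit Types (p q h : int) (b i j : 'I_N) (D : {ffun 'I_N -> int})
  (L : seq 'I_N) (s : 'S_N) (ps us w : seq int).

Definition wdesc D h p := [&& h <= p, p <= h + N%:Z - 2 & desc D p].

Definition scan_step D h (c p : int) (r : option int * option (int * int)) :=
  if wdesc D h p then
    (if c < p then Some p else r.1,
     if r.2 is Some (d, g) then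
       if g < gp D (p + 1) then Some (d, g) else Some (p, gp D (p + 1))
     else Some (p, gp D (p + 1)))
  else r.

(* One pass from right to left computes the least descent above [c] and the
   leftmost unavoidable descent, the latter paired with the target of its right
   element, which is the minimum over the descents seen so far. *)
Definition scan D h (c : int) us := foldr (scan_step D h c) (None, None) us.

Lemma scan_cand D h (c : int) us : path.sorted <%R us ->
  if (scan D h c us).1 is Some p then
    [/\ p \in us, wdesc D h p, c < p &
        forall e, e \in us -> wdesc D h e -> c < e -> p <= e]
  else forall e, e \in us -> wdesc D h e -> e <= c.
Proof.
elim: us => //= p us IH so; have {}IH := IH (path_sorted so).
have lt e : e \in us -> p < e.
  by move: so; rewrite (path_sortedE lt_trans) => /andP [/allP H _] /H.
have weak : if (scan D h c us).1 is Some p' then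
    [/\ p' \in p :: us, wdesc D h p', c < p' &
        forall e, e \in us -> wdesc D h e -> c < e -> p' <= e]
  else forall e, e \in us -> wdesc D h e -> e <= c.
  by case: (scan D h c us).1 IH => [p' [? ? ? ?]|//]; split; rewrite // inE; apply/orP; right.
rewrite /scan_step -/(scan D h c us); case: ifP => wp /=; last first.
  move: weak; case: (scan D h c us).1 => [p' [? ? ? H]|H]; [split=> //|] => e;
  by rewrite inE => /orP [/eqP ->|/H //]; rewrite wp.
case: ifP => cp /=.
  by split; rewrite ?inE ?eqxx // => e /orP [/eqP -> //|/lt /ltW].
move: weak; case: (scan D h c us).1 => [p' [? ? ? H]|H]; [split=> //|] => e;
by rewrite inE => /orP [/eqP ->|/H //]; rewrite ?cp // leNgt cp.
Qed.

Lemma scan_dst D h (c : int) us : path.sorted <%R us ->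
  if (scan D h c us).2 is Some (d, g) then
    [/\ d \in us, wdesc D h d, g = gp D (d + 1),
        forall e, e \in us -> wdesc D h e -> g <= gp D (e + 1) &
        forall e, e \in us -> wdesc D h e -> e < d -> g < gp D (e + 1)]
  else forall e, e \in us -> ~~ wdesc D h e.
Proof.
elim: us => //= p us IH so; have {}IH := IH (path_sorted so).
have lt e : e \in us -> p < e.
  by move: so; rewrite (path_sortedE lt_trans) => /andP [/allP H _] /H.
rewrite /scan_step -/(scan D h c us); case: ifP => wp /=; last first.
  move: IH; case: (scan D h c us).2 => [[d g] [H1 H2 H3 H4 H5]|H].
    split=> //; rewrite ?inE ?H1 ?orbT // => e; rewrite inE => /orP [/eqP ->|/[dup] he];
    by rewrite ?wp //; first [apply: H4|move=> _ ?; apply: H5].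
  by move=> e; rewrite inE => /orP [/eqP ->|/H //]; rewrite wp.
have new : (forall e, e \in us -> wdesc D h e -> gp D (p + 1) <= gp D (e + 1)) ->
  [/\ p \in p :: us, wdesc D h p, gp D (p + 1) = gp D (p + 1),
    forall e, e \in p :: us -> wdesc D h e -> gp D (p + 1) <= gp D (e + 1) &
    forall e, e \in p :: us -> wdesc D h e -> e < p -> gp D (p + 1) < gp D (e + 1)].
  move=> H; split=> //; first exact: mem_head.
    by move=> e; rewrite inE => /orP [/eqP ->|/H].
  by move=> e; rewrite inE => /orP [/eqP ->|/lt /ltW]; rewrite ?ltxx // leNgt => /negPf ->.
move: IH; case: (scan D h c us).2 => [[d g] [H1 H2 H3 H4 H5]|H]; last first.
  by apply: new => e /H /negPf ->.
case: ifP => gt; last first.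
  apply: new => e eu we; apply: le_trans (H4 e eu we).
  by rewrite leNgt gt.
split=> //; rewrite ?inE ?H1 ?orbT // => e; rewrite inE => /orP [/eqP ->|he] we //.
- exact: ltW.
- exact: H4.
- exact: H5.
Qed.

(* Descents up to one place to the right of the leftmost unavoidable one are
   exactly those that some normal word starts with. *)
Definition try_next D h (c : int) us : option int :=
  if scan D h c us is (Some p, Some (d, _)) then
    if p <= d + 1 then Some p else None
  else None.

Variables (y : {ffun 'I_N -> int}) (a : int) (us0 : seq int).
Hypothesis us0_sorted : path.sorted <%R us0.
Hypothesis mem_us0 : forall p, a <= p -> p < a + 2 * N%:Z -> over y p -> p \in us0.
Hypothesis ya_le : y (lin a) <= N%:Z.

(** [reached_top] bounds [h], since the target of the cut is fixed and at most N lines away from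
    [a]; [reached_over] keeps all usable bars in [us0]. *)
Record reached D h : Prop := Reached {
  reached_total : total id D = 0;
  reached_inj : injective (gp D);
  reached_noPass : noPass D h;
  reached_top : gp D h = gp y a;
  reached_ge : a <= h;
  reached_over : forall p, over D p -> over y p
}.

Lemma reached_step D h p :
  reached D h -> wdesc D h p -> reached (advance D (lin p)) (nxt h p).
Proof.
move=> [tD iD nD gD leD oD] /and3P [le1 le2 dp].
have db : D (ordS (lin p)) + 1 < D (lin p) by rewrite -desc_lin.
have nb := desc_neq db; have [L rL] := red_exists tD iD; split.
- by rewrite total_step //; move: tD; clear; lia.
- exact: gp_inj_step.
- exact: noPass_step.
- by rewrite gp_nxt.
- by rewrite /nxt; case: ifP => _; move: leD; clear; lia.
- by move=> q oq; apply/oD/(over_step rL db oq).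
Qed.

Lemma reached_red D h : reached D h -> exists L, red D L.
Proof. by case=> tD iD _ _ _ _; apply: red_exists. Qed.

Lemma reached_mem D h p : reached D h -> wdesc D h p -> p \in us0.
Proof.
move=> rD /and3P [le1 le2 dp]; have [L rL] := reached_red rD.
have [ps v _] := red_vld rL (reached_noPass rD).
have := vld_ge0 v; have := reached_top rD; rewrite /gp => e1 e2.
apply: mem_us0.
- exact: le_trans (reached_ge rD) le1.
- by move: e1 e2 le2 ya_le; clear; lia.
- by apply: (reached_over rD); apply: (desc_over rL).
Qed.

(** A nonzero [D] has a descent; its lift in [[h, h + N - 1]] is not the last bar, by [noPass]. *)
Lemma reached_wdesc D h : reached D h -> D <> [ffun=> 0] -> exists p, wdesc D h p.
Proof.
case=> tD iD nD _ _ _ nz.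
have [/hasP [p _ wp]|/hasPn H] := boolP (has (wdesc D h) [seq h + k%:Z | k <- iota 0 N]).
  by exists p.
case: nz; apply: no_desc_zero => // p; apply/negP => dp.
have [q /eqP/lin_eqP [k e] /andP [le1 lt1]] := lin_lift (lin p) h.
have dq : desc D q by rewrite desc_lin (_ : lin q = lin p) -?desc_lin // e linD.
have [e1|ne] := eqVneq q (h - 1 + N%:Z).
  have := nD (h - 1); move: dq; rewrite e1 /desc gpDN1.
  have -> : h - 1 + N%:Z + 1 = h + N%:Z by clear; lia.
  by rewrite gpDN1; clear; lia.
have := H q; rewrite /wdesc le1 dq; apply/implyP; rewrite negb_imply negbK andbT.
apply/andP; split; last by move: lt1 ne; clear; lia.
apply/mapP; exists `|(q - h)%R|%N; last by move: le1; clear; lia.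
by rewrite mem_iota; move: le1 lt1; clear; lia.
Qed.

Definition try D h c := try_next D h c us0.

Lemma try_some D h c p : reached D h -> try D h c = Some p ->
  [/\ wdesc D h p, c < p, forall e, wdesc D h e -> c < e -> p <= e &
      forall e, wdesc D h e -> e < p - 1 -> avoidable D h e].
Proof.
move=> rD; rewrite /try /try_next.
have := scan_cand D h c us0_sorted; have := scan_dst D h c us0_sorted.
case: (scan D h c us0) => -[p'|] [[d g]|] //=.
move=> [d1 d2 d3 d4 d5] [p1 p2 p3 p4]; case: ifP => // le [<-]; split=> //.
  by move=> e we; apply: p4 => //; apply: (reached_mem rD).
move=> e we lt; have ed : e < d by move: le lt; clear; lia.
(* The target on line [d + 1] is strictly below those of all descents to the left of [d]. *)
exists (d + 1); rewrite -d3; split; last exact: d5 (reached_mem rD we) we ed.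
  by move: ed; clear; lia.
by case/and3P: d2 => _ + _; clear; lia.
Qed.

(** A witness would yield, by [first_desc], a descent in the window with a smaller target. *)
Lemma unavoidable_dst D h d : reached D h -> wdesc D h d ->
  (forall e, e \in us0 -> wdesc D h e -> gp D (d + 1) <= gp D (e + 1)) ->
  ~ avoidable D h d.
Proof.
move=> rD wd d4 [q [lt1 lt2]]; case/(first_desc lt1) => e [le1 le2 de].
have we : wdesc D h e.
  by case/and3P: wd => h1 h2 _; apply/and3P; split=> //; move: le1 le2 lt2 h1; clear; lia.
by have := d4 e (reached_mem rD we) we; rewrite leNgt => /negPf ->.
Qed.

Lemma exists_unavoidable D h p : reached D h -> wdesc D h p ->
  exists2 d, wdesc D h d & ~ avoidable D h d.
Proof.
move=> rD wp; have := scan_dst D h 0 us0_sorted.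
case: (scan D h 0 us0).2 => [[d g] [d1 d2 d3 d4 d5]|H]; last first.
  by have := H p (reached_mem rD wp); rewrite wp.
by exists d => //; apply: unavoidable_dst => //; rewrite -d3.
Qed.

Lemma try_none D h c : reached D h -> try D h c = None ->
  (forall e, wdesc D h e -> e <= c) \/
  exists p d, [/\ wdesc D h p, c < p, forall e, wdesc D h e -> c < e -> p <= e,
     wdesc D h d /\ d < p - 1 & ~ avoidable D h d].
Proof.
move=> rD; rewrite /try /try_next.
have := scan_cand D h c us0_sorted; have := scan_dst D h c us0_sorted.
case: (scan D h c us0) => -[p'|] dg /=; last first.
  by move=> _ H _; left=> e we; apply: H => //; apply: (reached_mem rD).
case: dg => [[d g]|].
  move=> [d1 d2 d3 d4 d5] [p1 p2 p3 p4]; case: ifP => // le _; right.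
  exists p', d; split=> //.
  - by move=> e we; apply: p4 => //; apply: (reached_mem rD).
  - by split=> //; move: le; clear; lia.
  by apply: unavoidable_dst => //; rewrite -d3.
by move=> H [p1 p2 p3 p4] _; have := H p' p1; rewrite p2.
Qed.

Fixpoint run D h ps : {ffun 'I_N -> int} * int :=
  if ps is p :: ps' then run (advance D (lin p)) (nxt h p) ps' else (D, h).

Lemma run_rcons D h ps p : run D h (rcons ps p) =
  (advance (run D h ps).1 (lin p), nxt (run D h ps).2 p).
Proof. by elim: ps D h => //= q ps IH D h; rewrite IH. Qed.

Definition lst ps := last a ps.
Definition curD ps := (run y a ps).1.
Definition curh ps := (run y a ps).2.

Lemma curD_rcons ps p : curD (rcons ps p) = advance (curD ps) (lin p).
Proof. by rewrite /curD run_rcons. Qed.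

Lemma curh_rcons ps p : curh (rcons ps p) = nxt (curh ps) p.
Proof. by rewrite /curh run_rcons. Qed.

Lemma lst_rcons ps p : lst (rcons ps p) = p.
Proof. by rewrite /lst last_rcons. Qed.

Definition try_at ps c := try (curD ps) (curh ps) c.

(** [node_avoid] excludes dead ends: descents too far left for the next bar of a normal word can
    wait. *)
Record node ps : Prop := Node {
  node_reached : reached (curD ps) (curh ps);
  node_avoid : forall d, wdesc (curD ps) (curh ps) d -> d < lst ps - 1 ->
    avoidable (curD ps) (curh ps) d;
  node_red : forall L, red (curD ps) L -> red y (map lin ps ++ L)
}.

Lemma node_child ps c p : node ps -> try_at ps c = Some p -> node (rcons ps p).
Proof.
move=> [rD aD redD] /(try_some rD) [wp cp mp ap].
have /and3P [h1 h2 dp] := wp.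
have nb : lin p != ordS (lin p) by rewrite -lin_ordS (desc_neql dp).
split; rewrite ?curD_rcons ?curh_rcons ?lst_rcons.
- exact: reached_step.
- move=> d /and3P [d1 d2 dd] lt.
  have hp : nxt (curh ps) p = curh ps.
    by move: d1; rewrite /nxt; case: eqP => // e; move: lt; rewrite e; clear; lia.
  rewrite hp in d1 d2 *.
  have dj : disj (lin p) (lin d).
    by rewrite disjC; apply: far_disj; move: h2 d1 lt; clear; lia.
  apply/avoidable_step => //; first by move: lt; clear; lia.
  apply: ap => //; apply/and3P; split=> //.
  by move: dd; rewrite desc_lin !(step_disj _ dj) -desc_lin.
- by move=> L rL; rewrite map_rcons cat_rcons; apply: redD; rewrite /= rL -desc_lin dp.
Qed.

(** * Subtrees of normal words and their traversal *)

Definition normal_from ps w :=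
  exists r, [/\ w = ps ++ r, vld (curD ps) (curh ps) r & path leR (lst ps) r].

Definition normal_above ps (c : int) w := exists p r, [/\ w = ps ++ p :: r, c < p,
  vld (curD ps) (curh ps) (p :: r) & path leR (lst ps) (p :: r)].

(** [try_at] looks strictly above its threshold, and a normal word may go back by one: hence
    [lst ps - 2]. This relation and the next specify the loops of the program. *)
Inductive descend : seq int -> seq int -> Prop :=
  | DescendStop ps : try_at ps (lst ps - 2) = None -> descend ps ps
  | DescendGo ps p w : try_at ps (lst ps - 2) = Some p ->
      descend (rcons ps p) w -> descend ps w.

Inductive backtrack : seq int -> option (seq int) -> Prop :=
  | BackNil : backtrack [::] None
  | BackSibling ps c p : try_at ps c = Some p ->
      backtrack (rcons ps c) (Some (rcons ps p))
  | BackUp ps c r : try_at ps c = None -> backtrack ps r ->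
      backtrack (rcons ps c) r.

Definition next w w' := exists2 ps, backtrack w (Some ps) & descend ps w'.

Fixpoint chain w T := if T is w' :: T' then next w w' /\ chain w' T' else True.

Lemma chain_cat w T1 T2 :
  chain w T1 -> chain (last w T1) T2 -> chain w (T1 ++ T2).
Proof. by elim: T1 w => //= w' T1 IH w [n c] /(IH _ c). Qed.

(** By the last clause, leaving the last listed word continues as leaving [ps0] does; this joins the
    lists of successive siblings. *)
Definition lists_tree ps0 (P : seq int -> Prop) ps1 := exists w T,
  [/\ descend ps1 w, chain w T, uniq (w :: T), forall x, x \in w :: T <-> P x &
      forall r, backtrack ps0 r -> backtrack (last w T) r].

Lemma normal_above_none ps c w : node ps -> try_at ps c = None ->
  lst ps - 2 <= c -> ~ normal_above ps c w.
Proof.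
move=> [rD aD _] tn lc [p [r [_ cp v]]] /= /andP [lp pr].
have /and4P [h1 h2 dp _] := v.
have wp : wdesc (curD ps) (curh ps) p by apply/and3P.
case: (try_none rD tn) => [/(_ p wp)|[p' [d [wp' cp' mp' [wd dp'] na]]]].
  by rewrite leNgt cp.
(* A normal word continuing with [p] can cross the pair of [d], more than one place further left,
   only if [d] is avoidable. *)
case: na; have /and3P [d1 d2 dd] := wd.
apply: (@normal_avoidable _ _ _ (p + 1) (p :: r)) => //=.
  by rewrite pr /leR andbT; clear; lia.
by have := mp' p wp cp; move: dp'; clear; lia.
Qed.

Lemma normal_above_some ps c p w : node ps -> try_at ps c = Some p ->
  lst ps - 2 <= c ->
  normal_above ps c w <-> normal_from (rcons ps p) w \/ normal_above ps p w.
Proof.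
move=> [rD aD _] /(try_some rD) [wp cp mp ap] lc; have /and3P [h1 h2 dp] := wp.
rewrite /normal_from curD_rcons curh_rcons lst_rcons; split.
  case=> q [r [-> cq /[dup] v /and4P [q1 q2 dq v'] pq]].
  have := mp q; rewrite /wdesc q1 q2 dq => /(_ isT cq); rewrite le_eqVlt => /orP [/eqP e|lt].
    left; exists r; rewrite cat_rcons -e in v' *; rewrite e; split=> //.
      by rewrite e in v'.
    by case/andP: pq => _; rewrite -e.
  by right; exists q, r.
case=> [[r [-> v pr]]|[q [r [-> cq v pr]]]].
  exists p, r; split=> //; first by rewrite cat_rcons.
    by rewrite /= h1 h2 dp v.
  by rewrite /= pr andbT /leR; move: cp lc; clear; lia.
by exists q, r; split=> //; apply: lt_trans cq.
Qed.

(** Siblings come in increasing order, so fewer and fewer bars of [us0] lie above the one tried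
    last. *)
Lemma lists_tree_above ps (subtree : forall c p : int, try_at ps c = Some p ->
    lists_tree (rcons ps p) (normal_from (rcons ps p)) (rcons ps p)) (c p : int) :
  node ps -> lst ps - 2 <= c -> try_at ps c = Some p ->
  lists_tree ps (normal_above ps c) (rcons ps p).
Proof.
move=> nps; have rD := node_reached nps.
have [k] := ubnP (size [seq u <- us0 | c < u]); elim: k c p => // k IH c p lek lc tc.
have [wp cp mp ap] := try_some rD tc.
have [w [T [d1 ch1 u1 m1 b1]]] := subtree _ _ tc.
case tp : (try_at ps p) => [p'|]; last first.
  have lp : lst ps - 2 <= p by move: lc cp; clear; lia.
  exists w, T; split=> // [x|r br]; last by apply: b1; apply: BackUp.
  apply: (iff_trans (m1 x)); apply: iff_sym.
  apply: (iff_trans (normal_above_some x nps tc lc)); split=> [[//|]|]; last by left.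
  by move/(normal_above_none nps tp lp).
have [||w' [T' [d2 ch2 u2 m2 b2]]] := IH p p' _ _ tp.
- rewrite -ltnS; apply: leq_trans lek; rewrite ltnS !size_filter.
  have -> : count (fun u => c < u) us0 = (count (fun u => (p < u)%R) us0
      + count (fun u => (c < u)%R && (u <= p)%R) us0)%N.
    rewrite -count_predUI (eq_count (a1 := predI _ _) (a2 := pred0)) ?count_pred0 ?addn0 => [|u] /=.
      by apply: eq_count => u /=; move: cp; clear; lia.
    by clear; lia.
  rewrite -[X in (X < _)%N]addn0 ltn_add2l -has_count; apply/hasP; exists p.
    exact: reached_mem rD wp.
  by rewrite cp lexx.
- by move: lc cp; clear; lia.
exists w, (T ++ w' :: T'); split=> //.
- apply: chain_cat => //=; split=> //.
  by exists (rcons ps p') => //; apply: b1; apply: BackSibling.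
- rewrite -cat_cons cat_uniq u1 u2 andbT; apply/hasPn => x /m2 [q [r [-> pq _ _]]].
  apply/negP => /m1 [r' [e _ _]]; move: e; rewrite cat_rcons => /eqP.
  by rewrite eqseq_cat // eqxx /= eqseq_cons => /andP [/eqP e _]; rewrite e ltxx in pq.
- move=> x; apply: iff_sym; apply: (iff_trans (normal_above_some x nps tc lc)).
  rewrite -cat_cons mem_cat; split; first by case=> [/m1|/m2] ->; rewrite ?orbT.
  by case/orP => [/m1|/m2]; [left|right].
- by move=> r /b2; rewrite last_cat.
Qed.

Lemma lists_tree_node ps : node ps -> lists_tree ps (normal_from ps) ps.
Proof.
have [k] := ubnP `|energy (curD ps)|%N; elim: k ps => // k IH ps lek nps.
have rD := node_reached nps.
have [z|/eqP nz] := eqVneq (curD ps) [ffun=> 0].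
  have nw e : ~~ wdesc (curD ps) (curh ps) e.
    by rewrite /wdesc z /desc /gp !ffunE; clear; lia.
  exists ps, [::]; split=> //.
    apply: DescendStop; case tc : (try_at _ _) => [p|] //.
    by have [wp _ _ _] := try_some rD tc; rewrite (negPf (nw p)) in wp.
  move=> x; rewrite inE; split=> [/eqP ->|[r [-> ]]].
    by exists [::]; rewrite cats0; split=> //=; rewrite z.
  case: r => [|p r /and4P [h1 h2 dp _]]; first by rewrite cats0.
  by case/negP: (nw p); apply/and3P.
have [p0 wp0] := reached_wdesc rD nz.
case tc : (try_at ps (lst ps - 2)) => [p|]; last first.
  (* No dead end: by [node_avoid] an unavoidable descent is at least [lst ps - 1], hence a
     candidate, so the least candidate cannot lie beyond it. *)
  exfalso; case: (try_none rD tc) => [H|[p [d [wp cp mp [wd dp] na]]]].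
    have [d wd na] := exists_unavoidable rD wp0; apply: na.
    by apply: (node_avoid nps) => //; have := H d wd; clear; lia.
  apply: na; apply: (node_avoid nps) => //.
  by rewrite ltNge; apply/negP => le; have := mp d wd; move: le dp; clear; lia.
have [wp _ _ _] := try_some rD tc.
have subtree c q : try_at ps c = Some q ->
    lists_tree (rcons ps q) (normal_from (rcons ps q)) (rcons ps q).
  move=> tq; apply: IH (node_child nps tq); rewrite curD_rcons.
  have [/and3P [_ _ dq] _ _ _] := try_some rD tq.
  have := @energy_step _ (curD ps) (lin q); rewrite -desc_lin => /(_ dq).
  by have := energy_ge0 (advance (curD ps) (lin q)); move: lek; clear; lia.
have [w [T [d1 ch1 u1 m1 b1]]] := lists_tree_above subtree nps (lexx _) tc.
exists w, T; split=> //; first exact: DescendGo tc d1.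
move=> x; rewrite m1; split=> [[q [r [-> cq v pq]]]|[r [-> v pr]]].
  by exists (q :: r).
case: r v pr => [/eqP //|q r v pr]; exists q, r; split=> //.
by case/andP: pr; rewrite /leR; clear; lia.
Qed.

End Search.

(** * The programs *)

Section Machine.
Variable W : nat.
Implicit Types (s : state) (Q : state -> Prop) (c : cmd) (cs : seq cmd).

Definition quiet (tr : seq step) := all (fun e => if e is Tick then true else false) tr.

(** A total-correctness triple with a time budget, for silent runs. *)
Definition ok c s (T : nat) Q := exists tr s',
  [/\ exec W c s tr s', quiet tr, (size tr <= T)%N & Q s'].

(** Each block ends in a [Skip], whose unit of time is counted by [ok_nil]. *)
Definition seqs := foldr Seq Skip.

Lemma ok_mono c s T T' Q Q' : ok c s T Q -> (T <= T')%N ->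
  (forall s', Q s' -> Q' s') -> ok c s T' Q'.
Proof.
move=> [tr [s' [e q sz H]]] le HQ; exists tr, s'; split=> //; last exact: HQ.
exact: leq_trans le.
Qed.

Lemma ok_seq c1 c2 s T1 T2 Q :
  ok c1 s T1 (fun s' => ok c2 s' T2 Q) -> ok (Seq c1 c2) s (T1 + T2) Q.
Proof.
move=> [tr1 [s1 [e1 q1 sz1 [tr2 [s2 [e2 q2 sz2 H]]]]]]; exists (tr1 ++ tr2), s2.
split=> //; [exact: ExecSeq e1 e2|by rewrite /quiet all_cat; apply/andP|].
by rewrite size_cat leq_add.
Qed.

Lemma ok_nil s T Q : Q s -> ok (seqs [::]) s T.+1 Q.
Proof. by move=> H; exists [:: Tick], s; split=> //; exact: ExecSkip. Qed.

Lemma ok_tick c cs s s1 T Q : exec W c s [:: Tick] s1 ->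
  ok (seqs cs) s1 T Q -> ok (seqs (c :: cs)) s T.+1 Q.
Proof.
move=> e H; rewrite -[T.+1]/(1 + T)%N; apply: ok_seq.
by exists [:: Tick], s1; split.
Qed.

Lemma ok_const x (v : int) cs s T Q : (`|v| <= W)%N ->
  ok (seqs cs) (set_reg s x v) T Q -> ok (seqs (Const x v :: cs)) s T.+1 Q.
Proof. by move=> le; apply: ok_tick; exact: ExecConst. Qed.

Lemma ok_op o x y z v cs s T Q : eval_binop o (regs s y) (regs s z) = v ->
  (`|v| <= W)%N ->
  ok (seqs cs) (set_reg s x v) T Q -> ok (seqs (Op o x y z :: cs)) s T.+1 Q.
Proof. by move=> <- le; apply: ok_tick; exact: ExecOp. Qed.

Lemma ok_read x y (k : nat) v cs s T Q : regs s y = Posz k -> memory s k = v ->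
  ok (seqs cs) (set_reg s x v) T Q -> ok (seqs (Read x y :: cs)) s T.+1 Q.
Proof. by move=> e <-; apply: ok_tick; exact: ExecRead. Qed.

Lemma ok_write x y (k : nat) v cs s T Q : regs s x = Posz k -> regs s y = v ->
  ok (seqs cs) (set_mem s k v) T Q -> ok (seqs (Write x y :: cs)) s T.+1 Q.
Proof. by move=> e <-; apply: ok_tick; exact: ExecWrite. Qed.

Lemma ok_cons c cs s T1 T2 Q : ok c s T1 (fun s' => ok (seqs cs) s' T2 Q) ->
  ok (seqs (c :: cs)) s (T1 + T2) Q.
Proof. exact: ok_seq. Qed.

Lemma ok_if x c1 c2 s T Q : (0 < regs s x -> ok c1 s T Q) ->
  (regs s x <= 0 -> ok c2 s T Q) -> ok (If x c1 c2) s T.+1 Q.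
Proof.
move=> H1 H2; have [le|lt] := leP (regs s x) 0.
  have [tr [s' [e q sz H]]] := H2 le; exists (Tick :: tr), s'; split=> //.
  exact: ExecIfNpos.
have [tr [s' [e q sz H]]] := H1 lt; exists (Tick :: tr), s'; split=> //.
exact: ExecIfPos.
Qed.

Lemma ok_if_last x c1 c2 s T Q : (0 < regs s x -> ok c1 s T Q) ->
  (regs s x <= 0 -> ok c2 s T Q) -> ok (seqs [:: If x c1 c2]) s T.+2 Q.
Proof.
move=> H1 H2; rewrite -addn1; apply: ok_cons; apply: ok_if => H.
  by apply: ok_mono (H1 H) _ _ => // s' Qs; apply: ok_nil.
by apply: ok_mono (H2 H) _ _ => // s' Qs; apply: ok_nil.
Qed.

Lemma ok_if_cons x c1 c2 cs s T1 T2 Q :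
  (0 < regs s x -> ok c1 s T1 (fun s' => ok (seqs cs) s' T2 Q)) ->
  (regs s x <= 0 -> ok c2 s T1 (fun s' => ok (seqs cs) s' T2 Q)) ->
  ok (seqs (If x c1 c2 :: cs)) s (T1 + T2).+1 Q.
Proof. by move=> H1 H2; rewrite -addSn; apply: ok_cons; apply: ok_if. Qed.

(** For counting loops: the invariant is indexed by the number of iterations left, which the
    register holds. *)
Lemma ok_while (I : nat -> state -> Prop) x c T :
  (forall k s, I k s -> regs s x = Posz k) ->
  (forall k s, I k.+1 s -> ok c s T (I k)) ->
  forall k s, I k s -> ok (While x c) s (k * T.+1).+1 (I 0%N).
Proof.
move=> Ix step; elim=> [|k IH] s Is.
  by exists [:: Tick], s; split=> //; apply: ExecWhileNpos; rewrite (Ix _ _ Is).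
have [tr1 [s1 [e1 q1 sz1 /IH [tr2 [s2 [e2 q2 sz2 H]]]]]] := step _ _ Is.
exists (Tick :: tr1 ++ tr2), s2; split=> //.
- by apply: (ExecWhilePos _ e1 e2); rewrite (Ix _ _ Is).
- by rewrite /quiet /= all_cat; apply/andP.
- by rewrite /= size_cat mulSn; move: sz1 sz2; clear; lia.
Qed.

Fixpoint written c : seq register :=
  match c with
  | Const x _ | Op _ x _ _ | Read x _ => [:: x]
  | Seq c1 c2 | If _ c1 c2 => written c1 ++ written c2
  | While _ c1 => written c1
  | _ => [::]
  end.

(** Carries the loop register [rrun] through commands whose postconditions do not mention it. *)
Lemma exec_unwritten c s tr s' : exec W c s tr s' ->
  forall x, x \notin written c -> regs s' x = regs s x.
Proof.
elim=> //=.
- by move=> s0 x v _ z; rewrite inE /update => /negPf ->.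
- by move=> s0 o x y z v t; rewrite inE /update => /negPf ->.
- by move=> s0 x y k _ t; rewrite inE /update => /negPf ->.
- move=> s1 s2 s3 c1 c2 tr1 tr2 _ IH1 _ IH2 x; rewrite mem_cat negb_or => /andP [n1 n2].
  by rewrite IH2 // IH1.
- by move=> s0 s1 x c1 c2 tr0 _ _ IH z; rewrite mem_cat negb_or => /andP [n1 _]; apply: IH.
- by move=> s0 s1 x c1 c2 tr0 _ _ IH z; rewrite mem_cat negb_or => /andP [_ n1]; apply: IH.
- by move=> s1 s2 s3 x c0 tr1 tr2 _ _ IH1 _ IH2 z n; rewrite IH2 // IH1.
Qed.

End Machine.

(* Memory: the displacements [D] are kept at N, ..., 2N - 1, in place of the
   input y; the bars that may ever be used, in increasing order over two periods,
   at 2N, ...; and the current word at 4N, ... *)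
Local Notation rn := 0%N (only parsing).
Local Notation rh := 1%N (only parsing).
Local Notation rc := 2%N (only parsing).
Local Notation rk := 3%N (only parsing).
Local Notation ru := 4%N (only parsing).
Local Notation rf := 5%N (only parsing).
Local Notation rcand := 6%N (only parsing).
Local Notation rd := 7%N (only parsing).
Local Notation rmn := 8%N (only parsing).
Local Notation rany := 9%N (only parsing).
Local Notation rcnt := 10%N (only parsing).
Local Notation rp := 11%N (only parsing).
Local Notation rl := 12%N (only parsing).
Local Notation rm := 13%N (only parsing).
Local Notation rv := 14%N (only parsing).
Local Notation rw := 15%N (only parsing).
Local Notation rt := 16%N (only parsing).
Local Notation rz := 17%N (only parsing).
Local Notation r1 := 18%N (only parsing).
Local Notation r2 := 19%N (only parsing).
Local Notation rnn := 20%N (only parsing).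
Local Notation r4n := 21%N (only parsing).
Local Notation r0 := 22%N (only parsing).
Local Notation rrun := 23%N (only parsing).
Local Notation rq := 24%N (only parsing).
Local Notation rb := 25%N (only parsing).

Definition line_of dst src := seqs
  [:: Op Div rt src rn; Op Mul rt rt rn; Op Defs.Sub dst src rt].

Definition target_of dst src := seqs
  [:: line_of rl src; Op Add rl rl rn; Read dst rl; Op Add dst dst src].

(** Only positivity can be tested, so [h <= p] becomes [0 < p - h + 1]. The factor [rany] is 0 until
    a descent has been seen, so the first one is always recorded. *)
Definition scan_body := seqs
  [:: Op Defs.Sub rcnt rcnt r1; Op Add rt rnn rcnt; Read rp rt;
      Op Defs.Sub rz rp rh; Op Add rz rz r1;
      If rz (seqs
        [:: Op Add rz rh rn; Op Defs.Sub rz rz r1; Op Defs.Sub rz rz rp;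
            If rz (seqs
              [:: target_of rv rp; Op Add rq rp r1; target_of rw rq;
                  Op Defs.Sub rz rv rw;
                  If rz (seqs
                    [:: Op Defs.Sub rz rp rc;
                        If rz (seqs [:: Op Add rcand rp r0; Const rf 1]) Skip;
                        Op Defs.Sub rz rw rmn; Op Mul rz rz rany;
                        If rz Skip (seqs [:: Op Add rd rp r0; Op Add rmn rw r0;
                                             Const rany 1])]) Skip]) Skip]) Skip].

Definition scan_cmd := seqs
  [:: Const rf 0; Const rcand 0; Const rd 0; Const rmn 0; Const rany 0;
      Op Add rcnt ru r0; While rcnt scan_body].

Definition swap_cmd x := seqs
  [:: line_of rl x; Op Add rl rl rn; Op Add rq x r1; line_of rm rq;
      Op Add rm rm rn; Read rv rl; Read rw rm; Op Add rw rw r1; Write rl rw;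
      Op Defs.Sub rv rv r1; Write rm rv].

Definition push_cmd := seqs
  [:: Op Add rt r4n rk; Write rt rcand; Op Add rk rk r1; swap_cmd rcand;
      Op Defs.Sub rz rh rcand; Op Add rz rz r1;
      If rz (seqs [:: Op Add rh rh r1]) Skip; Op Defs.Sub rc rcand r2; Const rf 1].

(** [rd - rcand + 2] is positive iff the candidate is at most one place to the right of [rd]; the
    factor [rf] rejects the case without candidate. *)
Definition try_cmd := seqs
  [:: scan_cmd; Op Defs.Sub rz rd rcand; Op Add rz rz r2; Op Mul rz rz rf;
      If rz push_cmd (seqs [:: Const rf 0])].

(** After a push, [rh] exceeds the bar just crossed only if this bar moved the cut, which tells
    whether to move it back. *)
Definition pop_cmd := seqs
  [:: Op Defs.Sub rk rk r1; Op Add rt r4n rk; Read rc rt; Op Defs.Sub rz rh rc;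
      If rz (seqs [:: Op Defs.Sub rh rh r1]) Skip; swap_cmd rc].

Definition descend_cmd := seqs [:: Const rf 1; While rf try_cmd].

Definition backtrack_cmd := seqs
  [:: Const rf 0; Op Add rb rk r0;
      While rb (seqs [:: pop_cmd; try_cmd;
        If rf (seqs [:: Const rb 0]) (seqs [:: Op Add rb rk r0])])].

Definition output_cmd := seqs
  [:: seqs [:: Op Add rb rk r0; Op Add rq r4n r0];
      While rb (seqs [:: seqs [:: Read rp rq; line_of rl rp]; Emit rl;
                         seqs [:: Op Add rq rq r1; Op Defs.Sub rb rb r1]]);
      EndRecord].

(** In the second loop [rmn] is the running maximum of the targets from the cut on; a bar is in use
    iff this maximum lies beyond it. *)
Definition init_cmd := seqs
  [:: Const r1 1; Const r2 2; Op Add rnn rn rn; Op Add r4n rnn rnn;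
      Read rmn rn; Op Add rcnt rn r0;
      While rcnt (seqs
        [:: Op Defs.Sub rcnt rcnt r1; Op Add rt rn rcnt; Read rv rt;
            Op Defs.Sub rz rv rmn;
            If rz (seqs [:: Op Add rmn rv r0; Op Add rh rcnt r0]) Skip]);
      Op Add rp rh r0; Op Add rmn rh r0; Op Add rcnt rnn r0;
      While rcnt (seqs
        [:: target_of rv rp; Op Defs.Sub rz rv rmn;
            If rz (seqs [:: Op Add rmn rv r0]) Skip;
            Op Defs.Sub rz rmn rp;
            If rz (seqs [:: Op Add rt rnn ru; Write rt rp; Op Add ru ru r1]) Skip;
            Op Add rp rp r1; Op Defs.Sub rcnt rcnt r1]);
      Op Defs.Sub rc rh r2].

Definition root_cmd := seqs [:: init_cmd; descend_cmd; output_cmd].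

Definition enumerate_cmd := Seq (Const rrun 1)
  (While rrun (seqs [:: output_cmd; backtrack_cmd;
    If rf descend_cmd (seqs [:: Const rrun 0])])).

(** * Correctness and cost of the single search steps *)

Section Correct.
Variable m : nat.
Local Notation N := (m.+1).
Local Notation lin := (@lin m).
Implicit Types (p q h : int) (b i j : 'I_N) (D : {ffun 'I_N -> int})
  (ps us w : seq int) (s : state).
Variables (W : nat) (I : nat).
(** Addresses are at most [4 N + I] and values are small multiples of [N + I + 2]; the factor 20
    covers them all. *)
Hypothesis W_ge : (20 * (N + I + 2) <= W)%N.

Lemma ok_line_of dst src p cs s T Q : src != rt -> regs s rn = N%:Z ->
  regs s src = p -> 0 <= p -> p <= 10 * (N%:Z + I%:Z + 2) ->
  (forall t u, ok W (seqs cs) (set_reg (set_reg (set_reg s rt t) rt u) dst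
      (Posz (lin p))) T Q) ->
  ok W (seqs (line_of dst src :: cs)) s (4 + T) Q.
Proof.
move=> ns en ep p0 pW H; have := divz_eq p N; have lv := lin_val m p.
have q0 : 0 <= (p %/ N)%Z by rewrite divz_ge0.
have m0 : 0 <= (p %% N)%Z by apply: modz_ge0.
have mN : (p %% N)%Z < N by apply: ltz_pmod.
have qN : (p %/ N)%Z <= (p %/ N)%Z * N by nia.
move=> dE; apply: ok_cons.
apply: (ok_op (v := (p %/ N)%Z)); first by rewrite /= en ep.
  by move: dE q0 m0 mN qN p0 pW W_ge; clear; lia.
apply: (ok_op (v := (p %/ N)%Z * N)); first by rewrite /= /update /= en.
  by move: dE q0 m0 mN qN p0 pW W_ge; clear; lia.
apply: (ok_op (v := Posz (lin p))); last by apply: ok_nil; apply: H.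
  by rewrite /= /update eqxx (negPf ns) ep lv; move: dE; clear; lia.
by rewrite lv; move: m0 mN W_ge; clear; lia.
Qed.

Record loaded s D h us ps : Prop := Loaded {
  ld_n : regs s rn = N%:Z;
  ld_h : regs s rh = h;
  ld_k : regs s rk = size ps;
  ld_u : regs s ru = size us;
  ld_1 : regs s r1 = 1;
  ld_2 : regs s r2 = 2;
  ld_nn : regs s rnn = (2 * N)%N;
  ld_4n : regs s r4n = (4 * N)%N;
  ld_0 : regs s r0 = 0;
  ld_D : forall l : 'I_N, memory s (N + l)%N = D l;
  ld_us : forall t, (t < size us)%N -> memory s (2 * N + t)%N = nth 0 us t;
  ld_ps : forall t, (t < size ps)%N -> memory s (4 * N + t)%N = nth 0 ps t
}.

Lemma loaded_set s D h us ps x v :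
  x \notin [:: rn; rh; rk; ru; r1; r2; rnn; r4n; r0] ->
  loaded s D h us ps -> loaded (set_reg s x v) D h us ps.
Proof.
rewrite !inE !negb_or => /and5P [n1 n2 n3 n4 /and5P [n5 n6 n7 n8 n9]] [*].
by split=> //=; rewrite /update eq_sym ifN.
Qed.

Record bounded D h us ps : Prop := Bounded {
  bd_D : forall l, (`|D l| <= I)%N;
  bd_h : 0 <= h <= 2 * N%:Z;
  bd_us : forall p, p \in us -> 0 <= p < 3 * N%:Z;
  bd_usz : (size us <= 2 * N)%N;
  bd_psz : (size ps <= I)%N
}.

Lemma ok_target_of dst src p D cs s T Q :
  src != rt -> src != rl -> src != dst ->
  regs s rn = N%:Z -> regs s src = p -> 0 <= p -> p <= 4 * N%:Z ->
  (forall l : 'I_N, memory s (N + l)%N = D l) -> (forall l, (`|D l| <= I)%N) ->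
  (forall t u v z x, ok W (seqs cs) (set_reg (set_reg (set_reg (set_reg
     (set_reg (set_reg s rt t) rt u) rl v) rl z) dst x) dst (gp D p)) T Q) ->
  ok W (seqs (target_of dst src :: cs)) s (8 + T) Q.
Proof.
move=> n1 n2 n3 en ep p0 pW eD bD H; apply: ok_cons.
apply: (ok_line_of (p := p)) => // [|t u]; first by move: p0 pW; clear; lia.
have lN := ltn_ord (lin p).
apply: (ok_op (v := Posz (N + lin p))); first by rewrite /= /update /= en; clear; lia.
  by move: lN W_ge; clear; lia.
apply: (ok_read (k := N + lin p) (v := D (lin p))) => //; first exact: eD.
apply: (ok_op (v := gp D p)).
- by rewrite /= /update eqxx (negPf n1) (negPf n2) (negPf n3) ep addrC.
- by have := bD (lin p); move: p0 pW W_ge; rewrite /gp; clear; lia.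
by apply: ok_nil; apply: H.
Qed.

Definition scanned s (r : option int * option (int * int)) : Prop :=
  (if r.1 is Some p then regs s rf = 1 /\ regs s rcand = p
   else regs s rf = 0 /\ regs s rcand = 0) /\
  (if r.2 is Some (d, g) then [/\ regs s rany = 1, regs s rd = d & regs s rmn = g]
   else [/\ regs s rany = 0, regs s rd = 0 & regs s rmn = 0]).

Definition scan_inv D h us ps (c : int) (k : nat) s :=
  [/\ loaded s D h us ps, regs s rc = c, regs s rcnt = k, (k <= size us)%N &
      scanned s (scan D h c (drop k us))].

Lemma scan_bounds D h c us : (forall l, (`|D l| <= I)%N) ->
  (forall p, p \in us -> 0 <= p < 3 * N%:Z) ->
  (if (scan D h c us).1 is Some p then 0 <= p < 3 * N%:Z else true) /\
  (if (scan D h c us).2 is Some (d, g) then 0 <= d < 3 * N%:Z /\ (`|g| <= 4 * N + I)%N else True).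
Proof.
move=> bD; elim: us => //= p us IH bus.
have [|IH1 IH2] := IH _; first by move=> q qus; apply: bus; rewrite inE qus orbT.
have bp : 0 <= p < 3 * N%:Z by apply: bus; rewrite mem_head.
have bg : (`|gp D (p + 1)| <= 4 * N + I)%N.
  by have := bD (lin (p + 1)); rewrite /gp; move: bp; clear; lia.
rewrite /scan_step -/(scan D h c us); case: ifP => // _; split=> /=; first by case: ifP.
by case: (scan D h c us).2 IH2 => [[d g] //|//]; case: ifP.
Qed.

Lemma ok_scan_body D h us ps (c : int) k s : bounded D h us ps ->
  -2 <= c <= 3 * N%:Z -> scan_inv D h us ps c k.+1 s ->
  ok W scan_body s 60 (scan_inv D h us ps c k).
Proof.
move=> [bD bh bus busz bpsz] bc [ld ec ek kle sc].
have [en eh ekk eu e1 e2 enn e4 e0 eD eus eps] := ld.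
have [p [pin dr eus_k]] : exists p : int,
    [/\ p \in us, drop k us = p :: drop k.+1 us & memory s (2 * N + k)%N = p].
  by exists (nth 0 us k); rewrite mem_nth // eus // (drop_nth 0).
have bp := bus _ pin; have HW := W_ge.
have [sb1 sb2] := @scan_bounds D h c (drop k.+1 us) bD (fun q qd => bus q (mem_drop qd)).
have scE : scan D h c (drop k us) = scan_step D h c p (scan D h c (drop k.+1 us)).
  by rewrite dr.
have same t : ~~ wdesc D h p -> loaded t D h us ps -> regs t rc = c ->
    regs t rcnt = k -> scanned t (scan D h c (drop k.+1 us)) -> scan_inv D h us ps c k t.
  by move=> nw ldt ct kt st; split; rewrite ?scE /scan_step ?(negPf nw) // ltnW.
apply: (ok_op (v := Posz k)); first by rewrite /= ek e1; clear; lia.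
  by move: kle busz HW; clear; lia.
apply: (ok_op (v := Posz (2 * N + k))); first by rewrite /= /update /= enn; clear; lia.
  by move: kle busz HW; clear; lia.
apply: (ok_read (k := 2 * N + k) (v := p)) => //.
apply: (ok_op (v := p - h)); first by rewrite /= /update /= eh.
  by move: bp bh HW; clear; lia.
apply: (ok_op (v := p - h + 1)); first by rewrite /= /update /= e1.
  by move: bp bh HW; clear; lia.
apply: ok_if_last; last first; move=> w1; rewrite /= /update /= in w1.
  apply: ok_nil; apply: same => //.
  by apply/negP => /and3P [? _ _]; lia.
apply: (ok_op (v := h + N)); first by rewrite /= /update /= eh en.
  by move: bp bh HW; clear; lia.
apply: (ok_op (v := h + N - 1)); first by rewrite /= /update /= e1.
  by move: bp bh HW; clear; lia.
apply: (ok_op (v := h + N - 1 - p)); first by rewrite /= /update /=.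
  by move: bp bh HW; clear; lia.
apply: ok_if_last; last first; move=> w2; rewrite /= /update /= in w2.
  apply: ok_nil; apply: same => //.
  by apply/negP => /and3P [_ ? _]; lia.
apply: (ok_target_of (p := p) (D := D)) => // [||t1 u1 v1 z1 x1]; try by move: bp; clear; lia.
apply: (ok_op (v := p + 1)); first by rewrite /= /update /= e1.
  by move: bp HW; clear; lia.
apply: (ok_target_of (p := p + 1) (D := D)) => // [||t2 u2 v2 z2 x2]; try by move: bp; clear; lia.
have bg : (`|gp D (p + 1)| <= 4 * N + I)%N.
  by have := bD (lin (p + 1)); rewrite /gp; move: bp; clear; lia.
have bg' : (`|gp D p| <= 4 * N + I)%N.
  by have := bD (lin p); rewrite /gp; move: bp; clear; lia.
apply: (ok_op (v := gp D p - gp D (p + 1))); first by rewrite /= /update /=.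
  by move: bg bg' HW; clear; lia.
apply: ok_if_last; last first; move=> w3; rewrite /= /update /= in w3.
  apply: ok_nil; apply: same => //.
  by apply/negP => /and3P [_ _]; rewrite /desc; move: w3; clear; lia.
have wd : wdesc D h p by apply/and3P; rewrite /desc; split; move: w1 w2 w3; clear; lia.
move: (scan D h c (drop k.+1 us)) sc sb1 sb2 scE => [cd dg] [sc1 sc2] sb1 sb2 scE.
rewrite /= in sc1 sc2 sb1 sb2.
rewrite /scan_step wd /= in scE.
apply: (ok_op (v := p - c)); first by rewrite /= /update /= ec.
  by move: bp bc HW; clear; lia.
(* The instructions after the update of [rcand] are common to both branches of the conditional. *)
have finish r t : loaded t D h us ps -> regs t rc = c -> regs t rcnt = k ->
    scanned t (r, dg) -> regs t rw = gp D (p + 1) -> regs t rp = p ->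
    r = (if c < p then Some p else cd) ->
    ok W (seqs [:: Op Defs.Sub rz rw rmn; Op Mul rz rz rany;
        If rz Skip (seqs [:: Op Add rd rp r0; Op Add rmn rw r0; Const rany 1])])
      t 10 (scan_inv D h us ps c k).
  move=> ldt ect ekt [st1 st2] ewt ept er; have et0 := ld_0 ldt.
  rewrite /= in st1 st2; rewrite -er in scE.
  have kle' : (k <= size us)%N by apply: ltnW.
  clear sc2; case: dg st2 sb2 scE => [[d g]|] [ean ed em] sb2 scE.
    have [_ bgg] := sb2.
    apply: (ok_op (v := gp D (p + 1) - g)); first by rewrite /= /update /= ewt em.
      by move: bg bgg HW; clear; lia.
    apply: (ok_op (v := gp D (p + 1) - g)); first by rewrite /= /update /= ean mulr1.
      by move: bg bgg HW; clear; lia.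
    apply: ok_if_last => w4; rewrite /= /update /= in w4.
      apply: ok_nil; rewrite ifT in scE; last by move: w4; clear; lia.
      by split=> //; [do !apply: loaded_set|rewrite scE].
    rewrite ifF in scE; last by move: w4; clear; lia.
    apply: (ok_op (v := p)); first by rewrite /= /update /= ept et0 addr0.
      by move: bp HW; clear; lia.
    apply: (ok_op (v := gp D (p + 1))); first by rewrite /= /update /= ewt et0 addr0.
      by move: bg HW; clear; lia.
    apply: ok_const; first by move: HW; clear; lia.
    apply: ok_nil; split=> //; first by do !apply: loaded_set.
    by rewrite scE.
  apply: (ok_op (v := gp D (p + 1))); first by rewrite /= /update /= ewt em subr0.
    by move: bg HW; clear; lia.
  apply: (ok_op (v := 0)) => //; first by rewrite /= /update /= ean mulr0.
  apply: ok_if_last => w4; rewrite /= /update /= in w4 => //.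
  apply: (ok_op (v := p)); first by rewrite /= /update /= ept et0 addr0.
    by move: bp HW; clear; lia.
  apply: (ok_op (v := gp D (p + 1))); first by rewrite /= /update /= ewt et0 addr0.
    by move: bg HW; clear; lia.
  apply: ok_const; first by move: HW; clear; lia.
  apply: ok_nil; split=> //; first by do !apply: loaded_set.
  by rewrite scE.
apply: (ok_if_cons (T1 := 4)) => w5; rewrite /= /update /= in w5.
  apply: (ok_op (v := p)); first by rewrite /= /update /= e0 addr0.
    by move: bp HW; clear; lia.
  apply: ok_const; first by move: HW; clear; lia.
  apply: ok_nil; apply: ok_mono (finish (Some p) _ _ _ _ _ _ _ _) _ _ => //.
  by rewrite ifT //; move: w5; clear; lia.
apply: ok_nil; apply: ok_mono (finish cd _ _ _ _ _ _ _ _) _ _ => //.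
by rewrite ifF //; move: w5; clear; lia.
Qed.

Lemma ok_scan D h us ps (c : int) s : bounded D h us ps ->
  -2 <= c <= 3 * N%:Z -> loaded s D h us ps -> regs s rc = c ->
  ok W scan_cmd s (61 * size us + 10) (fun s' =>
    [/\ loaded s' D h us ps, regs s' rc = c & scanned s' (scan D h c us)]).
Proof.
move=> bd bc ld ec; have [en eh ekk eu e1 e2 enn e4 e0 eD eus eps] := ld.
have HW := W_ge; have busz := bd_usz bd.
rewrite addnC -[10%N]/(6 + 4)%N -addnA.
do 5!(apply: ok_const => //).
apply: (ok_op (v := Posz (size us))); first by rewrite /= /update /= eu e0 addr0.
  by move: busz HW; clear; lia.
rewrite (_ : (4 + 61 * size us = (61 * size us).+1 + 3)%N); last by clear; lia.
apply: ok_cons.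
have : scan_inv D h us ps c (size us) (set_reg (set_reg (set_reg (set_reg (set_reg
    (set_reg s rf 0) rcand 0) rd 0) rmn 0) rany 0) rcnt (size us)).
  by split=> //; rewrite drop_size.
rewrite mulnC; move/(ok_while (I := scan_inv D h us ps c) (c := scan_body) (W := W) (x := rcnt) (T := 60)) => H.
apply: ok_mono (H _ _) _ _ => //.
- by move=> k t [].
- by move=> k t; apply: ok_scan_body.
by move=> t [ldt ect _ _ st]; apply: ok_nil; rewrite drop0 in st.
Qed.

(** Crossing back is the same exchange in memory, so [pop_cmd] reuses [swap_cmd]. *)
Lemma advance_involutive D b : b != ordS b -> advance (advance D b) b = D.
Proof.
move=> nb; have nb' : ordS b != b by rewrite eq_sym.
apply/ffunP => l; rewrite !ffunE !eqxx (negPf nb').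
case: eqP => [->|_]; first by rewrite subrK.
by case: eqP => [->|_] //; rewrite addrK.
Qed.

Lemma ok_swap x p cs D h us ps s T Q : x \in [:: rcand; rc] ->
  (forall l, (`|D l| <= I)%N) -> loaded s D h us ps -> regs s x = p -> 0 <= p < 3 * N%:Z ->
  lin p != lin (p + 1) ->
  (forall s', loaded s' (advance D (lin p)) h us ps -> regs s' x = p ->
     ok W (seqs cs) s' T Q) ->
  ok W (seqs (swap_cmd x :: cs)) s (18 + T) Q.
Proof.
move=> xin bD ld ex bp np H; have [en eh ekk eu e1 e2 enn e4 e0 eD eus eps] := ld.
have HW := W_ge; apply: ok_cons.
have [nx1 nx2] : x != rt /\ x \notin [:: rt; rl; rm; rq; rv; rw].
  by move: xin; rewrite !inE => /orP [] /eqP ->.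
move: nx2; rewrite !inE !negb_or => /and5P [_ n2 n3 n4 /andP [n5 n6]].
have lN := ltn_ord (lin p); have lN' := ltn_ord (lin (p + 1)).
apply: (ok_line_of (p := p)) => // [||t u]; try by move: bp; clear; lia.
apply: (ok_op (v := Posz (N + lin p))); first by rewrite /= /update /= en; clear; lia.
  by move: lN HW; clear; lia.
apply: (ok_op (v := p + 1)).
- by rewrite /= /update /= (negPf nx1) (negPf n2) ex e1.
- by move: bp HW; clear; lia.
apply: (ok_line_of (p := p + 1)) => // [||t' u']; try by move: bp; clear; lia.
apply: (ok_op (v := Posz (N + lin (p + 1)))); first by rewrite /= /update /= en; clear; lia.
  by move: lN' HW; clear; lia.
apply: (ok_read (k := N + lin p) (v := D (lin p))) => //; first exact: eD.
apply: (ok_read (k := N + lin (p + 1)) (v := D (lin (p + 1)))) => //; first exact: eD.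
apply: (ok_op (v := D (lin (p + 1)) + 1)); first by rewrite /= /update /= e1.
  by have := bD (lin (p + 1)); move: HW; clear; lia.
apply: (ok_write (k := N + lin p) (v := D (lin (p + 1)) + 1)) => //.
apply: (ok_op (v := D (lin p) - 1)); first by rewrite /= /update /= e1.
  by have := bD (lin p); move: HW; clear; lia.
apply: (ok_write (k := N + lin (p + 1)) (v := D (lin p) - 1)) => //.
apply: ok_nil; apply: H; last first.
  by rewrite /= /update /= (negPf nx1) (negPf n2) (negPf n3) (negPf n4) (negPf n5) (negPf n6).
split; rewrite /= /update //=.
- move=> l; rewrite !eqn_add2l !(inj_eq (@ord_inj _)) ffunE -lin_ordS eD.
  by have [->|nl] := eqVneq l (lin p); rewrite ?(negPf np).
- move=> k ku; rewrite !ifN ?eus //; move: lN lN'; clear; lia.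
- move=> k ku; rewrite !ifN ?eps //; move: lN lN'; clear; lia.
Qed.

Lemma loaded_h s D h h' us ps :
  loaded s D h us ps -> loaded (set_reg s rh h') D h' us ps.
Proof. by case. Qed.

Lemma ok_push D h us ps p s : bounded D h us ps -> loaded s D h us ps ->
  wdesc D h p -> 0 <= p < 3 * N%:Z -> regs s rcand = p ->
  ok W push_cmd s 36 (fun s' => [/\ loaded s' (advance D (lin p)) (nxt h p) us (rcons ps p),
    regs s' rc = p - 2 & regs s' rf = 1]).
Proof.
move=> bd ld /and3P [w1 w2 dp] bp ec.
have [en eh ekk eu e1 e2 enn e4 e0 eD eus eps] := ld.
have HW := W_ge; have bps := bd_psz bd; have bu := bd_usz bd; have bh := bd_h bd.
apply: (ok_op (v := Posz (4 * N + size ps))); first by rewrite /= e4 ekk; clear; lia.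
  by move: bps HW; clear; lia.
apply: (ok_write (k := 4 * N + size ps) (v := p)) => //.
apply: (ok_op (v := Posz (size ps).+1)); first by rewrite /= /update /= e1 ekk; clear; lia.
  by move: bps HW; clear; lia.
apply: (@ok_swap rcand p _ D h us (rcons ps p) _ 15) => //; first exact: bd_D bd.
- split=> //=; rewrite ?size_rcons //.
  + by move=> l; rewrite /update ifN ?eD //; have := ltn_ord l; clear; lia.
  + by move=> t tu; rewrite /update ifN ?eus //; move: bu tu; clear; lia.
  + move=> t; rewrite ltnS leq_eqVlt /update eqn_add2l nth_rcons => /orP [/eqP ->|tp].
      by rewrite eqxx ltnn.
    by rewrite tp ifN ?eps // neq_ltn tp.
- exact: desc_neql dp.
move=> s1 ld1 ec1; have [e1' e2' eh'] : [/\ regs s1 r1 = 1, regs s1 r2 = 2 & regs s1 rh = h].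
  by case: ld1.
apply: (ok_op (v := h - p)); first by rewrite /= /update /= ec1 eh'.
  by move: bp bh HW; clear; lia.
apply: (ok_op (v := h - p + 1)); first by rewrite /= /update /= e1'.
  by move: bp bh HW; clear; lia.
apply: (ok_if_cons (T1 := 3) (T2 := 9)) => w3; rewrite /= /update /= in w3.
  apply: (ok_op (v := h + 1)); first by rewrite /= /update /= eh' e1'.
    by move: bp bh HW; clear; lia.
  apply: ok_nil; apply: (ok_op (v := p - 2)); first by rewrite /= /update /= ec1 e2'.
    by move: bp bh HW; clear; lia.
  apply: ok_const; first by move: HW; clear; lia.
  have -> : nxt h p = h + 1 by rewrite /nxt ifT //; move: w1 w3; clear; lia.
  by apply: ok_nil; split=> //; case: ld1.
apply: ok_nil; apply: (ok_op (v := p - 2)); first by rewrite /= /update /= ec1 e2'.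
  by move: bp bh HW; clear; lia.
apply: ok_const; first by move: HW; clear; lia.
have -> : nxt h p = h by rewrite /nxt ifF //; move: w1 w3; clear; lia.
by apply: ok_nil; split=> //; do !apply: loaded_set => //.
Qed.

(** A candidate is itself a descent, so [rd] is meaningful whenever [rf] is set, and [try_cmd] does
    not consult [rany]. *)
Lemma scan_some D h c us p : (scan D h c us).1 = Some p ->
  wdesc D h p /\ exists dg, (scan D h c us).2 = Some dg.
Proof.
elim: us => //= u us IH; rewrite /scan_step -/(scan D h c us); case: ifP => [wu|_ /IH //] /=.
have E : exists dg, (if (scan D h c us).2 is Some (d, g) then
       if g < gp D (u + 1) then Some (d, g) else Some (u, gp D (u + 1))
     else Some (u, gp D (u + 1))) = Some dg.
  by case: (scan D h c us).2 => [[d g]|]; [case: ifP|]; eexists.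
by case: ifP => [_ [<-]|_ /IH []].
Qed.

Lemma ok_try D h us ps (c : int) s : bounded D h us ps ->
  -2 <= c <= 3 * N%:Z -> loaded s D h us ps -> regs s rc = c ->
  ok W try_cmd s (61 * size us + 60) (fun s' =>
    if try_next D h c us is Some p then
      [/\ loaded s' (advance D (lin p)) (nxt h p) us (rcons ps p),
          regs s' rc = p - 2 & regs s' rf = 1]
    else loaded s' D h us ps /\ regs s' rf = 0).
Proof.
move=> bd bc ld ec; have HW := W_ge.
rewrite -[60%N]/(10 + 50)%N addnA; apply: ok_cons.
apply: ok_mono (ok_scan bd bc ld ec) (leqnn _) _ => s1 [ld1 ec1 [sc1 sc2]].
have [en eh ekk eu e1 e2 enn e4 e0 eD eus eps] := ld1.
have [sb1 sb2] := @scan_bounds D h c us (bd_D bd) (bd_us bd).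
rewrite /try_next; have := @scan_some D h c us.
case: (scan D h c us) sc1 sc2 sb1 sb2 => [[p|] dg] sc1 sc2 sb1 sb2 ss;
  rewrite /= in sc1 sc2 sb1 sb2 ss.
  have [wp [[d g] edg]] := ss p erefl; have [ef ecand] := sc1; have bp := sb1.
  rewrite edg in sc2 sb2 *; have [ea ed em] := sc2; have [bdd bg] := sb2.
  apply: (ok_op (v := d - p)); first by rewrite /= ed ecand.
    by move: bp bdd HW; clear; lia.
  apply: (ok_op (v := d - p + 2)); first by rewrite /= /update /= e2.
    by move: bp bdd HW; clear; lia.
  apply: (ok_op (v := d - p + 2)); first by rewrite /= /update /= ef mulr1.
    by move: bp bdd HW; clear; lia.
  apply: ok_if_last => w1; rewrite /= /update /= in w1.
    rewrite ifT; last by move: w1; clear; lia.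
    by apply: ok_mono (ok_push bd _ wp bp _) _ _ => //; do !apply: loaded_set.
  rewrite ifF; last by move: w1; clear; lia.
  apply: ok_const; first by move: HW; clear; lia.
  by apply: ok_nil; split=> //; do !apply: loaded_set.
have [ef ecand] := sc1.
have bd' : (`|regs s1 rd| <= 3 * N)%N.
  by clear ss; case: dg sc2 sb2 => [[d g] [_ -> _] [bdd _]|[_ -> _] _]; [move: bdd|]; clear; lia.
apply: (ok_op (v := regs s1 rd)); first by rewrite /= ecand subr0.
  by move: bd' HW; clear; lia.
apply: (ok_op (v := regs s1 rd + 2)); first by rewrite /= /update /= e2.
  by move: bd' HW; clear; lia.
apply: (ok_op (v := 0)) => //; first by rewrite /= /update /= ef mulr0.
apply: ok_if_last => w1; rewrite /= /update /= in w1 => //.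
apply: ok_const; first by move: HW; clear; lia.
by apply: ok_nil; split=> //; do !apply: loaded_set.
Qed.

Lemma ok_pop D h us ps p s : bounded D h us ps -> wdesc D h p ->
  0 <= p < 3 * N%:Z ->
  (forall l, (`|advance D (lin p) l| <= I)%N) ->
  loaded s (advance D (lin p)) (nxt h p) us (rcons ps p) ->
  ok W pop_cmd s 40 (fun s' => loaded s' D h us ps /\ regs s' rc = p).
Proof.
move=> bd /and3P [w1 w2 dp] bp bD' ld.
have [en eh ekk eu e1 e2 enn e4 e0 eD eus eps] := ld.
have nb : lin p != ordS (lin p) by rewrite -lin_ordS (desc_neql dp).
have HW := W_ge; have bps := bd_psz bd; have bh := bd_h bd.
apply: (ok_op (v := Posz (size ps))); first by rewrite /= ekk e1 size_rcons; clear; lia.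
  by move: bps HW; clear; lia.
apply: (ok_op (v := Posz (4 * N + size ps))); first by rewrite /= /update /= e4; clear; lia.
  by move: bps HW; clear; lia.
apply: (ok_read (k := 4 * N + size ps) (v := p)) => //.
  by rewrite /= eps ?size_rcons // nth_rcons ltnn eqxx.
apply: (ok_op (v := nxt h p - p)); first by rewrite /= /update /= eh.
  by rewrite /nxt; case: ifP => _; move: bp bh HW; clear; lia.
have swap t : loaded t (advance D (lin p)) h us ps -> regs t rc = p ->
  ok W (seqs [:: swap_cmd rc]) t 19 (fun s' => loaded s' D h us ps /\ regs s' rc = p).
  move=> ldt et; apply: (@ok_swap rc p _ _ h us ps _ 1) => // [|s' ld' e'].
    exact: desc_neql dp.
  by apply: ok_nil; rewrite advance_involutive // in ld'.
have ld2 t h2 : regs t = update (update (update (update (regs s) rk (size ps)) rt (4 * N + size ps)%N) rc p) rz (nxt h p - p) ->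
    memory t = memory s -> nxt h p = h2 -> loaded t (advance D (lin p)) h2 us ps.
  move=> er em e; split; rewrite ?er ?em //= /update //= ?eh // => k kp.
  by rewrite eps ?size_rcons 1?ltnW // nth_rcons kp.
apply: (ok_if_cons (T1 := 3) (T2 := 32)) => w3; rewrite /= /update /= in w3.
  have eh2 : nxt h p = h + 1.
    by move: w3; rewrite /nxt; case: ifP => // _; move: w1; clear; lia.
  apply: (ok_op (v := h)); first by rewrite /= /update /= e1 eh eh2 addrK.
    by move: bh HW; clear; lia.
  apply: ok_nil; apply: ok_mono (swap _ _ _) _ _ => //.
  by apply: loaded_h (ld2 _ (h + 1) _ _ _).
apply: ok_nil; apply: ok_mono (swap _ _ _) _ _ => //.
apply: ld2 => //; move: w3; rewrite /nxt; case: ifP => // /eqP ->; clear; lia.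
Qed.

End Correct.

(** * Traversing the tree *)

Section Traversal.
Variable m : nat.
Local Notation N := (m.+1).
Local Notation lin := (@lin m).
Implicit Types (p q h : int) (b i j : 'I_N) (D : {ffun 'I_N -> int})
  (ps us w : seq int) (L : seq 'I_N).

Lemma red_bound D L l : red D L -> (`|D l| <= size L)%N.
Proof.
elim: L D l => [|b L IH] D l; first by move/eqP => ->; rewrite ffunE.
case/andP => db rL; have nb := desc_neq db; have nb' : ordS b != b by rewrite eq_sym.
rewrite /= -[in X in (X <= _)%N](advance_involutive D nb) ffunE.
have := IH _ (ordS b) rL; have := IH _ b rL; have := IH _ l rL.
move: (advance D b) => D'; case: eqP => [->|_]; first by clear; lia.
by case: eqP => [->|_]; clear; lia.
Qed.

Fixpoint walk D h ps : bool :=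
  if ps is p :: ps' then wdesc D h p && walk (advance D (lin p)) (nxt h p) ps'
  else true.

Lemma vld_walk D h ps : vld D h ps -> walk D h ps.
Proof.
elim: ps D h => //= p ps IH D h /and4P [h1 h2 dp /IH ->].
by rewrite /wdesc h1 h2 dp.
Qed.

Lemma walk_rcons D h ps p : walk D h (rcons ps p) =
  walk D h ps && wdesc (run D h ps).1 (run D h ps).2 p.
Proof.
by elim: ps D h => [|q ps IH] D h /=; rewrite ?andbT // IH andbA.
Qed.

Lemma walk_red D h ps L : walk D h ps -> red (run D h ps).1 L ->
  red D (map lin ps ++ L).
Proof.
elim: ps D h => //= p ps IH D h /andP [/and3P [_ _ dp] /IH H] /H ->.
by rewrite -desc_lin dp.
Qed.

Variables (y : {ffun 'I_N -> int}) (a : 'I_N) (I W : nat) (us0 : seq int).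
Hypothesis W_ge : (20 * (N + I + 2) <= W)%N.
Hypothesis us0_sorted : path.sorted <%R us0.
Hypothesis mem_us0 : forall p, Posz a <= p -> p < Posz a + 2 * N%:Z -> over y p -> p \in us0.
Hypothesis us0_bound : forall p, p \in us0 -> Posz a <= p < Posz a + 2 * N%:Z.
Hypothesis us0_size' : (size us0 <= 2 * N)%N.
Hypothesis ya_le : y (lin (Posz a)) <= N%:Z.
Hypothesis y_total : total id y = 0.
Hypothesis y_inj : injective (gp y).
Hypothesis y_noPass : noPass y (Posz a).
Hypothesis y_size : forall L, red y L -> (size L <= I)%N.

Notation curD := (curD y a).
Notation curh := (curh y a).
Notation lst := (lst a).
Notation try_at := (try_at y a us0).
Notation reached := (reached y a).
Notation walks := (walk y (Posz a)).

Lemma reached0 : reached y (Posz a).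
Proof. by split. Qed.

Lemma walk_reached ps : walks ps -> reached (curD ps) (curh ps).
Proof.
elim/last_ind: ps => [_|ps p IH]; first exact: reached0.
rewrite walk_rcons curD_rcons curh_rcons => /andP [/IH rD wp].
exact: reached_step.
Qed.

(** Every prefix extends to a reduced word of [y], of length at most [I]; this bounds the stored
    word and, one line per bar, the remaining displacements. *)
Lemma walk_bounded ps : walks ps -> bounded I (curD ps) (curh ps) us0 ps.
Proof.
move=> wk; have rD := walk_reached wk; have [L rL] := reached_red rD.
have := y_size (walk_red wk rL); rewrite size_cat size_map => sz.
have la := ltn_ord a.
split=> //; last by apply: leq_trans sz; apply: leq_addr.
- by move=> l; apply: leq_trans (red_bound l rL) _; apply: leq_trans sz; apply: leq_addl.
- have [ps' v _] := red_vld rL (reached_noPass rD).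
  have := vld_ge0 v; have := reached_top rD; have := reached_ge rD.
  by move: la ya_le; rewrite /gp; clear; lia.
- by move=> p /us0_bound; move: la; clear; lia.
Qed.

Lemma walk_mem ps p : walks ps -> wdesc (curD ps) (curh ps) p -> 0 <= p < 3 * N%:Z.
Proof.
move=> wk wp; have := walk_reached wk => /reached_mem -/(_ us0 mem_us0 ya_le p wp) /us0_bound.
by have := ltn_ord a; clear; lia.
Qed.

Lemma walk_lst ps : walks ps -> 0 <= lst ps < 3 * N%:Z.
Proof.
case/lastP: ps => [_|ps p]; first by rewrite /lst /=; have := ltn_ord a; clear; lia.
by rewrite walk_rcons lst_rcons => /andP [wk /(walk_mem wk)].
Qed.

Lemma walk_try ps c p : walks ps -> try_at ps c = Some p -> walks (rcons ps p).
Proof.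
move=> wk tp; rewrite walk_rcons wk.
by have [] := try_some us0_sorted mem_us0 ya_le (walk_reached wk) tp.
Qed.

Lemma walk_descend ps w : descend y a us0 ps w -> walks ps -> walks w.
Proof. by elim=> // {}ps p {}w tp _ IH wk; apply: IH; apply: walk_try tp. Qed.

Lemma walk_backtrack ps r : backtrack y a us0 ps r -> walks ps ->
  if r is Some ps' then walks ps' else true.
Proof.
elim=> // {}ps c.
  by move=> p tp; rewrite walk_rcons => /andP [wk _]; apply: walk_try tp.
by move=> {}r _ _ IH; rewrite walk_rcons => /andP [/IH].
Qed.

Definition at_node s ps := loaded s (curD ps) (curh ps) us0 ps.

Definition try_time := (61 * size us0 + 60)%N.

Lemma ok_try_at ps c s : walks ps -> -2 <= c <= 3 * N%:Z -> at_node s ps ->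
  regs s rc = c ->
  ok W try_cmd s try_time (fun s' =>
    if try_at ps c is Some p then
      [/\ at_node s' (rcons ps p), regs s' rc = p - 2 & regs s' rf = 1]
    else at_node s' ps /\ regs s' rf = 0).
Proof.
move=> wk bc ld ec; apply: ok_mono (ok_try W_ge (walk_bounded wk) bc ld ec) _ _ => // s'.
rewrite -/(try _ _ _ _) -/(try_at ps c).
rewrite /at_node /curD /curh.
by case: (try_at ps c) => [p|] //; rewrite run_rcons.
Qed.

(** Each successful test lengthens the word, which never exceeds [I] bars; one failing test ends the
    loop. *)
Lemma ok_descend_loop ps w s : descend y a us0 ps w -> walks ps -> at_node s ps ->
  regs s rc = lst ps - 2 -> regs s rf = 1 ->
  ok W (While rf try_cmd) s ((I - size ps).+1 * try_time.+1).+1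
    (fun s' => at_node s' w).
Proof.
move=> d; elim: d s => {ps w} [ps tp|ps p w tp _ IH] s wk ld ec ef.
  have bl := walk_lst wk.
  have : -2 <= lst ps - 2 <= 3 * N%:Z by move: bl; clear; lia.
  move/(ok_try_at wk)/(_ ld ec); rewrite tp => -[tr [s' [e q sz [ld' ef']]]].
  exists (Tick :: tr ++ [:: Tick]), s'; split=> //.
  - by apply: (ExecWhilePos _ e); [rewrite ef|apply: ExecWhileNpos; rewrite ef'].
  - by rewrite /quiet /= all_cat /= andbT.
  - rewrite /= size_cat /= mulSn; move: (_ * _)%N sz => X; clear; lia.
have bl := walk_lst wk; have wk' := walk_try wk tp.
have : -2 <= lst ps - 2 <= 3 * N%:Z by move: bl; clear; lia.
move/(ok_try_at wk)/(_ ld ec); rewrite tp => -[tr [s' [e q sz [ld' ec' ef']]]].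
have [||||tr2 [s2 [e2 q2 sz2 ld2]]] := IH s' => //; first by rewrite lst_rcons.
exists (Tick :: tr ++ tr2), s2; split=> //.
- by apply: (ExecWhilePos _ e e2); rewrite ef.
- by rewrite /quiet /= all_cat; apply/andP.
have szps := bd_psz (walk_bounded wk'); rewrite size_rcons in szps sz2.
rewrite /= size_cat; have -> : ((I - size ps) = (I - (size ps).+1).+1)%N.
  by move: szps; clear; lia.
by rewrite mulSn; move: (_ * _)%N sz sz2 => X; clear; lia.
Qed.

Lemma ok_descend ps w s : descend y a us0 ps w -> walks ps -> at_node s ps ->
  regs s rc = lst ps - 2 ->
  ok W descend_cmd s (I.+1 * try_time.+1 + 3) (fun s' => at_node s' w).
Proof.
move=> d wk ld ec; rewrite addnS; apply: ok_const; first by move: W_ge; clear; lia.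
rewrite (_ : (I.+1 * try_time.+1 + 2 = (I.+1 * try_time.+1).+1 + 1)%N); last by rewrite addn2 addn1.
apply: ok_cons.
apply: ok_mono (ok_descend_loop d wk _ _ _) _ _ => //.
- by apply: loaded_set.
- by rewrite ltnS leq_mul2r ltnS leq_subr orbT.
by move=> s' ld'; apply: ok_nil.
Qed.

Definition back_body := seqs [:: pop_cmd; try_cmd;
  If rf (seqs [:: Const rb 0]) (seqs [:: Op Add rb rk r0])].

Definition back_time := (try_time + 50)%N.

Lemma ok_back_body ps c s : walks (rcons ps c) -> at_node s (rcons ps c) ->
  ok W back_body s back_time (fun s' =>
    if try_at ps c is Some p then
      [/\ at_node s' (rcons ps p), regs s' rc = p - 2, regs s' rf = 1 & regs s' rb = 0]
    else [/\ at_node s' ps, regs s' rf = 0 & regs s' rb = size ps]).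
Proof.
move=> wk' ld; have := wk'; rewrite walk_rcons => /andP [wk wc].
have bc := walk_mem wk wc.
rewrite /back_time addnC -[50%N]/(40 + 10)%N -addnA; apply: ok_cons.
have bD' := bd_D (walk_bounded wk'); rewrite curD_rcons in bD'.
have ld0 := ld; rewrite /at_node curD_rcons curh_rcons in ld0.
apply: ok_mono (ok_pop W_ge (walk_bounded wk) wc bc bD' ld0) _ _ => // s1 [ld1 ec1].
rewrite addnC; apply: ok_cons.
have bc' : -2 <= c <= 3 * N%:Z by move: bc; clear; lia.
apply: ok_mono (ok_try_at wk bc' ld1 ec1) _ _ => // s2.
case tp : (try_at ps c) => [p|].
  case=> ld2 ec2 ef2; apply: ok_if_last; rewrite ef2 // => _.
  by apply: ok_const => //; apply: ok_nil; split=> //; apply: loaded_set.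
case=> ld2 ef2; apply: ok_if_last; rewrite ef2 // => _.
have := bd_psz (walk_bounded wk) => sz.
apply: (ok_op (v := Posz (size ps))); first by rewrite /= (ld_k ld2) (ld_0 ld2) addr0.
  by move: sz W_ge; clear; lia.
by apply: ok_nil; split=> //; apply: loaded_set.
Qed.

Lemma ok_back_loop ps r s : backtrack y a us0 ps r -> walks ps -> at_node s ps ->
  regs s rb = size ps -> regs s rf = 0 ->
  ok W (While rb back_body) s ((size ps).+1 * back_time.+1).+1 (fun s' =>
    if r is Some ps' then [/\ at_node s' ps', regs s' rc = lst ps' - 2 & regs s' rf = 1]
    else regs s' rf = 0).
Proof.
move=> bt; elim: bt s => {ps r} [|ps c p tp|ps c r tp _ IH] s wk ld eb ef.
- by exists [:: Tick], s; split=> //; apply: ExecWhileNpos; rewrite eb.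
- have := ok_back_body wk ld; rewrite tp => -[tr [s' [e q sz [ld' ec' ef' eb']]]].
  exists (Tick :: tr ++ [:: Tick]), s'; split; rewrite ?lst_rcons //.
  - apply: (ExecWhilePos _ e); first by rewrite eb size_rcons.
    by apply: ExecWhileNpos; rewrite eb'.
  - by rewrite /quiet /= all_cat /= andbT.
  - by rewrite /= size_cat /= mulSn; move: (_ * _)%N sz => X; clear; lia.
have := ok_back_body wk ld; rewrite tp => -[tr [s' [e q sz [ld' ef' eb']]]].
have wk' : walks ps by move: wk; rewrite walk_rcons => /andP [].
have [||||tr2 [s2 [e2 q2 sz2 H2]]] := IH s' => //.
exists (Tick :: tr ++ tr2), s2; split=> //.
- by apply: (ExecWhilePos _ e e2); rewrite eb size_rcons.
- by rewrite /quiet /= all_cat; apply/andP.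
by rewrite /= size_cat size_rcons mulSn; move: (_ * _)%N sz sz2 => X; clear; lia.
Qed.

Lemma ok_backtrack ps r s : backtrack y a us0 ps r -> walks ps -> at_node s ps ->
  ok W backtrack_cmd s (I.+1 * back_time.+1 + 5) (fun s' =>
    if r is Some ps' then [/\ at_node s' ps', regs s' rc = lst ps' - 2 & regs s' rf = 1]
    else regs s' rf = 0).
Proof.
move=> bt wk ld; have sz := bd_psz (walk_bounded wk).
rewrite addnC -[5%N]/(2 + 3)%N -addnA.
apply: ok_const => //.
apply: (ok_op (v := Posz (size ps))).
- by rewrite /= /update /= (ld_k ld) (ld_0 ld) addr0.
- by move: sz W_ge; clear; lia.
rewrite (_ : (3 + _ = (I.+1 * back_time.+1).+1 + 2)%N); last by rewrite addnC !addnS.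
apply: ok_cons; apply: ok_mono (ok_back_loop bt wk _ _ _) _ _ => //.
- by do !apply: loaded_set.
- by rewrite ltnS leq_mul2r ltnS sz orbT.
by move=> s' H; apply: ok_nil.
Qed.

Definition noEor (tr : seq step) := all (fun e => if e is Eor then false else true) tr.

Definition prints c s (T : nat) out (Q : state -> Prop) := exists tr s',
  [/\ exec W c s tr s', noEor tr, emitted tr = out, (size tr <= T)%N & Q s'].

Lemma quiet_noEor tr : quiet tr -> noEor tr.
Proof. by apply: sub_all => -[]. Qed.

Lemma quiet_emitted tr : quiet tr -> emitted tr = [::].
Proof. by elim: tr => //= -[] //= tr IH /IH. Qed.

Lemma emitted_cat tr1 tr2 : emitted (tr1 ++ tr2) = emitted tr1 ++ emitted tr2.
Proof. by rewrite /emitted pmap_cat. Qed.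

Lemma prints_seq c1 c2 s T1 T2 out1 out2 Q :
  prints c1 s T1 out1 (fun s' => prints c2 s' T2 out2 Q) ->
  prints (Seq c1 c2) s (T1 + T2) (out1 ++ out2) Q.
Proof.
move=> [tr1 [s1 [e1 q1 <- sz1 [tr2 [s2 [e2 q2 <- sz2 H]]]]]]; exists (tr1 ++ tr2), s2.
split=> //; [exact: ExecSeq e1 e2|by rewrite /noEor all_cat; apply/andP| |].
  by rewrite emitted_cat.
by rewrite size_cat leq_add.
Qed.

Lemma ok_prints c s T Q : ok W c s T Q -> prints c s T [::] Q.
Proof.
move=> [tr [s' [e q sz H]]]; exists tr, s'; split=> //; first exact: quiet_noEor.
exact: quiet_emitted.
Qed.

Definition output_body := seqs [:: seqs [:: Read rp rq; line_of rl rp]; Emit rl;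
   seqs [:: Op Add rq rq r1; Op Defs.Sub rb rb r1]].

Lemma prints_output_body ps k s : walks ps -> at_node s ps -> (k < size ps)%N ->
  regs s rq = (4 * N + k)%N -> regs s rb = (size ps - k)%N ->
  prints output_body s 12 [:: Posz (lin (nth 0 ps k))] (fun s' =>
    [/\ at_node s' ps, regs s' rq = (4 * N + k.+1)%N & regs s' rb = (size ps - k.+1)%N]).
Proof.
move=> wk ld kp eq eb; have sz := bd_psz (walk_bounded wk).
have bp : 0 <= nth 0 ps k < 3 * N%:Z.
  have wkt : walks (take k.+1 ps).
    move: wk; rewrite -{1}(cat_take_drop k.+1 ps).
    elim: (take _ _) (Posz a) y => //= p l IH h D /andP [-> /IH].
    by [].
  by move: wkt; rewrite (take_nth 0) // walk_rcons => /andP [wk1 /(walk_mem wk1)].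
apply: (@prints_seq (seqs [:: Read rp rq; line_of rl rp]) (seqs [:: Emit rl;
   seqs [:: Op Add rq rq r1; Op Defs.Sub rb rb r1]]) s 7 5 [::]); apply: ok_prints.
apply: (ok_read (k := 4 * N + k) (v := nth 0 ps k)) => //.
  by rewrite (ld_ps ld).
apply: (ok_line_of W_ge (p := nth 0 ps k)) => // [|||t u]; try by move: bp; clear; lia.
  exact: (ld_n ld).
apply: ok_nil.
apply: (@prints_seq (Emit rl) (seqs [:: seqs [:: Op Add rq rq r1; Op Defs.Sub rb rb r1]])
  _ 1 4 [:: _] [::]).
set s1 := set_reg _ _ _; have ld1 : at_node s1 ps by do !apply: loaded_set => //.
exists [:: Out (Posz (lin (nth 0 ps k)))], s1; split=> //; first exact: ExecEmit.
apply: (@prints_seq (seqs [:: Op Add rq rq r1; Op Defs.Sub rb rb r1]) (seqs [::])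
  _ 3 1 [::] [::]); apply: ok_prints.
apply: (ok_op (v := Posz (4 * N + k.+1))).
- by rewrite /= /update /= eq (ld_1 ld); clear; lia.
- by move: kp sz W_ge; clear; lia.
apply: (ok_op (v := Posz (size ps - k.+1))).
- by rewrite /= /update /= eb (ld_1 ld); move: kp; clear; lia.
- by move: kp sz W_ge; clear; lia.
apply: ok_nil; apply: ok_prints; apply: ok_nil; split=> //.
by do !apply: loaded_set.
Qed.

Lemma prints_output_loop ps k s : walks ps -> at_node s ps -> (k <= size ps)%N ->
  regs s rq = (4 * N + k)%N -> regs s rb = (size ps - k)%N ->
  prints (While rb output_body) s ((size ps - k) * 13).+1
    [seq Posz (lin p) | p <- drop k ps] (fun s' => at_node s' ps).
Proof.
move=> wk; have [j] := ubnP (size ps - k)%N; elim: j k s => // j IH k s lej ld kp eq eb.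
have [ek|nk] := eqVneq k (size ps).
  exists [:: Tick], s; rewrite ek drop_size; split=> //.
  by apply: ExecWhileNpos; rewrite eb ek subnn.
have kp' : (k < size ps)%N by rewrite ltn_neqAle nk.
have [tr [s' [e q em sz [ld' eq' eb']]]] := prints_output_body wk ld kp' eq eb.
have [|||||tr2 [s2 [e2 q2 em2 sz2 ld2]]] := IH k.+1 s' => //.
  by move: lej kp'; clear; lia.
exists (Tick :: tr ++ tr2), s2; split=> //.
- by apply: (ExecWhilePos _ e e2); rewrite eb; move: kp'; clear; lia.
- by rewrite /noEor /= all_cat; apply/andP.
- by rewrite -[LHS]/(emitted (tr ++ tr2)) emitted_cat em em2 (drop_nth 0 kp').
have -> : (size ps - k = (size ps - k.+1).+1)%N by move: kp'; clear; lia.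
by rewrite /= size_cat mulSn; move: sz sz2; clear; lia.
Qed.

Lemma exec_output ps s : walks ps -> at_node s ps -> exists t s',
  [/\ exec W output_cmd s (t ++ [:: Eor; Tick]) s', noEor t,
      emitted t = encode (map lin ps), (size t <= 13 * I + 5)%N & at_node s' ps].
Proof.
move=> wk ld; have sz := bd_psz (walk_bounded wk).
have : ok W (seqs [:: Op Add rb rk r0; Op Add rq r4n r0]) s 3 (fun s' =>
   [/\ at_node s' ps, regs s' rq = (4 * N + 0)%N & regs s' rb = (size ps - 0)%N]).
  apply: (ok_op (v := Posz (size ps - 0))).
  - by rewrite /= (ld_k ld) (ld_0 ld) subn0 addr0.
  - by move: sz W_ge; clear; lia.
  apply: (ok_op (v := Posz (4 * N + 0))).
  - by rewrite /= /update /= (ld_4n ld) (ld_0 ld) addn0 addr0.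
  - by move: W_ge; clear; lia.
  by apply: ok_nil; split=> //; do !apply: loaded_set.
case=> tr1 [s1 [e1 q1 sz1 [ld1 eq1 eb1]]].
have [tr2 [s2 [e2 q2 em2 sz2 ld2]]] := prints_output_loop wk ld1 (leq0n _) eq1 eb1.
exists (tr1 ++ tr2), s2; split=> //.
- rewrite -catA; apply: (ExecSeq e1); apply: (ExecSeq e2).
  by apply: (@ExecSeq _ _ _ _ _ _ [:: Eor] [:: Tick]); constructor.
- by rewrite /noEor all_cat; apply/andP; split=> //; exact: quiet_noEor.
- by rewrite emitted_cat quiet_emitted // em2 drop0 /encode -map_comp.
by rewrite size_cat; move: sz1 sz2 sz; clear; lia.
Qed.

Lemma segments_noEor t : noEor t -> segments t = [:: t].
Proof. by elim: t => //= -[|v|] //= t IH /IH; rewrite /segments /= => ->. Qed.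

Lemma segments_cat_Eor t tr : noEor t -> segments (t ++ Eor :: tr) = t :: segments tr.
Proof. by elim: t => //= -[|v|] //= t IH /IH; rewrite /segments /= => ->. Qed.

Lemma outputs_noEor t : noEor t -> outputs t = [::].
Proof. by move=> nt; rewrite /outputs segments_noEor. Qed.

Lemma outputs_cat_Eor t tr : noEor t ->
  outputs (t ++ Eor :: tr) = emitted t :: outputs tr.
Proof.
move=> nt; rewrite /outputs segments_cat_Eor //=.
have [g [gs ->]] : exists g gs, segments tr = g :: gs.
  by case: tr => [|[|v|] tr]; do 2!eexists.
by [].
Qed.

Lemma has_delay_cat_Eor d t tr : noEor t ->
  has_delay d (t ++ Eor :: tr) = ((size t).+1 <= d)%N && has_delay d tr.
Proof. by move=> nt; rewrite /has_delay segments_cat_Eor. Qed.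

Lemma has_delay_noEor d t : noEor t -> has_delay d t = ((size t).+1 <= d)%N.
Proof. by move=> nt; rewrite /has_delay segments_noEor //= andbT. Qed.

Definition gap_time := (I.+1 * back_time.+1 + I.+1 * try_time.+1 + 20)%N.
Definition delay_time := (gap_time + 13 * I + 20)%N.

Definition main_body := seqs [:: output_cmd; backtrack_cmd;
  If rf descend_cmd (seqs [:: Const rrun 0])].

(** Records end inside the loop body, so the time segments straddle iterations. The silent prefix
    [t] is the time already spent since the last record. *)
Lemma exec_main T w s : chain y a us0 w T ->
  backtrack y a us0 (last w T) None -> walks w -> at_node s w ->
  regs s rrun = 1 -> exists tr s', exec W (While rrun main_body) s tr s' /\
  forall t, quiet t -> (size t <= gap_time)%N ->
    outputs (t ++ tr) = [seq encode (map lin x) | x <- w :: T] /\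
    has_delay delay_time (t ++ tr).
Proof.
elim: T w s => [|w' T IH] w s /= ch bt wk ld er.
  have [t1 [s1 [e1 n1 em1 sz1 ld1]]] := exec_output wk ld.
  have [tr2 [s2 [e2 q2 sz2 ef2]]] := ok_backtrack bt wk ld1.
  exists (Tick :: ((t1 ++ [:: Eor; Tick]) ++ tr2 ++ (Tick :: [:: Tick; Tick]) ++ [:: Tick]) ++ [:: Tick]).
  exists (set_reg s2 rrun 0); split.
    apply: (ExecWhilePos (s2 := set_reg s2 rrun 0)); rewrite ?er //; last first.
      exact: ExecWhileNpos.
    apply: (ExecSeq e1); apply: (ExecSeq e2).
    apply: (ExecSeq (s2 := set_reg s2 rrun 0)); last exact: ExecSkip.
    apply: ExecIfNpos; first by rewrite ef2.
    apply: (@ExecSeq _ _ _ _ _ _ [:: Tick] [:: Tick]); last exact: ExecSkip.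
    exact: ExecConst.
  move=> t qt szt.
  have -> : t ++ (Tick :: ((t1 ++ [:: Eor; Tick]) ++ tr2 ++ (Tick :: [:: Tick; Tick]) ++ [:: Tick]) ++ [:: Tick])
     = (t ++ Tick :: t1) ++ Eor :: (Tick :: tr2 ++ nseq 5 Tick).
    by rewrite -!catA /= ?cat_cons -?catA.
  have q3 : quiet (Tick :: tr2 ++ nseq 5 Tick) by rewrite /quiet /= all_cat; apply/andP.
  have n3 : noEor (t ++ Tick :: t1).
    by rewrite /noEor all_cat; apply/andP; split=> //; exact: quiet_noEor.
  rewrite outputs_cat_Eor // has_delay_cat_Eor // outputs_noEor ?quiet_noEor //.
  rewrite has_delay_noEor ?quiet_noEor // emitted_cat quiet_emitted //.
  rewrite -[emitted (Tick :: t1)]/(emitted t1) em1; split=> //.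
  rewrite !size_cat /= ?size_cat /= /delay_time /gap_time; rewrite /gap_time in szt.
  move: (I.+1 * try_time.+1)%N (I.+1 * back_time.+1)%N szt sz2 sz1 => X Y.
  by clear; lia.
have [[ps bt' de] ch'] := ch.
have [t1 [s1 [e1 n1 em1 sz1 ld1]]] := exec_output wk ld.
have [tr2 [s2 [e2 q2 sz2 [ld2 ec2 ef2]]]] := ok_backtrack bt' wk ld1.
have wkp : walks ps := walk_backtrack bt' wk.
have [tr3 [s3 [e3 q3 sz3 ld3]]] := ok_descend de wkp ld2 ec2.
have wk' : walks w' := walk_descend de wkp.
have er3 : regs s3 rrun = 1.
  by rewrite (exec_unwritten e3) // (exec_unwritten e2) // (exec_unwritten e1).
have [tr4 [s4 [e4 H4]]] := IH w' s3 ch' bt wk' ld3 er3.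
exists (Tick :: ((t1 ++ [:: Eor; Tick]) ++ tr2 ++ (Tick :: tr3) ++ [:: Tick]) ++ tr4), s4; split.
  apply: (ExecWhilePos (s2 := s3) _ _ e4); first by rewrite er.
  apply: (ExecSeq e1); apply: (ExecSeq e2).
  apply: (ExecSeq (s2 := s3)); last exact: ExecSkip.
  by apply: ExecIfPos => //; rewrite ef2.
move=> t qt szt; pose t2 := Tick :: tr2 ++ Tick :: tr3 ++ [:: Tick].
have -> : t ++ (Tick :: ((t1 ++ [:: Eor; Tick]) ++ tr2 ++ (Tick :: tr3) ++ [:: Tick]) ++ tr4)
   = (t ++ Tick :: t1) ++ Eor :: (t2 ++ tr4).
  by rewrite /t2 -!catA /= ?cat_cons -?catA /= -?catA.
have q5 : quiet t2.
  by rewrite /quiet /= all_cat; apply/andP; split=> //=; rewrite all_cat; apply/andP.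
have sz5 : (size t2 <= gap_time)%N.
  rewrite /= size_cat /= size_cat /= /gap_time.
  by move: (I.+1 * try_time.+1)%N (I.+1 * back_time.+1)%N sz2 sz3 => X Y; clear; lia.
have [H5 H6] := H4 t2 q5 sz5.
have n3 : noEor (t ++ Tick :: t1).
  by rewrite /noEor all_cat; apply/andP; split=> //; exact: quiet_noEor.
rewrite outputs_cat_Eor // has_delay_cat_Eor // H5 H6 andbT.
rewrite emitted_cat quiet_emitted // -[emitted (Tick :: t1)]/(emitted t1) em1; split=> //.
rewrite !size_cat /= /delay_time; move: szt sz1; clear; lia.
Qed.

End Traversal.

(** * The first word and the initialization *)

Section FirstWord.
Variable m : nat.
Local Notation N := (m.+1).
Local Notation lin := (@lin m).
Implicit Types (p q h : int) (b i j : 'I_N) (D : {ffun 'I_N -> int})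
  (ps us w : seq int) (L : seq 'I_N).

(** Without a descent between [h] and [p] the targets increase there, and [noPass] moves along from
    line to line. *)
Lemma noPass_min D h p : injective (gp D) -> noPass D h -> h <= p ->
  p <= h + N%:Z - 2 -> (forall d, wdesc D h d -> p <= d) -> noPass D p.
Proof.
move=> iD nD hp pN mp.
have H (k : nat) : h + k%:Z <= p -> noPass D (h + k%:Z).
  elim: k => [|k IH] le; first by rewrite addr0.
  have nk : noPass D (h + k%:Z) by apply: IH; move: le; clear; lia.
  have -> : h + k.+1%:Z = h + k%:Z + 1 by clear; lia.
  have lt : gp D (h + k%:Z) < gp D (h + k%:Z + 1).
    rewrite ltNge le_eqVlt (inj_eq iD) negb_or; apply/andP; split; first by clear; lia.
    apply/negP => dk; have := mp (h + k%:Z); rewrite /wdesc /desc dk andbT.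
    by move: le pN; clear; lia.
  move=> q; have [->|ne] := eqVneq q (h + k%:Z) => // ltq.
  by apply: lt_trans lt; apply: nk; move: ltq ne; clear; lia.
have -> : p = h + `|(p - h)%R|%N%:Z by move: hp; clear; lia.
by apply: H; move: hp; clear; lia.
Qed.

Variables (y : {ffun 'I_N -> int}) (a : 'I_N) (us0 : seq int).
Hypothesis us0_sorted : path.sorted <%R us0.
Hypothesis mem_us0 : forall p, Posz a <= p -> p < Posz a + 2 * N%:Z -> over y p -> p \in us0.
Hypothesis ya_le : y (lin (Posz a)) <= N%:Z.

(** While no descent lies left of [lst - 1], the threshold hides nothing and the leftmost descent is
    taken. This persists, because crossing [p] does not affect the bars left of [p - 1]. *)
Lemma descend_leftmost ps w : descend y a us0 ps w ->
  reached y a (curD y a ps) (curh y a ps) ->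
  (forall d, wdesc (curD y a ps) (curh y a ps) d -> lst a ps - 1 <= d) ->
  exists2 r, w = ps ++ r & leftmost (curD y a ps) (map lin r).
Proof.
elim=> {w} {}ps; first by exists [::]; rewrite ?cats0.
move=> p w tp _ IH rD low.
have [wp cp mp _] := try_some us0_sorted mem_us0 ya_le rD tp.
have /and3P [w1 w2 dp] := wp.
have nb : lin p != ordS (lin p) by rewrite -lin_ordS (desc_neql dp).
have min d : wdesc (curD y a ps) (curh y a ps) d -> p <= d.
  by move=> wd; apply: mp => //; have := low d wd; clear; lia.
rewrite curD_rcons curh_rcons lst_rcons in IH.
have [||r -> lr] := IH; first exact: reached_step rD wp.
  move=> d wd; rewrite leNgt; apply/negP => lt; have /and3P [d1 d2 dd] := wd.
  have hp : nxt (curh y a ps) p = curh y a ps.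
    by move: d1; rewrite /nxt; case: eqP => // e; move: lt; rewrite e; clear; lia.
  rewrite hp in d1 d2.
  have dj : disj (lin p) (lin d).
    by rewrite disjC; apply: far_disj; move: w2 d1 lt; clear; lia.
  have : p <= d.
    apply: min; apply/and3P; split=> //.
    by move: dd; rewrite desc_lin !(step_disj _ dj) -desc_lin.
  by move: lt; clear; lia.
exists (p :: r); rewrite ?cat_rcons //=; split=> //.
have np := noPass_min (reached_inj rD) (reached_noPass rD) w1 w2 min.
have /lin_eqP [k ->] : lin (Posz (lin p)) == lin p by rewrite lin_ord.
exact: noPassD.
Qed.

End FirstWord.

(** * Choosing the cut and listing the bars in use *)

Section Init.
Variable m : nat.
Local Notation N := (m.+1).
Local Notation lin := (@lin m).
Implicit Types (p q h : int) (a b : 'I_N) (D : {ffun 'I_N -> int})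
  (ps us w : seq int) (L : seq 'I_N).
Variables (y : {ffun 'I_N -> int}) (I W : nat).
Hypothesis W_ge : (20 * (N + I + 2) <= W)%N.
Hypothesis y_bound : forall l, (`|y l| <= I)%N.

(** Only elements from [a] on are examined: by [noPass], one further left has a smaller target than
    [a]. *)
Definition overb (a : 'I_N) p :=
  has (fun k : nat => p < gp y (Posz a + k%:Z)) (iota 0 `|(p - Posz a)%R|.+1).

Definition us_of (a : 'I_N) (j : nat) :=
  [seq p <- [seq Posz a + k%:Z | k <- iota 0 j] | overb a p].

Lemma us_ofS a j : us_of a j.+1 =
  if overb a (Posz a + j%:Z) then rcons (us_of a j) (Posz a + j%:Z) else us_of a j.
Proof.
rewrite /us_of -[j.+1]addn1 iotaD map_cat filter_cat /= add0n.
by case: ifP; rewrite ?cats0 ?cats1.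
Qed.

Lemma mem_us_of a j p :
  (p \in us_of a j) = [&& Posz a <= p, p < Posz a + j%:Z & overb a p].
Proof.
rewrite mem_filter; apply/andP/and3P => [[ov /mapP [k kj e]]|[le lt ov]].
  by rewrite mem_iota in kj; split=> //; rewrite e; move: kj; clear; lia.
split=> //; apply/mapP; exists `|(p - Posz a)%R|%N; last by move: le; clear; lia.
by rewrite mem_iota; move: le lt; clear; lia.
Qed.

Lemma us_of_sorted a j : path.sorted <%R (us_of a j).
Proof.
apply: sorted_filter; first exact: lt_trans.
have H : {homo (fun k : nat => Posz a + k%:Z) : x x' / (x < x')%N >-> x < x'} by clear; move=> x x'; lia.
exact: homo_sorted H _ (iota_ltn_sorted 0 j).
Qed.

Lemma size_us_of a j : (size (us_of a j) <= j)%N.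
Proof. by rewrite size_filter (leq_trans (count_size _ _)) // size_map size_iota. Qed.

Lemma overb_over a p : Posz a <= p -> overb a p -> over y p.
Proof.
move=> le /hasP [k]; rewrite mem_iota => /andP [_ lt] H.
by exists (Posz a + k%:Z) => //; move: le lt; clear; lia.
Qed.

Lemma over_overb a p : noPass y (Posz a) -> Posz a <= p -> over y p -> overb a p.
Proof.
move=> np le [q qp H]; apply/hasP.
have [aq|qa] := leP (Posz a) q.
  exists `|(q - Posz a)%R|%N; first by rewrite mem_iota; move: aq qp; clear; lia.
  by have -> : Posz a + `|(q - Posz a)%R|%N%:Z = q by move: aq; clear; lia.
exists 0%N; first by rewrite mem_iota.
by rewrite addr0; apply: lt_trans H (np q qa).
Qed.

(** Each listed bar occurs in [L] and has at most two lifts in two periods. This bound makes the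
    cost of a scan independent of n. *)
Lemma size_us_of_red a L : red y L -> (size (us_of a (2 * N)) <= 2 * size L)%N.
Proof.
move=> rL; pose f p := (lin p, p < Posz a + N%:Z).
have -> : (2 * size L = size [seq (b, x) | b <- L, x <- [:: true; false]])%N.
  by rewrite size_allpairs mulnC.
rewrite -(size_map f); apply: uniq_leq_size.
  rewrite map_inj_in_uniq; first exact: (sorted_uniq lt_trans ltxx (us_of_sorted _ _)).
  move=> p q; rewrite !mem_us_of => /and3P [p1 p2 _] /and3P [q1 q2 _] [/eqP/lin_eqP [k e] e2].
  move: e2 p1 p2 q1 q2; rewrite e; clear; case: (mulN_cases m k) => [->|?|?]; lia.
move=> x /mapP [p]; rewrite mem_us_of => /and3P [le _ /(overb_over le) ov] ->.
by apply/allpairsP; exists (f p); rewrite (over_used rL ov) !inE; split=> //; case: (f p).2.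
Qed.

Definition arg_inv (k : nat) s := exists2 a : 'I_N,
  loaded s y (Posz a) [::] [::] &
  [/\ regs s rcnt = k, regs s rmn = y a, (k <= N)%N & forall l : 'I_N, (k <= l)%N -> y l <= y a].

Lemma ok_arg_body k s : arg_inv k.+1 s -> ok W (seqs
   [:: Op Defs.Sub rcnt rcnt r1; Op Add rt rn rcnt; Read rv rt; Op Defs.Sub rz rv rmn;
       If rz (seqs [:: Op Add rmn rv r0; Op Add rh rcnt r0]) Skip]) s 9 (arg_inv k).
Proof.
case=> a ld [ek em kN ma]; have HW := W_ge; have kN' := kN; pose l := Ordinal kN.
have lN := ltn_ord l.
have bl := y_bound l; have ba := y_bound a.
apply: (ok_op (v := Posz k)); first by rewrite /= ek (ld_1 ld); clear; lia.
  by move: kN' HW; clear; lia.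
apply: (ok_op (v := Posz (N + l))); first by rewrite /= /update /= (ld_n ld); clear; lia.
  by move: lN HW; clear; lia.
apply: (ok_read (k := N + l) (v := y l)) => //; first by rewrite (ld_D ld).
apply: (ok_op (v := y l - y a)); first by rewrite /= /update /= em.
  by move: bl ba HW; clear; lia.
apply: ok_if_last => w; rewrite /= /update /= in w.
  apply: (ok_op (v := y l)); first by rewrite /= /update /= (ld_0 ld) addr0.
    by move: bl HW; clear; lia.
  apply: (ok_op (v := Posz l)); first by rewrite /= /update /= (ld_0 ld) addr0.
    by move: lN HW; clear; lia.
  apply: ok_nil; exists l; first by apply: (loaded_h (h := Posz a)); do !apply: loaded_set.
  split=> //; first exact: ltnW.
  move=> l'; rewrite leq_eqVlt => /orP [/eqP e|/ma le].
    by have -> : l' = l by apply/val_inj.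
  by apply: le_trans le _; move: w; clear; lia.
apply: ok_nil; exists a; first by do !apply: loaded_set.
split=> //; first exact: ltnW.
move=> l'; rewrite leq_eqVlt => /orP [/eqP e|/ma //].
by have -> : l' = l by [apply/val_inj]; move: w; clear; lia.
Qed.

(** The running maximum [g] starts at [a], possibly no target; this selects no bar, since the bars
    tested are at least [a]. *)
Definition us_inv a (k : nat) s := exists (j : nat) (g : int),
  [/\ loaded s y (Posz a) (us_of a j) [::], regs s rcnt = k, (k + j = 2 * N)%N,
      regs s rp = Posz a + j%:Z &
      [/\ regs s rmn = g, Posz a <= g, (`|g| <= 3 * N + I)%N,
        forall i : nat, (i < j)%N -> gp y (Posz a + i%:Z) <= g &
        g = Posz a \/ exists2 i : nat, (i < j)%N & gp y (Posz a + i%:Z) = g]].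

Lemma ok_us_body a k s : us_inv a k.+1 s -> ok W (seqs
    [:: target_of rv rp; Op Defs.Sub rz rv rmn;
        If rz (seqs [:: Op Add rmn rv r0]) Skip;
        Op Defs.Sub rz rmn rp;
        If rz (seqs [:: Op Add rt rnn ru; Write rt rp; Op Add ru ru r1]) Skip;
        Op Add rp rp r1; Op Defs.Sub rcnt rcnt r1]) s 30 (us_inv a k).
Proof.
case=> j [g [ld ek kj ep [eg ag bg mg wg]]]; have HW := W_ge; have la := ltn_ord a.
set p := Posz a + j%:Z in ep; have bp := y_bound (lin p).
have p4 : 0 <= p <= 3 * N%:Z by rewrite /p; move: kj la; clear; lia.
have bgp : (`|gp y p| <= 3 * N + I)%N by rewrite /gp; move: bp p4; clear; lia.
apply: (ok_target_of W_ge (p := p) (D := y)) => // [|||t u v z x].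
- exact: ld_n ld.
- by move: p4; clear; lia.
- exact: ld_D ld.
apply: (ok_op (v := gp y p - g)); first by rewrite /= /update /= eg.
  by move: bg bgp HW; clear; lia.
pose g' := Num.max g (gp y p).
have bg' : (`|g'| <= 3 * N + I)%N by rewrite /g' maxEle; case: ifP.
have ov : overb a p = (p < g').
  have -> : overb a p = has (fun k0 : nat => p < gp y (Posz a + k0%:Z)) (iota 0 j.+1).
    by rewrite /overb; congr has; congr iota; rewrite /p; clear; lia.
  rewrite -[j.+1]addn1 iotaD has_cat /= add0n orbF -/p /g' lt_max; congr (_ || _).
  apply/hasP/idP => [[i]|lt].
    by rewrite mem_iota => /andP [_ ij] H; apply: lt_le_trans H (mg i ij).
  case: wg => [e|[i ij e]]; first by move: lt; rewrite e /p; clear; lia.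
  by exists i; rewrite ?mem_iota ?e.
have rest s1 : loaded s1 y (Posz a) (us_of a j) [::] -> regs s1 rcnt = k.+1 ->
   regs s1 rp = p -> regs s1 rmn = g' ->
   ok W (seqs [:: Op Defs.Sub rz rmn rp;
        If rz (seqs [:: Op Add rt rnn ru; Write rt rp; Op Add ru ru r1]) Skip;
        Op Add rp rp r1; Op Defs.Sub rcnt rcnt r1]) s1 16 (us_inv a k).
  move=> ld1 ek1 ep1 eg1; have su := size_us_of a j.
  have last s2 : loaded s2 y (Posz a) (us_of a j.+1) [::] -> regs s2 rcnt = k.+1 ->
     regs s2 rp = p -> regs s2 rmn = g' ->
     ok W (seqs [:: Op Add rp rp r1; Op Defs.Sub rcnt rcnt r1]) s2 9 (us_inv a k).
    move=> ld2 ek2 ep2 eg2.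
    apply: (ok_op (v := p + 1)); first by rewrite /= ep2 (ld_1 ld2).
      by move: p4 HW; clear; lia.
    apply: (ok_op (v := Posz k)); first by rewrite /= /update /= ek2 (ld_1 ld2); clear; lia.
      by move: kj HW; clear; lia.
    apply: ok_nil; exists j.+1, g'; split=> //.
    - by do !apply: loaded_set.
    - by move: kj; clear; lia.
    - by rewrite /= /update /= /p; clear; lia.
    split=> //; first by rewrite le_max ag.
      move=> i; rewrite ltnS leq_eqVlt le_max => /orP [/eqP ->|/mg ->] //.
      by rewrite lexx orbT.
    rewrite /g' maxEle; case: ifP => _; first by right; exists j.
    by case: wg => [->|[i ij e]]; [left|right; exists i => //; apply: ltnW].
  apply: (ok_op (v := g' - p)); first by rewrite /= /update /= eg1 ep1.
    by move: bg' p4 HW; clear; lia.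
  rewrite us_ofS -/p ov in last.
  apply: (ok_if_cons (T1 := 5) (T2 := 9)) => w; rewrite /= /update /= in w.
    have lt : p < g' by move: w; clear; lia.
    rewrite lt in last.
    apply: (ok_op (v := Posz (2 * N + size (us_of a j)))).
    - by rewrite /= /update /= (ld_nn ld1) (ld_u ld1).
    - by move: su kj HW; clear; lia.
    apply: (ok_write (k := 2 * N + size (us_of a j)) (v := p)) => //.
    apply: (ok_op (v := Posz (size (us_of a j)).+1)).
    - by rewrite /= /update /= (ld_u ld1) (ld_1 ld1); clear; lia.
    - by move: su kj HW; clear; lia.
    apply: ok_nil; apply: last => //.
    case: ld1 => *; split=> //=; rewrite ?size_rcons // /update.
    + by move=> l; rewrite ifN //; have := ltn_ord l; clear; lia.
    + move=> i; rewrite ltnS leq_eqVlt eqn_add2l nth_rcons => /orP [/eqP ->|ij].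
        by rewrite eqxx ltnn.
      by rewrite ij ifN ?neq_ltn ?ij //; auto.
  have nlt : (p < g') = false by move: w; clear; lia.
  by rewrite nlt in last; apply: ok_nil; apply: last => //; do !apply: loaded_set.
apply: (ok_if_cons (T1 := 4) (T2 := 16)) => w; rewrite /= /update /= in w.
  apply: (ok_op (v := gp y p)); first by rewrite /= /update /= (ld_0 ld) addr0.
    by move: bgp HW; clear; lia.
  apply: ok_nil; apply: rest => //; first by do !apply: loaded_set.
  by rewrite /= /update /= /g' max_r //; move: w; clear; lia.
apply: ok_nil; apply: rest => //; first by do !apply: loaded_set.
by rewrite /= /update /= eg /g' max_l //; move: w; clear; lia.
Qed.

Lemma initial_memory (pi : 'S_N) (l : 'I_N) :
  memory (initial_state pi y) (N + l)%N = y l.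
Proof.
rewrite /= /input_mem nth_cat size_map size_enum_ord ltnNge leq_addr /= addKn.
by rewrite (nth_map l) ?size_enum_ord // nth_ord_enum.
Qed.

Lemma ok_init (pi : 'S_N) : ok W init_cmd (initial_state pi y) (72 * N + 20) (fun s' =>
  exists a : 'I_N, [/\ forall l, y l <= y a,
    loaded s' y (Posz a) (us_of a (2 * N)) [::] & regs s' rc = Posz a - 2]).
Proof.
have HW := W_ge; have b0 := y_bound ord0.
suff H : ok W init_cmd (initial_state pi y)
    (6 + ((N * 10).+1 + (3 + ((2 * N * 31).+1 + 2)))) (fun s' =>
  exists a : 'I_N, [/\ forall l, y l <= y a,
    loaded s' y (Posz a) (us_of a (2 * N)) [::] & regs s' rc = Posz a - 2]).
  by apply: ok_mono H _ _ => //; lia.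
apply: ok_const; first by move: HW; clear; lia.
apply: ok_const; first by move: HW; clear; lia.
apply: (ok_op (v := Posz (2 * N))); first by rewrite /= /update /=; clear; lia.
  by move: HW; clear; lia.
apply: (ok_op (v := Posz (4 * N))); first by rewrite /= /update /=; clear; lia.
  by move: HW; clear; lia.
have m0 : memory (initial_state pi y) N = y ord0.
  by have := initial_memory pi ord0; rewrite [(_ + _)%N]addn0.
apply: (ok_read (k := N) (v := y ord0)) => //.
apply: (ok_op (v := Posz N)); first by rewrite /= /update /= addr0.
  by move: HW; clear; lia.
set s1 := set_reg _ _ _.
have ld1 : loaded s1 y (Posz 0) [::] [::].
  by split=> // l; rewrite -(initial_memory pi l).
apply: ok_cons; apply: ok_mono (ok_while (I := arg_inv) (T := 9) _ _ (k := N) _) _ _ => //.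
- by move=> k s [a _ []].
- by move=> k s; apply: ok_arg_body.
- by exists ord0 => //; split=> // l; rewrite leqNgt ltn_ord.
move=> s2 [a ld2 [_ ea _ ma]]; have la := ltn_ord a.
have ma' l : y l <= y a by apply: ma.
apply: (ok_op (v := Posz a)); first by rewrite /= (ld_h ld2) (ld_0 ld2) addr0.
  by move: la HW; clear; lia.
apply: (ok_op (v := Posz a)); first by rewrite /= /update /= (ld_h ld2) (ld_0 ld2) addr0.
  by move: la HW; clear; lia.
apply: (ok_op (v := Posz (2 * N))); first by rewrite /= /update /= (ld_nn ld2) (ld_0 ld2) addr0.
  by move: HW; clear; lia.
apply: ok_cons; apply: ok_mono (ok_while (I := us_inv a) (T := 30) _ _ (k := 2 * N) _) _ _ => //.
- by move=> k s [j [g []]].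
- by move=> k s; apply: ok_us_body.
- exists 0%N, (Posz a); split=> //.
  + by do !apply: loaded_set.
  + by rewrite addn0.
  + by rewrite addr0.
  by split=> //; [move: la; clear; lia|left].
move=> s3 [j [g [ld3 _ kj _ _]]].
have ej : j = (2 * N)%N by [].
rewrite ej in ld3.
apply: (ok_op (v := Posz a - 2)); first by rewrite /= (ld_h ld3) (ld_2 ld3).
  by move: la HW; clear; lia.
by apply: ok_nil; exists a; split=> //; do !apply: loaded_set.
Qed.

End Init.

(** * Travel of a single pseudoline *)

Section Bound.
Variable m : nat.
Local Notation N := (m.+1).
Implicit Types (i j : 'I_N) (L : seq 'I_N) (s : 'S_N).

(** Each move to the right passes another element, a different one every time. *)
Lemma disp_le s L i : proper L -> simple s L -> disp s L i <= N%:Z.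
Proof.
move=> pL sL; rewrite /disp; set cs := crossings_from s L.
suff : (count (fun c => c.1 == i) cs <= N)%N by move: (count _ _) (count _ _) => x z; clear; lia.
pose js := [seq c.2 | c <- cs & c.1 == i].
have -> : count (fun c => c.1 == i) cs = size js by rewrite size_map size_filter.
rewrite -[leqRHS]card_ord; suff /card_uniqP <- : uniq js by apply: max_card.
apply: count_mem_uniq => j; rewrite -has_pred1 has_count.
suff : (count_mem j js <= 1)%N by case: (count_mem j js) => [|[|]].
rewrite count_map count_filter.
have [eij|ne] := eqVneq i j; last first.
  apply: leq_trans (sL i j ne); apply: sub_count => -[x z] /= /andP [/eqP -> /eqP ->].
  by rewrite /meet eqxx.
rewrite leqNgt; apply/negP => /(leq_trans (isT : (0 < 2)%N)); rewrite -has_count.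
case/hasP => -[x z] /(crossings_neq pL) /= nxz /andP [/eqP e1 /eqP e2].
by rewrite e1 e2 eij eqxx in nxz.
Qed.

End Bound.

(** * Assembly and constants *)

Section Assembly.
Variable m : nat.
Local Notation N := (m.+1).
Local Notation lin := (@lin m).
Variables (pi : 'S_N) (y : {ffun 'I_N -> int}).
Let I := inv_dv y.
Let W := ((N + I + 2) ^ 4)%N.

Lemma W_large : (20 * (N + I + 2) <= W)%N.
Proof.
rewrite /W expnSr leq_mul2r; apply/orP; right.
(* [N + I + 2] is at least 3 and [3 ^ 3 = 27]: hence the exponent 4. *)
by rewrite (leq_trans (_ : 20 <= 3 ^ 3)%N) // leq_exp2r //; clear; lia.
Qed.

Lemma square_succ_le (k : nat) : (k.+1 * k.+1 <= 4 * maxn 1 (k ^ 2))%N.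
Proof.
case: k => // k; rewrite (maxn_idPr _) ?expn_gt0 // expnS expn1; clear; nia.
Qed.

Lemma leq_max_square (k : nat) : (k <= maxn 1 (k ^ 2))%N.
Proof. by case: k => // k; rewrite leq_max -{2}[k.+1]expn1 leq_pexp2l ?orbT. Qed.

Lemma max_square_le (k : nat) : (maxn 1 (k ^ 2) <= k ^ 3 + 1)%N.
Proof.
rewrite geq_max addn1 /=; case: k => // k; apply: leqW.
by rewrite leq_pexp2l.
Qed.

(** [61 u + k <= 122 (I + 1)], and squaring [I + 1] costs a factor 4. Here 61 is a scan step with
    its loop test, and 111 the overhead of one iteration of backtracking. *)
Lemma scan_cost (u k : nat) : (u <= 2 * I)%N -> (k <= 111)%N ->
  (I.+1 * (61 * u + k) <= 488 * maxn 1 (I ^ 2))%N.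
Proof.
move=> uI k1; apply: (@leq_trans (122 * (I.+1 * I.+1))%N).
  by rewrite mulnCA leq_mul2l; apply/orP; right; move: uI k1; clear; lia.
by rewrite (_ : 488 = 122 * 4)%N // -mulnA leq_mul2l square_succ_le.
Qed.

Lemma enumerate_lotteries : almost_optimal pi y ->
  exists R Ls tr1 tr2 s1 s2,
    [/\ is_root pi y R,
        forall R', is_root pi y R' -> same_arrangement R R',
        [/\ exec W root_cmd (initial_state pi y) tr1 s1,
            outputs tr1 = [:: encode R]
          & (size tr1 <= 1100 * (N + I ^ 3))%N]
      & [/\ exec W enumerate_cmd s1 tr2 s2,
            outputs tr2 = [seq encode L | L <- Ls],
            enumerates pi y Ls
          & has_delay (1100 * maxn 1 (I ^ 2)) tr2]].
Proof.
case=> L0 lL0; have [rL0 nD] := lottery_red lL0; have HW := W_large.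
have y_size L : red y L -> (size L <= I)%N.
  by move=> rL; apply: (@size_le_inv _ pi); apply: red_lottery lL0 rL.
have y_bound l : (`|y l| <= I)%N := leq_trans (red_bound l rL0) (y_size _ rL0).
have [tr0 [s0 [e0 q0 sz0 [a [ya ld0 ec0]]]]] := ok_init HW y_bound pi.
have np : noPass y (Posz a).
  by move=> q qa; have := ya (lin q); rewrite /gp lin_ord; move: qa; clear; lia.
have yaN : y (lin (Posz a)) <= N%:Z.
  have := disp_le a (red_proper rL0) (red_simple 1%g rL0 nD).
  by rewrite lin_ord (red_disp 1%g rL0) ffunE perm1.
pose us0 := us_of y a (2 * N).
have us_sorted : path.sorted <%R us0 := us_of_sorted y a _.
have us_mem p : Posz a <= p -> p < Posz a + 2 * N%:Z -> over y p -> p \in us0.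
  move=> p1 p2 ov; rewrite mem_us_of p1 over_overb // andbT.
  by move: p2; clear; lia.
have us_bound p : p \in us0 -> Posz a <= p < Posz a + 2 * N%:Z.
  by rewrite mem_us_of => /and3P [-> H _]; move: H; clear; lia.
have us_size : (size us0 <= 2 * I)%N.
  by apply: leq_trans (size_us_of_red a rL0) _; rewrite leq_mul2l y_size.
have us_size' : (size us0 <= 2 * N)%N by apply: size_us_of.
have y_total := red_total rL0; have y_inj := red_gp_inj rL0.
have rch0 : reached y a y (Posz a) by apply: reached0.
have node0 : node y a [::].
  split=> //; move=> d /and3P [d1 _ _]; rewrite /lst /=.
  by move: d1; rewrite /curh /=; clear; lia.
have [w [T [dw chw uw mw bw]]] := lists_tree_node us_sorted us_mem yaN node0.
have valid x : x \in w :: T -> vld y (Posz a) x.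
  by case/mw => r [-> v _].
have lott x : x \in w :: T -> lottery1_dv pi y (map lin x).
  by move=> /valid /vld_red rx; apply: red_lottery lL0 rx.
have ww : w \in w :: T by rewrite mem_head.
pose R := map lin w; have lR := lott w ww; have [rR _] := lottery_red lR.
have lmR : leftmost y R.
  have [||r ew lr] := descend_leftmost us_sorted us_mem yaN dw; first exact: rch0.
    move=> d /and3P [d1 _ _]; rewrite /lst /=.
    by move: d1; rewrite /curh /=; clear; lia.
  by rewrite /R ew.
have wk0 : walk y (Posz a) [::] by [].
have wkw : walk y (Posz a) w := vld_walk (valid w ww).
have ld0' : at_node y a us0 s0 [::] by [].
have Hd := ok_descend HW us_sorted us_mem us_bound us_size' yaN y_total y_inj np y_size dw wk0 ld0' ec0.
have [tr1 [s1 [e1 q1 sz1 ld1]]] := Hd.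
have [t2 [s2 [e2 n2 em2 sz2 ld2]]] := exec_output HW us_mem us_bound us_size' yaN y_total y_inj np y_size wkw ld1.
have ld3 : at_node y a us0 (set_reg s2 rrun 1) w by apply: loaded_set.
have [tr3 [s3 [e3 H3]]] := exec_main HW us_sorted us_mem us_bound us_size' yaN y_total y_inj np y_size chw (bw _ (BackNil y a us0)) wkw ld3 erefl.
(* The single tick is the instruction that sets [rrun] before the loop. *)
have [H4 H5] := H3 [:: Tick] isT isT.
exists R, [seq map lin x | x <- w :: T].
exists (tr0 ++ (tr1 ++ ((t2 ++ [:: Eor; Tick]) ++ [:: Tick]))), ([:: Tick] ++ tr3), s2, s3.
split.
- rewrite /is_root lR; apply/forallP => i; apply/forallP => j; apply/forallP => k.
  apply/negP => /left_tangled_LT [u [v [x]]].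
  by apply/negP; apply: leftmost_noLT rR nD lmR.
- move=> R' /andP [/lottery_red [rR' _] /forallP nt]; apply/same_arrangementP.
  apply: (root_unique rR lmR nD rR') => u v x; apply/negP => /LT_left_tangled.
  by apply/negP; move/forallP/(_ v)/forallP/(_ x): (nt u).
- split.
  + apply: (ExecSeq e0); apply: (ExecSeq e1); apply: (ExecSeq e2); exact: ExecSkip.
  + rewrite (_ : _ ++ _ = (tr0 ++ tr1 ++ t2) ++ Eor :: [:: Tick; Tick]); last first.
      by rewrite -!catA.
    rewrite outputs_cat_Eor; last first.
      by rewrite /noEor !all_cat; apply/and3P; split=> //; exact: quiet_noEor.
    by rewrite !emitted_cat (quiet_emitted q0) (quiet_emitted q1) em2.
  + rewrite !size_cat /=; move: sz0 sz1 sz2; rewrite /try_time => sz0 sz1 sz2.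
    have := scan_cost us_size (isT : (61 <= 111)%N); rewrite [(_ + 61)%N]addnS.
    have := max_square_le I; have := leq_max_square I.
    move: (maxn 1 _) (I ^ 3)%N (I.+1 * _)%N sz0 sz1 sz2 => M K X; clear; lia.
split=> //.
- apply: (ExecSeq _ e3); exact: ExecConst.
- by rewrite H4 -map_comp.
- split; first by apply/allP => L /mapP [x /lott Hx ->].
  move=> L lL; have [rL _] := lottery_red lL.
  have [x vx ex] := red_vld rL np.
  have [x' [vx' ex' sx']] := normal_exists 1%g vx.
  have x'T : x' \in w :: T.
    apply/mw; exists x'; split=> //.
    case: (x') sx' vx' => //= p z -> /and3P [le _ _]; rewrite andbT /leR /lst /=.
    by move: le; clear; lia.
  have eL : eqr 1%g L (map lin x') by rewrite -ex.
  (* Among the listed normal words, having the arrangement of [L] singles out [x'], which occurs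
     once. *)
  rewrite -[RHS](_ : count_mem x' (w :: T) = 1%N); last by rewrite count_uniq_mem // x'T.
  rewrite count_map; apply: eq_in_count => z zT /=.
  apply/same_arrangementP/eqP => [eLz|-> //].
  apply: normal_uniq (valid z zT) vx' _ sx' (eqr_trans (eqr_sym eLz) eL).
  by case/mw: zT => r [-> _ /path_sorted].
(* Climbing and descending take 488 units each; printing and fixed overheads fit in the remaining
   124, all in multiples of [maxn 1 (I ^ 2)]. *)
- apply: sub_all H5 => g /leq_trans -> //.
  rewrite /delay_time /gap_time /back_time /try_time.
  have := scan_cost us_size (isT : (61 <= 111)%N); rewrite [(_ + 61)%N]addnS.
  have := scan_cost us_size (isT : (111 <= 111)%N).
  rewrite -[111%N]/(60 + 50).+1 addnS addnA.
  have := leq_max_square I; have : (0 < maxn 1 (I ^ 2))%N by rewrite leq_max.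
  by move: (maxn 1 _) (I.+1 * _)%N (I.+1 * _)%N => M X Y; clear; lia.
Qed.

End Assembly.

Local Close Scope ring_scope.

Theorem theorem3 :
  exists (construct_root enumerate : cmd) (C e : nat),
  forall (n : nat) (pi : 'S_n) (y : {ffun 'I_n -> int}),
  0 < n -> almost_optimal pi y ->
  exists (R : seq 'I_n) (Ls : seq (seq 'I_n))
         (tr1 tr2 : seq step) (s1 s2 : state),
    let W := (n + inv_dv y + 2) ^ e in
    [/\ is_root pi y R,
        forall R' : seq 'I_n, is_root pi y R' -> same_arrangement R R',
        [/\ exec W construct_root (initial_state pi y) tr1 s1,
            outputs tr1 = [:: encode R]
          & size tr1 <= C * (n + inv_dv y ^ 3)]
      & [/\ exec W enumerate s1 tr2 s2,
            outputs tr2 = [seq encode L | L <- Ls],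
            enumerates pi y Ls
          & has_delay (C * maxn 1 (inv_dv y ^ 2)) tr2]].
Proof.
exists root_cmd, enumerate_cmd, 1100%N, 4%N => -[|m] // pi y _.
exact: enumerate_lotteries.
Qed.
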